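(* Let $\mathscr F$ be a characteristic class and let $u\colon\mathbb N\to\mathbb C$ be a bounded arithmetic function. If $u$ satisfies the Veech condition with respect to $\mathscr F$, that is, if for each Furstenberg system $\kappa\in V_S(u)$ the function $\pi_0$ is orthogonal in $L^2(X_u,\kappa)$ to $L^2\big((\mathcal B(X_u),\kappa)_{\mathscr F}\big)$, then $u\perp\mathscr C_{\mathscr F}$.
   Context: A topological dynamical system $(X,T)$ is a homeomorphism $T$ of a compact metric space $X$. A measure-theoretic dynamical system $(Z,\mathcal D,\kappa,R)$ is an invertible measure-preserving transformation $R$ of a standard Borel probability space $(Z,\mathcal D,\kappa)$. A $T$-invariant Borel probability measure $\nu$ on $X$ is visible, written $\nu\in V(X,T)$, if there are $x\in X$ and an increasing sequence $(N_\ell)$ of integers with $\frac1{N_\ell}\sum_{n\le N_\ell}\delta_{T^nx}\to\nu$ weak-$*$. A class $\mathscr F$ of measure-theoretic dynamical systems is characteristic if it is closed under taking isomorphisms, factors and (countable) joinings; every characteristic class contains the one-point system. An $\mathscr F$-factor of $(Z,\mathcal D,\kappa,R)$ is an invariant sub-$\sigma$-algebra of $\mathcal D$ on which the action of $R$ yields a system in $\mathscr F$; there is always a largest $\mathscr F$-factor, denoted $\mathcal D_{\mathscr F}$ (or $(\mathcal D,\kappa)_{\mathscr F}$ to indicate the measure). $\mathscr C_{\mathscr F}$ denotes the class of topological systems $(X,T)$ such that $(X,\mathcal B(X),\nu,T)\in\mathscr F$ for each $\nu\in V(X,T)$. $u\perp(X,T)$ means $\lim_{N\to\infty}\frac1N\sum_{n\le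 N}f(T^nx)u(n)=0$ for all $f\in C(X)$ and $x\in X$; $u\perp\mathscr C$ means $u\perp(X,T)$ for every $(X,T)\in\mathscr C$. Let $|u|\le L$. Extend $u$ to $\mathbb Z$ by $u(-n)=u(n)$ for $n\in\mathbb N$ and any $u(0)\in\mathbb D_L:=\{z\in\mathbb C:|z|\le L\}$. Let $S$ be the left shift on $\mathbb D_L^{\mathbb Z}$ and $X_u:=\overline{\{S^ku:k\in\mathbb Z\}}$. $V_S(u)$ is the set of all weak-$*$ limits of $\frac1{N_\ell}\sum_{n\le N_\ell}\delta_{S^nu}$ along increasing sequences $(N_\ell)$; each $\kappa\in V_S(u)$ gives a system $(X_u,\mathcal B(X_u),\kappa,S)$, called a Furstenberg system of $u$. $\pi_0\colon X_u\to\mathbb C$ is $\pi_0(z)=z_0$. *)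

(* Defs.v *)
From HB Require Import structures.
From mathcomp Require Import all_boot all_order all_algebra.
From mathcomp Require Import all_classical all_reals all_analysis.
From mathcomp Require Import complex.

Set Implicit Arguments.
Unset Strict Implicit.
Unset Printing Implicit Defensive.

Import Order.TTheory GRing.Theory Num.Theory.
Import numFieldNormedType.Exports.

Local Open Scope classical_set_scope.
Local Open Scope ring_scope.
Local Open Scope complex_scope.

(* Measurable types of the library are pointed, so phase spaces are taken
   nonempty; orthogonality to the empty system would hold vacuously. *)
#[short(type="pmetricType")]
HB.structure Definition PointedMetric (K : numDomainType) :=
  {M of Metric K M & isPointed M}.

(* The topology of the modulus on the complex numbers. *)
HB.instance Definition _ (R : rcfType) := NormedModule.copy R[i] R[i]^o.

Section systems.
Variable R : realType.

(* Only the data; the axioms of a measure-theoretic system are [is_mds]. *)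
Record system := System {
  sys_disp : measure_display;
  sys_space : measurableType sys_disp;
  sys_prob : probability sys_space R;
  sys_map : sys_space -> sys_space }.

(* A complete pseudometric structure with a Hausdorff topology is a complete
   metric one, so [P] below is an arbitrary nonempty Polish space. *)
Definition standard_borel d (Z : measurableType d) : Prop :=
  exists P : completePseudoMetricType R,
    [/\ hausdorff_space P,
        (exists2 D : set P, countable D & dense D) &
        exists (h : Z -> P) (k : P -> Z),
          [/\ cancel h k, cancel k h,
              (forall B, <<s (@open P) >> B -> measurable (h @^-1` B)) &
              (forall A, measurable A -> <<s (@open P) >> (k @^-1` A))]].

Definition measure_preserving d d' (Z : measurableType d)
    (Y : measurableType d') (kappa : probability Z R) (lambda : probability Y R)
    (p : Z -> Y) : Prop :=
  measurable_fun setT p /\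
  forall B, measurable B -> kappa (p @^-1` B) = lambda B.

Definition is_mds (s : system) : Prop :=
  [/\ standard_borel (sys_space s),
      measure_preserving (sys_prob s) (sys_prob s) (@sys_map s) &
      exists2 T' : sys_space s -> sys_space s, measurable_fun setT T' &
        cancel (@sys_map s) T' /\ cancel T' (@sys_map s)].

Definition factor_map (s t : system) (p : sys_space s -> sys_space t) : Prop :=
  measure_preserving (sys_prob s) (sys_prob t) p /\
  {ae sys_prob s, forall z, p (sys_map z) = sys_map (p z)}.

Definition is_factor_of (t s : system) : Prop :=
  exists p : sys_space s -> sys_space t, factor_map p.

Definition isomorphic (s t : system) : Prop :=
  exists (p : sys_space s -> sys_space t) (q : sys_space t -> sys_space s),
    [/\ factor_map p, factor_map q,
        {ae sys_prob s, forall z, q (p z) = z} &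
        {ae sys_prob t, forall y, p (q y) = y}].

Definition cylinders (I : Type) (Z : I -> system) :
    set (set (forall i, sys_space (Z i))) :=
  [set C | exists (i : I) (A : set (sys_space (Z i))),
     measurable A /\ C = (fun z => z i) @^-1` A].

Definition prod_space (I : Type) (Z : I -> system) :=
  g_sigma_algebraType (@cylinders I Z).

Definition prod_map (I : Type) (Z : I -> system) (z : prod_space Z) :
    prod_space Z := fun i => sys_map (z i).

Definition is_joining (I : Type) (Z : I -> system)
    (rho : probability (prod_space Z) R) : Prop :=
  measure_preserving rho rho (@prod_map I Z) /\
  forall i, measure_preserving rho (sys_prob (Z i)) (fun z => z i).

(* Countable joinings include finite ones; the joining indexed by an empty [I]
   is the one-point system. *)
Definition characteristic (F : system -> Prop) : Prop :=
  [/\ forall s, F s -> is_mds s,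
      forall s t, F s -> is_mds t -> isomorphic s t -> F t,
      forall s t, F s -> is_mds t -> is_factor_of t s -> F t &
      forall (I : countType) (Z : I -> system)
             (rho : probability (prod_space Z) R),
        (forall i, F (Z i)) -> is_joining rho -> F (System rho (@prod_map I Z))].

(* The action on [G] is represented by a standard Borel system [t] together
   with a factor map whose pulled back sigma-algebra is [G] up to null sets.
   Consequently adding to [G] all null sets of [s] does not affect whether it
   is an [F]-factor, so that the largest one for inclusion contains them. *)
Definition is_F_factor (F : system -> Prop) (s : system)
    (G : set (set (sys_space s))) : Prop :=
  [/\ sigma_algebra setT G,
      G `<=` measurable,
      (forall A, G (@sys_map s @^-1` A) <-> G A) &
      exists (t : system) (p : sys_space s -> sys_space t),
        [/\ F t, factor_map p,
            (forall C, measurable C -> exists2 A,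
               G A & sys_prob s (A `+` p @^-1` C) = 0%E) &
            (forall A, G A -> exists2 C,
               measurable C & sys_prob s (A `+` p @^-1` C) = 0%E)]].

Definition is_largest_F_factor (F : system -> Prop) (s : system)
    (G : set (set (sys_space s))) : Prop :=
  is_F_factor F G /\ forall G', is_F_factor F G' -> G' `<=` G.

Definition cintegral d (Z : measurableType d) (kappa : probability Z R)
    (f : Z -> R[i]) : R[i] :=
  (\int[kappa]_z complex.Re (f z)) +i* (\int[kappa]_z complex.Im (f z)).

(* Square-integrable functions measurable for the sub-sigma-algebra [G]. *)
Definition L2 d (Z : measurableType d) (kappa : probability Z R)
    (G : set (set Z)) (f : Z -> R[i]) : Prop :=
  (forall U : set R[i], open U -> G (f @^-1` U)) /\
  (\int[kappa]_z ((ComplexField.Normc.normc (f z)) ^+ 2)%:E < +oo)%E.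

Definition L2_inner d (Z : measurableType d) (kappa : probability Z R)
    (f g : Z -> R[i]) : R[i] := cintegral kappa (fun z => f z * (g z)^*).

Definition borel (X : ptopologicalType) := g_sigma_algebraType (@open X).

(* Weak-* convergence to [nu] of the averages over [1 <= n <= N l] of the Dirac
   masses at [T^n x]. *)
Definition quasi_generic (X : ptopologicalType) (T : X -> X) (x : X)
    (N : nat -> nat) (nu : probability (borel X) R) : Prop :=
  forall f : X -> R[i], continuous f ->
    (fun l => (N l)%:R^-1 * \sum_(1 <= n < (N l).+1) f (iter n T x)) @ \oo
      --> cintegral nu (f : borel X -> R[i]).

Definition homeomorphism (X : topologicalType) (T : X -> X) : Prop :=
  continuous T /\
  exists2 T' : X -> X, continuous T' & cancel T T' /\ cancel T' T.

Record tds := Tds {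
  tds_space : pmetricType R;
  tds_map : tds_space -> tds_space;
  tds_compact : compact [set: tds_space];
  tds_homeo : homeomorphism tds_map }.

Definition borel_system (X : ptopologicalType) (T : X -> X)
    (nu : probability (borel X) R) : system := @System _ (borel X) nu T.

Definition visible (X : tds) (nu : probability (borel (tds_space X)) R) :
    Prop :=
  measure_preserving nu nu (@tds_map X : borel _ -> borel _) /\
  exists (x : tds_space X) (N : nat -> nat),
    {homo N : m n / (m < n)%N} /\ quasi_generic (@tds_map X) x N nu.

Definition class_C (F : system -> Prop) (X : tds) : Prop :=
  forall nu, visible nu -> F (borel_system (@tds_map X) nu).

(* Arithmetic functions are indexed by the positive integers; the value of
   [u : nat -> R[i]] at [0] is never used, here or in [extend]. *)
Definition orthogonal_to (u : nat -> R[i]) (X : tds) : Prop :=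
  forall (f : tds_space X -> R[i]) (x : tds_space X), continuous f ->
    (fun N : nat => N%:R^-1 * \sum_(1 <= n < N.+1) f (iter n (@tds_map X) x) * u n)
      @ \oo --> (0 : R[i]).

Definition orthogonal_to_class (u : nat -> R[i]) (C : tds -> Prop) : Prop :=
  forall X, C X -> orthogonal_to u X.

Definition bisequence := prod_topology (fun _ : int => R[i]).

Definition extend (u : nat -> R[i]) (u0 : R[i]) : bisequence :=
  fun k => if k == 0 then u0 else u `|k|%N.

Definition shift_by (k : int) (z : bisequence) : bisequence :=
  fun n => z (n + k).

(* For [v] with values in the closed disc of radius [L], this is also the
   closure in the product of copies of that disc, which is closed. *)
Definition orbit_closure (v : bisequence) : set bisequence :=
  closure [set shift_by k v | k in [set: int]].

Lemma orbit_closure_refl (v : bisequence) : orbit_closure v v.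
Proof.
apply: subset_closure; exists 0 => //.
by apply/funext => n; rewrite /shift_by addr0.
Qed.

Lemma cvg_bisequence (T : Type) (A : set_system T) (g : T -> bisequence)
    (z : bisequence) : Filter A ->
  (forall n, (fun t => g t n) @ A --> z n) -> g @ A --> z.
Proof.
move=> FA gz.
apply/(@cvg_sup _ _ (fun i => Topological.class
    (initial_topology (fun f : int -> R[i] => f i))) (g @ A) z).
move=> i U /=.
rewrite (@nbhsE (initial_topology (fun f : int -> R[i] => f i))).
move=> [V [[W oW WV] Vz] VU]; apply: filterS VU _; rewrite -WV.
by apply: (gz i); apply: open_nbhs_nbhs; split => //; move: Vz; rewrite -WV.
Qed.

Lemma shift_by_continuous k : continuous (shift_by k).
Proof.
move=> z.
apply (@cvg_bisequence bisequence (nbhs z) (shift_by k) (shift_by k z)).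
  exact: nbhs_filter.
move=> n.
exact: (@proj_continuous int (fun=> R[i]) (n + k) z).
Qed.

Lemma orbit_closure_shift (v z : bisequence) :
  orbit_closure v z -> orbit_closure v (shift_by 1 z).
Proof.
move=> vz B /shift_by_continuous /vz [_ [[k _ <-] Bk]].
exists (shift_by (1 + k) v); split; first by exists (1 + k).
by congr B: Bk; apply/funext => n; rewrite /shift_by addrA.
Qed.

Definition Xspace (v : bisequence) := set_type (orbit_closure v).

Definition Xbase (v : bisequence) : Xspace v :=
  SigSub (mem_set (@orbit_closure_refl v)).

HB.instance Definition _ (v : bisequence) := Topological.on (Xspace v).
HB.instance Definition _ (v : bisequence) :=
  isPointed.Build (Xspace v) (Xbase v).

Definition Xshift v (z : Xspace v) : Xspace v :=
  SigSub (mem_set (orbit_closure_shift (set_valP z))).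

Definition in_VS (v : bisequence) (kappa : probability (borel (Xspace v)) R) :
    Prop :=
  exists2 N : nat -> nat, {homo N : m n / (m < n)%N} &
    quasi_generic (@Xshift v) (Xbase v) N kappa.

Definition pi0 v (z : borel (Xspace v)) : R[i] := (set_val z : bisequence) 0.

Definition veech (F : system -> Prop) (v : bisequence) : Prop :=
  forall kappa : probability (borel (Xspace v)) R, in_VS kappa ->
  forall G, is_largest_F_factor F (s := borel_system (@Xshift v) kappa) G ->
  forall f, L2 kappa G f -> L2_inner kappa (@pi0 v) f = 0.

End systems.

(* Main.v *)
From HB Require Import structures.
Require Import Defs.
From mathcomp Require Import all_boot all_order all_algebra.
From mathcomp Require Import all_classical all_reals all_analysis.
From mathcomp Require Import complex.
From mathcomp Require Import measurable_realfun lra ring zify.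

(** Suppose that the averages of [f (T^n x) * u n] stay away from 0 for
    infinitely many [N]. Along a subsequence the empirical measures of the pairs
    formed by [T^n x] and the [n]-th shift of [u] converge to a joining of a
    visible measure [nu] of [X] with a Furstenberg system [kappa] of [u], and the
    integral of [f * pi0] for this joining is not 0 ([empirical_limit],
    [visible_decode_point], [in_VS_decode_sequence]). By assumption [X] with [nu]
    belongs to the class [F]. Since [pi0] depends on the second coordinate only,
    [f] may be replaced by its conditional expectation [h] given this coordinate.
    If [h] is measurable for the largest [F]-factor of [kappa], the Veech
    condition forces the integral to vanish ([joining_orthogonality],
    [joint_limit_orthogonal]), a contradiction.

    Why [h] is measurable for the largest [F]-factor: take infinitely many copies
    of the point of [X], independent given the second coordinate [z]. Their law
    is a countable joining of copies of [nu], so it defines a system of [F]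
    ([F_self_joining]). By the law of large numbers [h z] is almost surely the
    limit of the averages of [f] over the copies. Hence a sublevel set of [h] is
    decided both by [z] and by the system of copies; the factor that it generates
    is a common factor of both, thus in [F] ([common_factor],
    [cond_expect_F_measurable]). A largest [F]-factor exists because the measure
    algebra is separable: countably many factors in [F] suffice, and their
    joining is in [F] ([universal_F_factor], [largest_F_factor_exists]).

    All limits are taken on the Cantor space. The orbit of [x], through a
    continuous surjection from the Cantor space to [X], and the sequence [u],
    through binary expansions, are written into one point of the Cantor space on
    which the dynamics permutes the coordinates ([permute_joint_code]). Measures
    are then given by the probabilities of cylinders, and a consistent family of
    weights of cylinders is realised as the law of a branch of nested intervals
    chosen by a uniform variable ([path_law]). Weights that depend measurably on
    a parameter are handled in the same way; this gives conditional laws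
    ([disintegration]) and, with many independent uniform variables extracted
    from one ([iid]), the relatively independent self-joining. *)

Set Implicit Arguments.
Unset Strict Implicit.
Unset Printing Implicit Defensive.

Import Order.TTheory GRing.Theory Num.Theory.
Import numFieldNormedType.Exports.

Local Open Scope classical_set_scope.
Local Open Scope ring_scope.
Local Open Scope complex_scope.

(** * Bounded measurable functions on a probability space *)

Definition law d d' (T : measurableType d) (T' : measurableType d')
    (R : realType) (P : probability T R) (f : T -> T')
    (mf : measurable_fun setT f) : probability T' R :=
  distribution P (mfun_Sub (mem_set mf)).

Lemma lawE d d' (T : measurableType d) (T' : measurableType d')
    (R : realType) (P : probability T R) (f : T -> T')
    (mf : measurable_fun setT f) A : law P mf A = P (f @^-1` A).
Proof. by []. Qed.

(** The measure structure of a pushforward depends on the proof that the map is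
    measurable, so it cannot be inferred from the map alone. *)
Definition image_measure d d' (T : measurableType d) (T' : measurableType d')
    (R : realType) (m : {measure set T -> \bar R}) (f : T -> T')
    (mf : measurable_fun setT f) : {measure set T' -> \bar R} :=
  measure_function_pushforward__canonical__measure_function_Measure m mf.

Lemma image_measureE d d' (T : measurableType d) (T' : measurableType d')
    (R : realType) (m : {measure set T -> \bar R}) (f : T -> T')
    (mf : measurable_fun setT f) A : image_measure m mf A = m (f @^-1` A).
Proof. by []. Qed.

Definition bounded_mfun d (T : measurableType d) (R : realType) (f : T -> R) :=
  measurable_fun setT f /\ exists M, forall x, `|f x| <= M.

Section bounded_mfun.
Context d (T : measurableType d) (R : realType).
Implicit Types (f g : T -> R) (P : probability T R).

Lemma bounded_mfun_int P f : bounded_mfun f -> P.-integrable setT (EFin \o f).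
Proof.
move=> [mf [M fM]]; apply: measurable_bounded_integrable => //.
  by rewrite (le_lt_trans (probability_le1 P measurableT)) ?ltry.
exists M; split; first exact: num_real.
by move=> N MN x _; apply: (le_trans (fM x)); exact: ltW.
Qed.

Lemma bounded_mfunD f g : bounded_mfun f -> bounded_mfun g ->
  bounded_mfun (fun x => f x + g x).
Proof.
move=> [mf [M fM]] [mg [N gN]]; split; first exact: measurable_funD.
by exists (M + N) => x; rewrite (le_trans (ler_normD _ _))// lerD.
Qed.

Lemma bounded_mfunN f : bounded_mfun f -> bounded_mfun (fun x => - f x).
Proof.
move=> [mf [M fM]]; split; first exact: measurableT_comp.
by exists M => x; rewrite normrN.
Qed.

Lemma bounded_mfunB f g : bounded_mfun f -> bounded_mfun g ->
  bounded_mfun (fun x => f x - g x).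
Proof. by move=> bf bg; exact: bounded_mfunD (bounded_mfunN bg). Qed.

Lemma bounded_mfunM f g : bounded_mfun f -> bounded_mfun g ->
  bounded_mfun (fun x => f x * g x).
Proof.
move=> [mf [M fM]] [mg [N gN]]; split; first exact: measurable_funM.
by exists (M * N) => x; rewrite normrM ler_pM.
Qed.

Lemma bounded_mfun_cst r : bounded_mfun (fun _ : T => r : R).
Proof. by split; [exact: measurable_cst|exists `|r|]. Qed.

Lemma bounded_mfun_indic A : measurable A -> bounded_mfun (\1_A : T -> R).
Proof.
move=> mA; split; first exact: measurable_indic.
by exists 1 => x; rewrite indicE; case: (_ \in _); rewrite ?normr0 ?normr1.
Qed.

Lemma bounded_mfun_sum (I : Type) (s : seq I) (F : I -> T -> R) :
  (forall i, bounded_mfun (F i)) -> bounded_mfun (fun x => \sum_(i <- s) F i x).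
Proof.
move=> bF; elim: s => [|i s IH].
  by under eq_fun do rewrite big_nil; exact: bounded_mfun_cst.
by under eq_fun do rewrite big_cons; exact: bounded_mfunD.
Qed.

Lemma expect_indic P A : measurable A -> \int[P]_x (\1_A x : R) = fine (P A).
Proof. by move=> mA; rewrite /Rintegral integral_indic// setIT. Qed.

Lemma expect_cst P r : \int[P]_x r = r :> R.
Proof.
by rewrite Rintegral_cst// (_ : fine _ = 1) ?mulr1//; exact: (congr1 fine (@probability_setT _ _ _ P)).
Qed.

Lemma expectD P f g : bounded_mfun f -> bounded_mfun g ->
  \int[P]_x (f x + g x) = \int[P]_x f x + \int[P]_x g x.
Proof. by move=> bf bg; rewrite RintegralD//; exact: bounded_mfun_int. Qed.

Lemma expectB P f g : bounded_mfun f -> bounded_mfun g ->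
  \int[P]_x (f x - g x) = \int[P]_x f x - \int[P]_x g x.
Proof. by move=> bf bg; rewrite RintegralB//; exact: bounded_mfun_int. Qed.

Lemma expectZl P r f : bounded_mfun f ->
  \int[P]_x (r * f x) = r * \int[P]_x f x.
Proof. by move=> bf; rewrite RintegralZl//; exact: bounded_mfun_int. Qed.

Lemma expectZr P r f : bounded_mfun f ->
  \int[P]_x (f x * r) = \int[P]_x f x * r.
Proof. by move=> bf; rewrite RintegralZr//; exact: bounded_mfun_int. Qed.

Lemma expect_sum P (I : Type) (s : seq I) (F : I -> T -> R) :
  (forall i, bounded_mfun (F i)) ->
  \int[P]_x (\sum_(i <- s) F i x) = \sum_(i <- s) \int[P]_x F i x.
Proof.
move=> bF; elim: s => [|i s IH].
  by under eq_Rintegral do rewrite big_nil; rewrite expect_cst big_nil.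
under eq_Rintegral do rewrite big_cons.
by rewrite big_cons expectD// ?IH//; exact: bounded_mfun_sum.
Qed.

Lemma le_expect P f g : bounded_mfun f -> bounded_mfun g ->
  (forall x, f x <= g x) -> \int[P]_x f x <= \int[P]_x g x.
Proof. by move=> bf bg fg; apply: le_Rintegral => //; exact: bounded_mfun_int. Qed.

Lemma ae_eq_expect P f g : bounded_mfun f -> bounded_mfun g ->
  {ae P, forall x, f x = g x} -> \int[P]_x f x = \int[P]_x g x.
Proof.
move=> [mf _] [mg _] fg; congr fine; apply: ae_eq_integral => //.
- exact/measurable_EFinP.
- exact/measurable_EFinP.
- by apply: filterS fg => x /= -> _.
Qed.

Lemma EFin_expect P f : bounded_mfun f ->
  (\int[P]_x (f x)%:E)%E = (\int[P]_x f x)%:E.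
Proof.
by move=> bf; rewrite fineK//; apply: integrable_fin_num => //; exact: bounded_mfun_int.
Qed.

Lemma expect_bounded P f M : bounded_mfun f -> (forall x, `|f x| <= M) ->
  `|\int[P]_x f x| <= M.
Proof.
move=> bf fM; rewrite ler_norml; apply/andP; split.
  rewrite -(expect_cst P (- M)); apply: le_expect => //.
    exact: bounded_mfun_cst.
  by move=> x; have := fM x; rewrite ler_norml => /andP[].
rewrite -(expect_cst P M); apply: le_expect => //.
  exact: bounded_mfun_cst.
by move=> x; have := fM x; rewrite ler_norml => /andP[].
Qed.

End bounded_mfun.

Lemma bounded_mfun_comp d d' (T : measurableType d) (T' : measurableType d')
    (R : realType) (g : T' -> R) (f : T -> T') :
  bounded_mfun g -> measurable_fun setT f -> bounded_mfun (g \o f).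
Proof.
by move=> [mg [M gM]] mf; split; [exact: measurableT_comp|exists M => x; exact: gM].
Qed.

Lemma expect_law d d' (T : measurableType d) (T' : measurableType d')
    (R : realType) (P : probability T R) (f : T -> T')
    (mf : measurable_fun setT f) (g : T' -> R) : measurable_fun setT g ->
  bounded_mfun (g \o f) -> \int[law P mf]_x g x = \int[P]_x g (f x).
Proof.
move=> mg bg; congr fine; rewrite integral_distribution//.
  exact/measurable_EFinP.
exact: bounded_mfun_int bg.
Qed.

Section fubini_bounded.
Context d1 d2 (T1 : measurableType d1) (T2 : measurableType d2) (R : realType).
Variables (P : probability T1 R) (Q : probability T2 R).
Variable f : T1 * T2 -> R.
Hypothesis bf : bounded_mfun f.

Let bfx x : bounded_mfun (fun y => f (x, y)).
Proof.
case: bf => mf [M fM]; split; last by exists M => y; exact: fM.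
exact: measurableT_comp mf (measurable_pair1 x).
Qed.

Lemma bounded_mfun_fubini : bounded_mfun (fun x => \int[Q]_y f (x, y)).
Proof.
split.
  have /measurable_fubini_F h := bounded_mfun_int (P \x Q)%E bf.
  apply/measurable_EFinP; apply: eq_measurable_fun h => x _ /=.
  by rewrite /fubini_F /= EFin_expect.
case: bf => mf [M fM]; exists M => x; apply: expect_bounded => // y; exact: fM.
Qed.

Lemma expect_prod :
  \int[(P \x Q)%E]_z f z = \int[P]_x \int[Q]_y f (x, y).
Proof.
congr fine; rewrite -integral12_prod_meas1; last exact: bounded_mfun_int bf.
by apply: eq_integral => x _; rewrite /fubini_F /= EFin_expect.
Qed.

End fubini_bounded.

(** * Cylinders in the Cantor space *)

Definition cyl (s : seq bool) : set cantor_space :=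
  [set b | mkseq b (size s) = s].

Notation cantor_borel := (borel cantor_space).

Lemma cantor_cvg (F : set_system cantor_space) (b : cantor_space) : Filter F ->
  (forall n, \forall c \near F, (c : nat -> bool) n = b n) -> F --> b.
Proof.
move=> FF Fb.
apply/(@cvg_sup _ _ (fun i => Topological.class
    (initial_topology (fun f : nat -> bool => f i))) F b).
move=> i U /=; rewrite (@nbhsE (initial_topology (fun f : nat -> bool => f i))).
move=> [V [[W oW WV] Vb] VU]; apply: filterS VU _; rewrite -WV.
by apply: filterS (Fb i) => c /= ->; move: Vb; rewrite -WV.
Qed.

Lemma mkseq_inj (b c : nat -> bool) n :
  mkseq b n = mkseq c n -> forall i, (i < n)%N -> b i = c i.
Proof. by move=> bc i ilt; rewrite -(nth_mkseq false b ilt) bc nth_mkseq. Qed.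

Lemma eq_mkseq_lt (b c : nat -> bool) n :
  (forall i, (i < n)%N -> b i = c i) -> mkseq b n = mkseq c n.
Proof.
move=> bc; apply: (@eq_from_nth _ false); rewrite !size_mkseq// => i ilt.
by rewrite !nth_mkseq// bc.
Qed.

Lemma take_mkseq (b : nat -> bool) m n :
  (m <= n)%N -> take m (mkseq b n) = mkseq b m.
Proof. by move=> mn; rewrite /mkseq -map_take take_iota (minn_idPl mn). Qed.

Lemma cyl_mkseq (b : nat -> bool) n : cyl (mkseq b n) b.
Proof. by rewrite /cyl /= size_mkseq. Qed.

Lemma cyl_nbhs (U : set cantor_space) (b : cantor_space) : nbhs b U ->
  exists n, cyl (mkseq b n) `<=` U.
Proof.
move=> Ub; apply: contrapT => /forallNP noU.
have /choice[c cP] n : exists c, cyl (mkseq b n) c /\ ~ U c.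
  by have /existsNP[c /not_implyP[]] : ~ (cyl (mkseq b n) `<=` U) := noU n; exists c.
have cb : c @ \oo --> b.
  apply: cantor_cvg => n; exists n.+1 => // m /= nm.
  have [+ _] := cP m; rewrite /cyl /= size_mkseq => /mkseq_inj; apply.
  exact: leq_trans nm.
have [n _ /(_ n (leqnn n))] := cb _ Ub.
by have [] := cP n.
Qed.

Lemma proj_cantor_nbhs (b : cantor_space) n : \forall c \near b, (c : nat -> bool) n = b n.
Proof.
apply: (@proj_continuous nat (fun=> bool) n b [set b n]).
by apply: open_nbhs_nbhs; split => //; exact: discrete_open.
Qed.

Lemma nbhs_cyl (b : cantor_space) n : \forall c \near b, mkseq c n = mkseq b n.
Proof.
elim: n => [|n IH]; first by near=> c.
apply: filterS2 IH (proj_cantor_nbhs b n) => c.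
by rewrite !mkseqS => -> ->.
Unshelve. all: end_near. Qed.

Lemma open_cyl s : open (cyl s).
Proof.
rewrite openE => b bs; apply: filterS (nbhs_cyl b (size s)) => c /=.
by rewrite /cyl /= bs.
Qed.

Lemma closed_cyl s : closed (cyl s).
Proof.
rewrite -[cyl s]setCK; apply: open_closedC; rewrite openE => b bs.
by apply: filterS (nbhs_cyl b (size s)) => c /= cb; rewrite /cyl /= cb.
Qed.

Lemma open_bigcup_cyl (U : set cantor_space) : open U ->
  U = \bigcup_(s in [set s | cyl s `<=` U]) cyl s.
Proof.
rewrite openE => oU; apply/seteqP; split=> [b Ub|b [s sU /sU//]].
have [n nU] := cyl_nbhs (oU _ Ub).
by exists (mkseq b n) => //; exact: cyl_mkseq.
Qed.

Lemma measurable_open (X : ptopologicalType) (U : set X) :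
  open U -> measurable (U : set (borel X)).
Proof. by move=> oU; exact: sub_sigma_algebra. Qed.

Lemma measurable_closed (X : ptopologicalType) (U : set X) :
  closed U -> measurable (U : set (borel X)).
Proof.
by move=> cU; rewrite -[U]setCK; apply: measurableC; apply: measurable_open; exact: closed_openC.
Qed.

Lemma measurable_cyl s : measurable (cyl s : set cantor_borel).
Proof. exact: measurable_open (open_cyl s). Qed.

Lemma bigcup_pickle (T : Type) (I : countType) (D : set I) (F : I -> set T) :
  \bigcup_(i in D) F i =
  \bigcup_n oapp (fun i => if `[< D i >] then F i else set0) set0 (unpickle n).
Proof.
apply/seteqP; split=> x [i Di Fx].
  by exists (pickle i) => //; rewrite pickleK /= asboolT.
move: Fx; case: (unpickle i) => //= j; case: asboolP => // Dj Fx.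
by exists j.
Qed.

Lemma bigcup_count_measurable d (T : measurableType d) (I : countType)
    (D : set I) (F : I -> set T) : (forall i, D i -> measurable (F i)) ->
  measurable (\bigcup_(i in D) F i).
Proof.
move=> mF; rewrite bigcup_pickle.
apply: bigcup_measurable => n _; case: (unpickle n) => //= i.
by case: asboolP => // /mF.
Qed.

Lemma bigcup_count_measure0 d (T : measurableType d) (R : realType)
    (mu : {measure set T -> \bar R}) (I : countType)
    (D : set I) (F : I -> set T) : (forall i, D i -> measurable (F i)) ->
  (forall i, D i -> mu (F i) = 0%E) -> mu (\bigcup_(i in D) F i) = 0%E.
Proof.
move=> mF F0; have mU := bigcup_count_measurable mF; move: mU.
rewrite bigcup_pickle => mU; apply/eqP; rewrite -measure_le0.
apply: (le_trans (generalized_Boole_inequality mu _ mU)) => [n|].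
  by case: (unpickle n) => //= i; case: asboolP => // /mF.
rewrite eseries0// => n _ _; case: (unpickle n) => [i|] /=; last exact: measure0.
by case: asboolP => [/F0//|_]; exact: measure0.
Qed.

(** Open sets are countable unions of cylinders. *)
Lemma cantor_borelE : @measurable _ cantor_borel = <<s range cyl >>.
Proof.
apply/seteqP; split; last first.
  apply: smallest_sub; first exact: smallest_sigma_algebra.
  by move=> _ [s _ <-]; apply: sub_sigma_algebra; exact: open_cyl.
apply: smallest_sub; first exact: smallest_sigma_algebra.
move=> U /open_bigcup_cyl ->.
apply: (@bigcup_count_measurable _ (g_sigma_algebraType (range cyl))) => s _.
by apply: sub_sigma_algebra; exists s.
Qed.

Lemma measurable_cantor d (T : measurableType d) (f : T -> cantor_borel) :
  (forall s, measurable (f @^-1` cyl s)) -> measurable_fun setT f.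
Proof.
move=> mf; have := @measurability _ _ T cantor_borel setT f (range cyl) cantor_borelE.
apply => _ [_ [s _ <-] <-].
by rewrite setTI.
Qed.

(** Closure under intersection, up to the empty set, is what lets the cylinders
    determine a measure. *)
Lemma cylI s t : cyl s `&` cyl t = set0 \/ cyl s `&` cyl t = cyl s \/
  cyl s `&` cyl t = cyl t.
Proof.
have main s' t' : (size s' <= size t')%N ->
    cyl s' `&` cyl t' = set0 \/ cyl s' `&` cyl t' = cyl t'.
  move=> st; have [ts|ts] := eqVneq (take (size s') t') s'; [right|left].
    apply/setIidPr => b /= bt; rewrite /cyl /= -[RHS]ts -bt.
    by rewrite take_mkseq.
  apply/seteqP; split=> // b /= [bs bt]; move: ts; rewrite -bt -bs.
  by rewrite size_mkseq take_mkseq// eqxx.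
have [st|/ltnW ts] := leqP (size s) (size t).
  by case: (main _ _ st) => ->; [left|right; right].
by rewrite setIC; case: (main _ _ ts) => ->; [left|right; left].
Qed.

Lemma finite_measure_unique d (T : measurableType d) (R : realType)
    (G : set (set T)) (m1 m2 : {measure set T -> \bar R}) :
  @measurable _ T = <<s G >> -> setI_closed G ->
  (m1 setT < +oo)%E -> m1 setT = m2 setT ->
  (forall A, G A -> m1 A = m2 A) -> forall A, measurable A -> m1 A = m2 A.
Proof.
move=> mG GI fin tot PQ; pose H := G `|` [set setT].
apply: (measure_unique H (fun=> setT)) => //.
- rewrite mG; apply/seteqP; split.
    apply: smallest_sub; first exact: smallest_sigma_algebra.
    by move=> A GA; apply: sub_sigma_algebra; left.
  apply: smallest_sub; first exact: smallest_sigma_algebra.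
  move=> A [GA|->]; first exact: sub_sigma_algebra.
  exact: (@measurableT _ (g_sigma_algebraType G)).
- move=> A B [GA|->] [GB|->]; rewrite ?setIT ?setTI; [left; exact: GI|by left|by left|by right].
- by move=> _; right.
- by rewrite bigcup_const.
- by move=> A [/PQ//|->].
Qed.

Lemma probability_unique d (T : measurableType d) (R : realType)
    (G : set (set T)) (P Q : probability T R) :
  @measurable _ T = <<s G >> -> setI_closed G ->
  (forall A, G A -> P A = Q A) -> forall A, measurable A -> P A = Q A.
Proof.
move=> mG GI PQ; apply: (finite_measure_unique mG GI) => //.
  by rewrite (le_lt_trans (probability_le1 P measurableT)) ?ltry.
by apply: (etrans (@probability_setT _ _ _ P)); exact/esym/probability_setT.
Qed.

Lemma cantor_measure_unique (R : realType)
    (m1 m2 : {measure set cantor_borel -> \bar R}) : (m1 setT < +oo)%E ->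
  (forall s, m1 (cyl s) = m2 (cyl s)) -> forall A, measurable A -> m1 A = m2 A.
Proof.
move=> fin m12; have cyl0 : cyl [::] = setT by apply/seteqP; split.
pose G := range cyl `|` [set set0].
apply: (@finite_measure_unique _ cantor_borel R G) => //.
- rewrite cantor_borelE; apply/seteqP; split.
    apply: smallest_sub; first exact: smallest_sigma_algebra.
    by move=> A GA; apply: sub_sigma_algebra; left.
  apply: smallest_sub; first exact: smallest_sigma_algebra.
  move=> _ [[s _ <-]|->]; first by apply: sub_sigma_algebra; exists s.
  exact: (@measurable0 _ (g_sigma_algebraType (range cyl))).
- move=> _ _ [[s _ <-]|->] [[t _ <-]|->]; rewrite ?set0I ?setI0; try by right.
  by case: (cylI s t) => [->|[->|->]]; [right|left; exists s|left; exists t].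
- by rewrite -cyl0.
- by move=> _ [[s _ <-]|->]; rewrite ?measure0.
Qed.

(** * Random points of the Cantor space driven by a uniform variable *)

Definition unif (R : realType) : probability (measurableTypeR R) R :=
  uniform_prob (@ltr01 R).

Lemma unif_itv (R : realType) (a b : R) : 0 <= a -> a <= b -> b <= 1 ->
  unif R `[a, b[%classic = (b - a)%:E.
Proof.
move=> a0 ab b1.
have := @integral_uniform R 0 1 ltr01 (EFin \o \1_`[a, b[).
rewrite integral_indic//= setIT => ->.
- rewrite subr0 invr1 mul1e integral_indic//= setIidl ?lebesgue_measure_itv /=.
    rewrite lte_fin; case: ltrP => [_|ba]; first by rewrite EFinB.
    by have -> : a = b by [apply/eqP; rewrite eq_le ab]; rewrite subrr.
  move=> x; rewrite /= !in_itv /= => /andP[ax xb].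
  by rewrite (le_trans a0 ax) (le_trans (ltW xb) b1).
- by apply/measurable_EFinP; exact: measurable_indic.
- by move=> x; rewrite lee_fin indicE.
Qed.

Lemma unif_setI01 (R : realType) (A : set (measurableTypeR R)) :
  measurable A -> unif R A = unif R (A `&` `[0, 1[%classic).
Proof.
move=> mA; have m01 : measurable (`[0, 1[%classic : set (measurableTypeR R)) by [].
rewrite (measureDI _ mA m01) [X in (X + _)%E](_ : _ = 0%E) ?add0e//.
apply/eqP; rewrite -measure_le0.
have -> : 0%E = unif R (~` `[0, 1[%classic).
  by rewrite probability_setC// unif_itv// subr0 subee.
by apply: le_measure; rewrite ?inE//; [exact: measurableD|exact: measurableC].
Qed.

Section tree_path.
Context d (Z : measurableType d) (R : realType).
Variable w : seq bool -> Z -> R.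
Hypothesis w_nil : forall z, w [::] z = 1.
Hypothesis w_ge0 : forall s z, 0 <= w s z.
Hypothesis wD : forall s z, w s z = w (rcons s false) z + w (rcons s true) z.
Hypothesis mw : forall s, measurable_fun setT (w s).

(** The intervals of length [w s z], placed side by side in lexicographic order
    for each length of [s], are nested: the interval of [s] starts here and is cut
    in two by those of [rcons s false] and [rcons s true]. *)
Definition left_end (s : seq bool) z :=
  \sum_(i < size s | nth false s i) w (rcons (take i s) false) z.

Lemma left_end_rcons s b z : left_end (rcons s b) z =
  left_end s z + if b then w (rcons s false) z else 0.
Proof.
rewrite /left_end size_rcons big_mkcond big_ord_recr /= -big_mkcond /=.
rewrite nth_rcons ltnn eqxx -cats1 take_size_cat//; congr (_ + _).
apply: eq_big => i; first by rewrite nth_cat ltn_ord.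
by rewrite nth_cat ltn_ord => _; rewrite takel_cat// ltnW.
Qed.

Lemma left_end_ge0 s z : 0 <= left_end s z.
Proof. by apply: sumr_ge0 => i _; exact: w_ge0. Qed.

Lemma right_end_le1 s z : left_end s z + w s z <= 1.
Proof.
elim/last_ind: s => [|s b IH]; first by rewrite /left_end big_ord0 add0r w_nil.
apply: le_trans IH; rewrite left_end_rcons -addrA lerD2l [leRHS]wD.
by case: b; rewrite ?add0r ?lerDl ?w_ge0.
Qed.

Lemma measurable_left_end s : measurable_fun setT (left_end s).
Proof.
rewrite (_ : left_end s = fun z => \sum_(i < size s)
    if nth false s i then w (rcons (take i s) false) z else 0); last first.
  by apply/funext => z; exact: big_mkcond.
apply: measurable_sum => i; case: (nth _ _ _); first exact: mw.
exact: measurable_cst.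
Qed.

Fixpoint path_prefix (p : Z * measurableTypeR R) n : seq bool :=
  if n is m.+1 then
    let s := path_prefix p m in
    rcons s (left_end s p.1 + w (rcons s false) p.1 <= p.2)
  else [::].

(** The branch of nested intervals that contain [p.2]. A cylinder is then pulled
    back to an interval whose length is the prescribed weight, so a uniform
    variable is sent to a random point with these cylinder probabilities, and the
    dependence on the parameter [p.1] is measurable by construction. *)
Definition tree_path (p : Z * measurableTypeR R) : cantor_space := fun n =>
  let s := path_prefix p n in left_end s p.1 + w (rcons s false) p.1 <= p.2.

Lemma mkseq_path p n : mkseq (tree_path p) n = path_prefix p n.
Proof. by elim: n => // n IH; rewrite mkseqS IH. Qed.

Lemma path_cyl p s : 0 <= p.2 < 1 ->
  cyl s (tree_path p) <-> left_end s p.1 <= p.2 < left_end s p.1 + w s p.1.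
Proof.
move=> p01; rewrite /cyl /= mkseq_path; elim/last_ind: s => [|s b IH].
  by rewrite /left_end big_ord0 add0r w_nil p01.
rewrite size_rcons /=; set t := path_prefix p (size s) in IH *.
have wsp := w_ge0 (rcons s false) p.1; have ws := wD s p.1.
have wst := w_ge0 (rcons s true) p.1.
split=> [/rcons_inj[ts]|].
  have /andP[l1 l2] := IH.1 ts; rewrite ts left_end_rcons.
  by case: b; [move=> ?; apply/andP; split|move/negbT; rewrite -ltNge => ?; apply/andP; split]; lra.
rewrite left_end_rcons => /andP[l1 l2].
have ts : t = s by apply/IH; apply/andP; split; move: l1 l2; case: b; lra.
rewrite ts; congr rcons; move: l1 l2.
by case: b => l1 l2; [|apply/negbTE; rewrite -ltNge]; lra.
Qed.

Lemma measurable_path : measurable_fun setT (tree_path : _ -> cantor_borel).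
Proof.
have mle s : measurable_fun setT (fun p : Z * measurableTypeR R =>
    left_end s p.1 + w (rcons s false) p.1 <= p.2).
  apply: measurable_fun_ler; last exact: measurable_snd.
  apply: measurable_funD; apply: measurableT_comp measurable_fst => //.
  exact: measurable_left_end.
apply: measurable_cantor; elim/last_ind => [|s b IH].
  by rewrite (_ : _ @^-1` _ = setT)//; apply/seteqP; split.
rewrite (_ : _ @^-1` _ = (tree_path @^-1` cyl s) `&`
    ((fun p => left_end s p.1 + w (rcons s false) p.1 <= p.2) @^-1` [set b])).
  by apply: measurableI => //; rewrite -[X in measurable X]setTI; exact: mle.
apply/seteqP; split=> p; rewrite /cyl /= !mkseq_path size_rcons /=.
  by move=> /rcons_inj[ps pb]; rewrite -pb ps.
by move=> [-> ->].
Qed.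

Lemma measurable_path_section z :
  measurable_fun setT (fun t => tree_path (z, t) : cantor_borel).
Proof. exact: (measurableT_comp measurable_path (measurable_pair1 z)). Qed.

Lemma path_law z s : unif R [set t | cyl s (tree_path (z, t))] = (w s z)%:E.
Proof.
have mA : measurable [set t : measurableTypeR R | cyl s (tree_path (z, t))].
  rewrite -[X in measurable X]setTI.
  exact: (measurable_path_section z) measurableT _ (measurable_cyl s).
rewrite unif_setI01// [X in unif R X](_ : _ =
    `[left_end s z, left_end s z + w s z[%classic).
  by rewrite unif_itv ?left_end_ge0 ?right_end_le1 ?lerDl// addrAC subrr add0r.
apply/seteqP; split=> t /=; rewrite !in_itv /=.
  by move=> [/path_cyl h /[dup] t01 /h].
move=> /andP[l1 l2]; have t01 : 0 <= t < 1.
  by rewrite (le_trans (left_end_ge0 s z) l1) (lt_le_trans l2 (right_end_le1 _ _)).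
by split=> //; apply/path_cyl => //; rewrite l1.
Qed.

End tree_path.

(** * Binary expansions and independent uniform variables *)

Definition fair_weight (R : realType) (s : seq bool) (_ : unit) : R :=
  2^-1 ^+ size s.

Section fair.
Variable R : realType.
Local Notation fw := (@fair_weight R).
Local Notation UR := (measurableTypeR R).

Let w_nil z : fw [::] z = 1. Proof. by rewrite /fair_weight expr0. Qed.
Let w_ge0 s z : 0 <= fw s z. Proof. by rewrite /fair_weight exprn_ge0// invr_ge0. Qed.
Let wD s z : fw s z = fw (rcons s false) z + fw (rcons s true) z.
Proof.
rewrite /fair_weight !size_rcons !exprS -mulrDl -[LHS]mul1r; congr (_ * _).
lra.
Qed.
Let mw s : measurable_fun setT (fw s). Proof. exact: measurable_cst. Qed.

(** With weights that halve at each step the branch is the binary expansion. *)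
Definition digits (t : UR) : cantor_space := tree_path fw (tt, t).

Lemma measurable_digits : measurable_fun setT (digits : UR -> cantor_borel).
Proof.
exact: (measurable_path_section mw tt).
Qed.

Definition fair : probability cantor_borel R := law (unif R) measurable_digits.

Lemma fair_cyl s : fair (cyl s) = (2^-1 ^+ size s)%:E.
Proof. exact: path_law. Qed.

(** A supremum of dyadic left ends rather than a series: the bounds by the ends of
    the dyadic intervals are then immediate. *)
Definition undigits (b : cantor_space) : R :=
  sup (range (fun n => left_end fw (mkseq b n) tt)).

Let left_mono (b : nat -> bool) m n : (m <= n)%N ->
  left_end fw (mkseq b m) tt <= left_end fw (mkseq b n) tt.
Proof.
elim: n => [|n IH]; first by rewrite leqn0 => /eqP ->.
rewrite leq_eqVlt => /predU1P[->//|/IH]; rewrite mkseqS left_end_rcons => h.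
by apply: (le_trans h); rewrite lerDl; case: ifP.
Qed.

Let right_mono (b : nat -> bool) m n : (m <= n)%N ->
  left_end fw (mkseq b n) tt + 2^-1 ^+ n <= left_end fw (mkseq b m) tt + 2^-1 ^+ m.
Proof.
elim: n => [|n IH]; first by rewrite leqn0 => /eqP ->.
rewrite leq_eqVlt => /predU1P[->//|/IH]; apply: le_trans.
rewrite mkseqS left_end_rcons -addrA lerD2l.
have := wD (mkseq b n) tt; rewrite /fair_weight !size_rcons !size_mkseq => ->.
by case: (b n); rewrite ?add0r// lerDl exprn_ge0.
Qed.

Let undigits_in (b : cantor_space) n :
  left_end fw (mkseq b n) tt <= undigits b <= left_end fw (mkseq b n) tt + 2^-1 ^+ n.
Proof.
have ub m : left_end fw (mkseq b m) tt <= left_end fw (mkseq b n) tt + 2^-1 ^+ n.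
  have [mn|/ltnW nm] := leqP m n.
    by apply: (le_trans (left_mono b mn)); rewrite lerDl exprn_ge0.
  by apply: le_trans (right_mono b nm); rewrite lerDl exprn_ge0.
apply/andP; split.
  apply: ub_le_sup; last by exists n.
  by exists (left_end fw (mkseq b n) tt + 2^-1 ^+ n) => _ [m _ <-].
apply: ge_sup; first by exists (left_end fw (mkseq b 0) tt); exists 0%N.
by move=> _ [m _ <-].
Qed.

Lemma half_lt (e : R) : 0 < e -> exists n, 2^-1 ^+ n < e.
Proof.
move=> e0; have /cvgrPdist_lt/(_ e e0)[n _ /(_ n (leqnn n))] : (2^-1 : R) ^+ n @[n --> \oo] --> 0.
  by apply: cvg_expr; rewrite ger0_norm ?invr_ge0//; lra.
by rewrite /= sub0r normrN ger0_norm ?exprn_ge0//; exists n.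
Qed.

(** For each [n] both numbers lie in the same dyadic interval of length [2^-n]. *)
Lemma digitsK t : 0 <= t < 1 -> undigits (digits t) = t.
Proof.
move=> t01; apply/eqP; rewrite -subr_eq0 -normr_le0 leNgt; apply/negP.
move=> /half_lt[n]; apply/negP; rewrite -leNgt.
have /andP[l1 l2] := undigits_in (digits t) n.
have : cyl (mkseq (digits t) n) (digits t) by exact: cyl_mkseq.
move=> /(path_cyl w_nil w_ge0 wD _ _) -/(_ t01) /=.
rewrite /fair_weight size_mkseq => /andP[l3 l4].
by rewrite ler_norml; apply/andP; split; lra.
Qed.

Lemma undigits_continuous : continuous undigits.
Proof.
move=> b; apply/cvgrPdist_lt => e /half_lt[n ne].
apply: filterS (nbhs_cyl b n) => c cb; apply: le_lt_trans ne.
have /andP[l1 l2] := undigits_in b n; have := undigits_in c n.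
by rewrite cb => /andP[l3 l4]; rewrite ler_norml; apply/andP; split; lra.
Qed.

End fair.

Lemma measurable_continuous (X : ptopologicalType) (R : realType) (f : X -> R) :
  continuous f -> measurable_fun setT (f : borel X -> R).
Proof.
move=> /continuousP cf.
apply: (measurability _ (RGenOpens.measurableE R)) => _ [_ [x [y ->]] <-].
by rewrite setTI; apply: measurable_open; apply: cf; exact: interval_open.
Qed.

Lemma measurable_continuous_map (X Y : ptopologicalType) (f : X -> Y) :
  continuous f -> measurable_fun setT (f : borel X -> borel Y).
Proof.
move=> cf; have := @measurability _ _ (borel X) (borel Y) setT f (@open Y) erefl.
apply=> _ [W oW <-]; rewrite setTI; apply: measurable_open.
by apply: open_comp => // x _; exact: cf.
Qed.

Definition merge (p : cantor_space * cantor_space) : cantor_space :=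
  fun n => if odd n then p.2 n./2 else p.1 n./2.

Definition evens (b : cantor_space) : cantor_space := fun n => b n.*2.
Definition odds (b : cantor_space) : cantor_space := fun n => b n.*2.+1.

Lemma evens_merge p : evens (merge p) = p.1.
Proof. by apply/funext => n; rewrite /evens /merge odd_double doubleK. Qed.

Lemma odds_merge p : odds (merge p) = p.2.
Proof.
by apply/funext => n; rewrite /odds /merge /= odd_double /= uphalf_double.
Qed.

Lemma merge_cyl s : merge @^-1` cyl s =
  cyl (mkseq (fun i => nth false s i.*2) (uphalf (size s))) `*`
  cyl (mkseq (fun i => nth false s i.*2.+1) (size s)./2).
Proof.
apply/seteqP; split=> -[b c]; rewrite /cyl /= !size_mkseq.
  move=> <-; rewrite size_mkseq; split; apply: eq_mkseq_lt => i ilt.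
    rewrite nth_mkseq; last by lia.
    by rewrite /merge odd_double doubleK.
  rewrite nth_mkseq; last by lia.
  by rewrite /merge /= odd_double /= uphalf_double.
move=> [/mkseq_inj bs /mkseq_inj cs].
rewrite -[RHS](mkseq_nth false); apply: eq_mkseq_lt => i ilt.
rewrite /merge /=; case: ifPn => oi.
  rewrite cs; last by lia.
  by congr nth; lia.
rewrite bs; last by lia.
by congr nth; lia.
Qed.

Lemma measurable_cantor_coord n : measurable_fun setT (fun b : cantor_borel => (b : cantor_space) n).
Proof.
apply: (measurable_fun_bool true); rewrite setTI; apply: measurable_open.
rewrite openE => b bn; apply: filterS (proj_cantor_nbhs b n) => c /= ->.
exact: bn.
Qed.

Lemma measurable_cantor_fun d (T : measurableType d) (f : T -> cantor_borel) :
  (forall n, measurable_fun setT (fun t => (f t : cantor_space) n)) ->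
  measurable_fun setT f.
Proof.
move=> mf; apply: measurable_cantor; elim/last_ind => [|s b IH].
  by rewrite (_ : _ @^-1` _ = setT)//; apply/seteqP; split.
rewrite (_ : _ @^-1` _ = (f @^-1` cyl s) `&`
    ((fun t => (f t : cantor_space) (size s)) @^-1` [set b])).
  by apply: measurableI => //; rewrite -[X in measurable X]setTI; exact: mf.
apply/seteqP; split=> p; rewrite /cyl /= size_rcons mkseqS.
  by move=> /rcons_inj[ps pb].
by move=> [-> ->].
Qed.

Section iid.
Variable R : realType.
Local Notation UR := (measurableTypeR R).

Definition unpair1 (t : UR) : UR := undigits R (evens (digits t)).
Definition unpair2 (t : UR) : UR := undigits R (odds (digits t)).

Let m_merge : measurable_fun setT (merge : cantor_borel * cantor_borel -> cantor_borel).
Proof.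
apply: measurable_cantor_fun => n; rewrite /merge.
case: (odd n); apply: measurableT_comp (measurable_cantor_coord _) _.
  exact: measurable_snd.
exact: measurable_fst.
Qed.

Let m_evens : measurable_fun setT (evens : cantor_borel -> cantor_borel).
Proof. by apply: measurable_cantor_fun => n; exact: measurable_cantor_coord. Qed.

Let m_odds : measurable_fun setT (odds : cantor_borel -> cantor_borel).
Proof. by apply: measurable_cantor_fun => n; exact: measurable_cantor_coord. Qed.

Let m_undigits : measurable_fun setT (@undigits R : cantor_borel -> UR).
Proof. exact: measurable_continuous (@undigits_continuous R). Qed.

Lemma measurable_unpair1 : measurable_fun setT unpair1.
Proof.
exact: (measurableT_comp m_undigits (measurableT_comp m_evens (@measurable_digits R))).
Qed.

Lemma measurable_unpair2 : measurable_fun setT unpair2.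
Proof.
exact: (measurableT_comp m_undigits (measurableT_comp m_odds (@measurable_digits R))).
Qed.

Let fair_merge (A : set cantor_borel) : measurable A ->
  (fair R \x fair R)%E (merge @^-1` A) = fair R A.
Proof.
move=> mA; rewrite -(lawE _ m_merge).
apply: cantor_measure_unique => [|s|//].
  by rewrite (le_lt_trans (probability_le1 _ measurableT)) ?ltry.
rewrite [LHS](_ : _ = (fair R \x fair R)%E (merge @^-1` cyl s))// merge_cyl.
apply: etrans (product_measure1E _ _ (measurable_cyl _) (measurable_cyl _)) _.
apply: etrans (congr2 _ (fair_cyl R _) (fair_cyl R _)) _.
rewrite [RHS]fair_cyl.
by rewrite !size_mkseq -EFinM -exprD uphalf_half -addnA addnn odd_double_half.
Qed.

Let fair_undigits (A : set UR) : measurable A -> fair R (@undigits R @^-1` A) = unif R A.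
Proof.
move=> mA; rewrite lawE [in RHS]unif_setI01// unif_setI01.
  congr (unif R _); apply/seteqP; split=> t [/= tA t01]; split=> //=.
    by move: tA; rewrite digitsK//; move: t01; rewrite in_itv.
  by rewrite digitsK//; move: t01; rewrite in_itv.
rewrite -[X in measurable X]setTI.
exact: (measurableT_comp m_undigits (@measurable_digits R)).
Qed.

(** Merging two independent fair sequences gives a fair sequence, hence the even
    and the odd digits of a uniform variable are independent and fair. *)
Lemma unif_unpair (A B : set UR) : measurable A -> measurable B ->
  unif R [set t | A (unpair1 t) /\ B (unpair2 t)] = (unif R A * unif R B)%E.
Proof.
move=> mA mB; rewrite -(fair_undigits mA) -(fair_undigits mB).
have mpre C : measurable C -> measurable (@undigits R @^-1` C : set cantor_borel).
  by move=> mC; rewrite -[X in measurable X]setTI; exact: m_undigits.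
have mA' := mpre _ mA; have mB' := mpre _ mB.
rewrite -(product_measure1E (fair R) (fair R))//.
transitivity (fair R (evens @^-1` (@undigits R @^-1` A) `&` odds @^-1` (@undigits R @^-1` B))).
  exact: erefl.
rewrite -fair_merge.
  congr (_ _); apply/seteqP; split=> p; rewrite /= evens_merge odds_merge//.
by apply: measurableI; rewrite -[X in measurable X]setTI; [exact: m_evens|exact: m_odds].
Qed.

(** Splitting off half of the remaining digits again and again extracts
    countably many independent uniform variables from a single one. *)
Fixpoint iid n (t : UR) : UR :=
  if n is m.+1 then iid m (unpair2 t) else unpair1 t.

Lemma measurable_iid n : measurable_fun setT (iid n).
Proof.
elim: n => [|n IH]; first exact: measurable_unpair1.
exact: (measurableT_comp IH measurable_unpair2).
Qed.

Lemma iid_law n (A : nat -> set UR) : (forall i, measurable (A i)) ->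
  unif R [set t | forall i, (i < n)%N -> A i (iid i t)] =
  (\prod_(i < n) fine (unif R (A i)))%:E.
Proof.
elim: n A => [|n IH] A mA.
  rewrite big_ord0 (_ : [set _ | _] = setT) ?probability_setT//.
  by apply/seteqP; split.
rewrite big_ord_recl EFinM -(IH (fun i => A i.+1))// fineK; last exact: fin_num_measure.
rewrite -unif_unpair//; last first.
  rewrite (_ : mkset _ = \bigcap_(i in `I_n) (iid i @^-1` A i.+1))//.
  apply: bigcap_measurableType => i _; rewrite -[X in measurable X]setTI.
  exact: measurable_iid.
congr (unif R _); apply/seteqP; split=> t.
  by move=> h; split; [exact: (h 0%N)|move=> i ilt; exact: (h i.+1)].
by move=> [h0 h1] [|i] //= ilt; exact: h1.
Qed.

Lemma unif_iid n (A : set UR) : measurable A -> unif R (iid n @^-1` A) = unif R A.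
Proof.
elim: n A => [|n IH] A mA.
  have := unif_unpair mA measurableT.
  by rewrite probability_setT mule1 => <-; congr (unif R _); apply/seteqP; split=> t //= -[].
rewrite -(IH A mA); have mI : measurable (iid n @^-1` A).
  by rewrite -[X in measurable X]setTI; exact: measurable_iid.
have := unif_unpair measurableT mI.
by rewrite probability_setT mul1e => <-; congr (unif R _); apply/seteqP; split=> t //= -[].
Qed.

End iid.

(** * Limits of empirical measures on the Cantor space *)

Definition avg (R : realType) (N : nat) (f : nat -> R) : R :=
  N%:R^-1 * \sum_(1 <= n < N.+1) f n.

Section avg.
Variable R : realType.
Implicit Types f g : nat -> R.

Lemma avgD N f g : avg N (fun n => f n + g n) = avg N f + avg N g.
Proof. by rewrite /avg big_split mulrDr. Qed.

Lemma avgB N f g : avg N (fun n => f n - g n) = avg N f - avg N g.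
Proof. by rewrite /avg sumrB mulrBr. Qed.

Lemma avgZ N r f : avg N (fun n => r * f n) = r * avg N f.
Proof. by rewrite /avg -big_distrr mulrCA. Qed.

Lemma avg_sum N (I : Type) (s : seq I) (F : I -> nat -> R) :
  avg N (fun n => \sum_(i <- s) F i n) = \sum_(i <- s) avg N (F i).
Proof. by rewrite /avg exchange_big big_distrr. Qed.

Lemma avg_cst N r : (0 < N)%N -> avg N (fun=> r) = r :> R.
Proof.
move=> N0; rewrite /avg big_const_nat iter_addr_0 subn1 /= -[r *+ N]mulr_natl mulrA mulVf ?mul1r//.
by rewrite pnatr_eq0 -lt0n.
Qed.

Lemma ler_avg N f g : (forall n, (0 < n)%N -> f n <= g n) -> avg N f <= avg N g.
Proof.
move=> fg; rewrite /avg ler_wpM2l ?invr_ge0//.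
by rewrite big_nat [leRHS]big_nat; apply: ler_sum => i /andP[i1 _]; exact: fg.
Qed.

Lemma eq_avg N f g : (forall n, (0 < n)%N -> f n = g n) -> avg N f = avg N g.
Proof.
by move=> fg; apply/eqP; rewrite eq_le !ler_avg// => n n0; rewrite fg.
Qed.

Lemma avg_norm_le N f r : 0 <= r -> (forall n, (0 < n)%N -> `|f n| <= r) ->
  `|avg N f| <= r.
Proof.
move=> r0 fr; have [->|N0] := posnP N.
  by rewrite /avg big_geq// mulr0 normr0.
rewrite ler_norml -[- r](avg_cst _ N0) -[X in _ && (_ <= X)](avg_cst _ N0).
by apply/andP; split; apply: ler_avg => n /fr; rewrite ler_norml => /andP[].
Qed.

End avg.

Section empirical_limit.
Variables (R : realType) (c : nat -> cantor_space).
Local Notation freq N s := (avg N (fun n => \1_(cyl s) (c n) : R)).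

Lemma cyl_rcons s b : cyl (rcons s b) = cyl s `&` [set d : cantor_space | d (size s) = b].
Proof.
apply/seteqP; split=> d; rewrite /cyl /= size_rcons mkseqS.
  by move=> /rcons_inj[].
by move=> [-> ->].
Qed.

Lemma freqD N s : freq N s = freq N (rcons s false) + freq N (rcons s true).
Proof.
rewrite -avgD; apply: eq_avg => n _; rewrite !cyl_rcons !indicI /=.
rewrite -mulrDr -[LHS]mulr1; congr (_ * _); rewrite !indicE.
case E : (c n (size s)).
  by rewrite memNset ?mem_set ?add0r//= E.
by rewrite mem_set ?memNset ?addr0//= E.
Qed.

Lemma indic_01 (A : set cantor_space) b : 0 <= (\1_A b : R) <= 1.
Proof. by rewrite indicE; case: (_ \in _); rewrite ?lexx ler01. Qed.

Lemma freq_01 N s : 0 <= freq N s <= 1.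
Proof.
have [->|N0] := posnP N; first by rewrite /avg big_geq// mulr0 lexx ler01.
rewrite -[X in X <= _ <= _](avg_cst _ N0) -[X in _ && (_ <= X)](avg_cst _ N0).
by apply/andP; split; apply: ler_avg => n _; have /andP[] := indic_01 (cyl s) (c n).
Qed.

(** The families of cylinder frequencies lie in a compact cube, so they have a
    cluster point. Only the cylinders with code below [l] are controlled at once,
    which is enough for a diagonal choice of [N]. *)
Lemma freq_cluster (Q : nat -> Prop) :
  (forall M, exists N, (M < N)%N /\ Q N) ->
  exists w : seq bool -> R, forall l M, exists N, [/\ (M < N)%N, Q N &
    forall s, (pickle s < l)%N -> `|freq N s - w s| < l.+1%:R^-1].
Proof.
move=> /choice[g gP].
pose a n : prod_topology (fun _ : seq bool => R) := fun s => freq (g n) s.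
have := @tychonoff _ (fun _ : seq bool => R) (fun=> `[0, 1]%classic)
  (fun=> @segment_compact R 0 1).
have PF : ProperFilter (a @ \oo) by exact: fmap_proper_filter.
move=> /(_ (a @ \oo) PF) [|w [_ wa]].
  by exists 0%N => // n _ s; rewrite /= in_itv /=; exact: freq_01.
exists w => l M.
have /wa : (a @ \oo) (a @` [set n | (M <= n)%N]).
  by exists M => // n /= Mn; exists n.
pose ws0 : prod_topology (fun _ : seq bool => R) := w.
have FFw := @nbhs_filter _ ws0.
have wnbhs k (r : R) : 0 < r -> nbhs ws0 [set v | 
    forall s, (pickle s < k)%N -> `|v s - w s| < r].
  move=> r0; elim: k => [|k IH].
    apply: (@filterS _ _ FFw setT); last exact: filterT.
    by move=> v _ s; rewrite ltn0.
  case E : (unpickle k : option (seq bool)) => [s|]; last first.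
    apply: (@filterS _ _ FFw _ _ _ IH) => v vP s; rewrite ltnS leq_eqVlt => /predU1P[sk|/vP//].
    by move: E; rewrite -sk pickleK.
  have ws := @proj_continuous _ (fun=> R) s w _ (nbhsx_ballx (w s) r r0).
  apply: (@filterS2 _ _ FFw _ _ _ _ IH ws) => v vP vs s'.
  rewrite ltnS leq_eqVlt => /predU1P[sk|/vP//].
  by move: E; rewrite -sk pickleK => -[->]; rewrite distrC.
have r0 : 0 < (l.+1%:R^-1 : R) by rewrite invr_gt0.
move=> /(_ _ (wnbhs l _ r0)) [_ [[n Mn <-] nP]].
by have [ng Qg] := gP n; exists (g n); split=> //; exact: leq_ltn_trans ng.
Unshelve. all: end_near. Qed.

(** Compactness of the set of measures, without a topology on measures: limiting
    frequencies are consistent weights, and these are the cylinder probabilities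
    of a random branch. *)
Lemma empirical_limit (Q : nat -> Prop) :
  (forall M, exists N, (M < N)%N /\ Q N) ->
  exists (N : nat -> nat) (P : probability cantor_borel R),
    [/\ {homo N : m n / (m < n)%N}, forall l, (0 < N l)%N /\ Q (N l) &
    forall s, freq (N l) s @[l --> \oo] --> fine (P (cyl s))].
Proof.
move=> /freq_cluster[w wP].
have /choice[f fP] (p : nat * nat) : exists N, [/\ (p.2 < N)%N, Q N &
    forall s, (pickle s < p.1)%N -> `|freq N s - w s| < p.1.+1%:R^-1].
  exact: wP.
pose N := fix N l := if l is k.+1 then f (k.+1, N k) else f (0, 0).
have N0 l : (0 < N l)%N.
  by case: l => [|l] /=; [have [h _ _] := fP (0, 0)|have [h _ _] := fP (l.+1, N l)]; exact: leq_ltn_trans h.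
have NQ l : Q (N l) by case: l => [|l] /=; [have [] := fP (0, 0)|have [] := fP (l.+1, N l)].
have Nw l s : (pickle s < l)%N -> `|freq (N l) s - w s| < l.+1%:R^-1.
  by case: l => [|l] //=; have [_ _] := fP (l.+1, N l); apply.
have Ncvg s : freq (N l) s @[l --> \oo] --> w s.
  apply/cvgrPdist_lt => e e0; near=> l.
  rewrite distrC; apply: (@lt_trans _ _ l.+1%:R^-1).
    by apply: Nw; near: l; exists (pickle s).+1.
  by near: l; exact: (near_infty_natSinv_lt (PosNum e0)).
have w1 : w [::] = 1.
  apply: (cvg_unique _ (Ncvg [::])) => //.
  apply: cvg_near_cst; apply: nearW => l.
  rewrite -[RHS](avg_cst 1 (N0 l)); apply: eq_avg => n _.
  by rewrite indicE mem_set.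
have w0 s : 0 <= w s.
  have <- := cvg_lim _ (Ncvg s) => //.
  apply: limr_ge; first by apply/cvg_ex; exists (w s).
  by apply: nearW => l; have /andP[] := freq_01 (N l) s.
have wD s : w s = w (rcons s false) + w (rcons s true).
  apply: (cvg_unique _ (Ncvg s)) => //.
  rewrite (_ : (fun l => freq (N l) s) =
    (fun l => freq (N l) (rcons s false) + freq (N l) (rcons s true))).
    exact: cvgD.
  by apply/funext => l; exact: freqD.
pose w' s (_ : unit) := w s.
have mw' s : measurable_fun setT (w' s) by exact: measurable_cst.
exists N, (law (unif R) (measurable_path_section mw' tt)).
split=> [||s].
- apply: homo_ltn => [|l /=]; first by move=> m n p; exact: ltn_trans.
  by have [] := fP (l.+1, N l).
- by move=> l; split.
- rewrite lawE (_ : _ @^-1` _ = [set t | cyl s (tree_path w' (tt, t))])//.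
  rewrite (path_law (fun=> w1) (fun s _ => w0 s) (fun s _ => wD s) mw' tt s).
  exact: Ncvg.
Unshelve. all: end_near. Qed.

End empirical_limit.

Section empirical_integral.
Variables (R : realType) (c : nat -> cantor_space) (K : set cantor_space).
Variables (N : nat -> nat) (P : probability cantor_borel R).
Hypothesis N0 : forall l, (0 < N l)%N.
Hypothesis NP : forall s,
  avg (N l) (fun n => \1_(cyl s) (c n) : R) @[l --> \oo] --> fine (P (cyl s)).
Hypothesis cK : forall n, (0 < n)%N -> K (c n).
Hypothesis closedK : closed K.

Lemma empirical_limit_support : P (~` K) = 0%E.
Proof.
have oK : open (~` K) by exact: closed_openC.
have cyl0 s : cyl s `<=` ~` K -> P (cyl s) = 0%E.
  move=> sK; have h : fine (P (cyl s)) = 0.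
    apply: (cvg_unique _ (@NP s)) => //.
    apply: cvg_near_cst; apply: nearW => l.
    rewrite -[RHS](avg_cst 0 (N0 l)); apply: eq_avg => n /cK Kn.
    by rewrite indicE memNset// => /sK.
  by rewrite -[LHS]fineK ?fin_num_measure ?h//; exact: measurable_cyl.
rewrite (open_bigcup_cyl oK); apply: bigcup_count_measure0 => // s _.
exact: measurable_cyl.
Qed.

Variable phi : cantor_space -> R.
Hypothesis phiK : forall b, K b -> forall e, 0 < e -> exists n,
  forall b', K b' -> mkseq b' n = mkseq b n -> `|phi b' - phi b| < e.
Hypothesis bphi : bounded_mfun (phi : cantor_borel -> R).

(** Pairs violating the conclusion for every [n] would cluster at a point of [K]. *)
Lemma cantor_unif_continuous (e : R) : 0 < e -> exists n, forall b b',
  K b -> K b' -> mkseq b n = mkseq b' n -> `|phi b - phi b'| < e.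
Proof.
move=> e0; apply: contrapT => /forallNP hn.
have /choice[g gP] n : exists bb : cantor_space * cantor_space,
    [/\ K bb.1, K bb.2, mkseq bb.1 n = mkseq bb.2 n & e <= `|phi bb.1 - phi bb.2|].
  have /existsNP[b /existsNP[b']] := hn n.
  move=> /not_implyP[Kb] /not_implyP[Kb'] /not_implyP[bb' /negP].
  by rewrite -leNgt => ?; exists (b, b').
have cptK : compact K.
  by apply: (@subclosed_compact _ _ setT) => //; exact: cantor_space_compact.
pose b1 n : cantor_space := (g n).1.
have PF : ProperFilter (b1 @ \oo) by exact: fmap_proper_filter.
have [|b [Kb clb]] := cptK (b1 @ \oo) PF.
  by exists 0%N => // n _; have [] := gP n.
have [|m mP] := phiK Kb (e := e / 2); first by rewrite divr_gt0.
have := clb (b1 @` [set n | (m <= n)%N]) [set d | mkseq d m = mkseq b m].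
case=> [||_ [[n /= mn <-] nb]]; [by exists m => // n /= mn; exists n|exact: nbhs_cyl|].
have [K1 K2 g12] := gP n; rewrite leNgt => /negP; apply.
have h1 := mP _ K1 nb.
have h2 : `|phi (g n).2 - phi b| < e / 2.
  apply: mP => //; rewrite -nb /b1.
  by rewrite -(take_mkseq _ mn) -[RHS](take_mkseq _ mn) g12.
apply: le_lt_trans (ler_distD (phi b) _ _) _.
by rewrite [ltRHS]splitr ltrD// distrC.
Qed.

(** Weak convergence for a function that is only known to be continuous on [K],
    which carries both the orbit and the limit measure. *)
Lemma empirical_integral :
  avg (N l) (phi \o c) @[l --> \oo] --> \int[P]_b phi b.
Proof.
have mK : measurable (K : set cantor_borel) by exact: measurable_closed.
apply/cvgrPdist_lt => e e0; have e3 : 0 < e / 3 by rewrite divr_gt0.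
have [m mP] := cantor_unif_continuous e3.
have /choice[rep repP] s : exists b, (cyl s `&` K) !=set0 -> (cyl s `&` K) b.
  by have [[b ?]|?] := pselect (cyl s `&` K !=set0); [exists b|exists point].
(* [psi] takes the value of [phi] at one point of [K] in each cylinder. *)
pose psi (b : cantor_space) := \sum_(s : m.-tuple bool) phi (rep s) * \1_(cyl s) b : R.
have psiE b : psi b = phi (rep (mkseq b m)).
  have sz : size (mkseq b m) == m by rewrite size_mkseq.
  rewrite /psi (bigD1 (Tuple sz))//= big1 ?addr0.
    by rewrite indicE mem_set ?mulr1//=; exact: cyl_mkseq.
  move=> s /eqP ns; rewrite indicE memNset ?mulr0// => bs; apply: ns.
  by apply/val_inj; rewrite /= -bs size_tuple.
have psiK b : K b -> `|phi b - psi b| <= e / 3.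
  move=> Kb; rewrite psiE; apply: ltW; have [|bs Ks] := repP (mkseq b m).
    by exists b; split=> //; exact: cyl_mkseq.
  by apply: mP => //; move: bs; rewrite /cyl /= size_mkseq.
have bterm (s : m.-tuple bool) :
    bounded_mfun (fun b : cantor_borel => phi (rep s) * \1_(cyl s) b : R).
  apply: bounded_mfunM; first exact: bounded_mfun_cst.
  by apply: bounded_mfun_indic; exact: measurable_cyl.
have bpsi : bounded_mfun (psi : cantor_borel -> R) by exact: bounded_mfun_sum.
have intpsi : \int[P]_b psi b = \sum_(s : m.-tuple bool) phi (rep s) * fine (P (cyl s)).
  rewrite expect_sum//; apply: eq_bigr => s _; rewrite expectZl.
    by rewrite expect_indic//; exact: measurable_cyl.
  by apply: bounded_mfun_indic; exact: measurable_cyl.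
have cvgpsi : avg (N l) (psi \o c) @[l --> \oo] --> \int[P]_b psi b.
  rewrite intpsi; under eq_fun do rewrite avg_sum.
  apply: cvg_big => [|s _]; first exact: add_continuous.
  rewrite (_ : (fun l => avg _ _) =
    (fun l => phi (rep s) * avg (N l) (fun n => \1_(cyl s) (c n)))).
    by apply: cvgMr; exact: NP.
  by apply/funext => l; rewrite avgZ.
have intle : `|\int[P]_b phi b - \int[P]_b psi b| <= e / 3.
  rewrite -expectB//; have bpp := bounded_mfunB bphi bpsi.
  have bK := bounded_mfunM bpp (bounded_mfun_indic R mK).
  rewrite (@ae_eq_expect _ _ _ P _ _ bpp bK).
    apply: expect_bounded => // b; rewrite indicE.
    case: (boolP (b \in K)) => [/set_mem/psiK|_]; rewrite ?mulr1// mulr0 normr0.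
    exact: ltW.
  exists (~` K); split; [exact: measurableC|exact: empirical_limit_support|].
  by move=> b /= nb Kb; apply: nb; rewrite indicE mem_set// mulr1.
near=> l.
have h1 : `|\int[P]_b psi b - avg (N l) (psi \o c)| < e / 3.
  by near: l; move/cvgrPdist_lt : cvgpsi; apply.
have h2 : `|avg (N l) (phi \o c) - avg (N l) (psi \o c)| <= e / 3.
  rewrite -avgB; apply: avg_norm_le; first exact: ltW.
  by move=> n n0; apply: psiK; exact: cK.
move: h1 h2 intle; rewrite !ltr_norml !ler_norml => /andP[? ?] /andP[? ?] /andP[? ?].
by apply/andP; split; lra.
Unshelve. all: end_near. Qed.

End empirical_integral.

(** * Factors up to null sets *)

Lemma measurable_preimage d d' (T : measurableType d) (T' : measurableType d')
    (f : T -> T') B : measurable_fun setT f -> measurable B -> measurable (f @^-1` B).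
Proof. by move=> mf mB; rewrite -[X in measurable X]setTI; exact: mf. Qed.

Lemma ae_comp d d' (T : measurableType d) (T' : measurableType d')
    (R : realType) (P : probability T R) (Q : probability T' R) (f : T -> T')
    (A : T' -> Prop) : measure_preserving P Q f ->
  {ae Q, forall y, A y} -> {ae P, forall x, A (f x)}.
Proof.
move=> [mf fP] [B [mB B0 AB]]; exists (f @^-1` B); split.
- exact: measurable_preimage.
- by rewrite fP.
- by move=> x /= nA; exact: AB.
Qed.

Lemma ae_forall_count d (T : measurableType d) (R : realType)
    (P : probability T R) (I : countType) (A : I -> T -> Prop) :
  (forall i, {ae P, forall x, A i x}) -> {ae P, forall x, forall i, A i x}.
Proof.
move=> h; have : {ae P, forall x, forall n, if unpickle n is Some i then A i x else True}.
  by apply: ae_foralln => n; case: (unpickle n) => [i|]; [exact: h|exact: aeW].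
by apply: filterS => x hx i; have := hx (pickle i); rewrite pickleK.
Qed.

Lemma ae_iff_measure d (T : measurableType d) (R : realType)
    (P : probability T R) (A B : set T) : measurable A -> measurable B ->
  {ae P, forall x, A x <-> B x} -> P A = P B.
Proof.
move=> mA mB [N [mN N0 AB]].
have le C D : measurable C -> measurable D -> (forall x, ~ N x -> C x -> D x) -> (P C <= P D)%E.
  move=> mC mD CD; rewrite -[leRHS]adde0 -N0.
  apply: (le_trans _ (measureU2 _ mD mN)); apply: le_measure; rewrite ?inE//; first exact: measurableU.
  by move=> x Cx; have [Nx|nN] := pselect (N x); [right|left; exact: CD].
have ABx x : ~ N x -> (A x <-> B x) by move=> nN; apply: contrapT => /AB.
by apply/eqP; rewrite eq_le !le// => x /ABx[].
Qed.

Lemma symdiff0_ae d (T : measurableType d) (R : realType)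
    (P : probability T R) (A B : set T) : measurable A -> measurable B ->
  P (A `+` B) = 0%E <-> {ae P, forall x, A x <-> B x}.
Proof.
move=> mA mB; have mAB : measurable (A `+` B).
  by rewrite setYE; apply: measurableD; [exact: measurableU|exact: measurableI].
split=> [AB0|AB].
  exists (A `+` B); split => // x /= nAB.
  apply: contrapT => h; apply: nAB.
  by split=> Hx; apply: contrapT => Hn; apply: h; [left|right].
rewrite -[RHS](@measure0 _ _ _ P); apply: ae_iff_measure => //.
by apply: filterS AB => x [AB BA]; split=> // -[[/AB ?]|[/BA ?]].
Qed.

Definition invertible d (T : measurableType d) (f : T -> T) :=
  exists2 g : T -> T, measurable_fun setT g & cancel f g /\ cancel g f.

Lemma measure_preserving_inv d (T : measurableType d) (R : realType)
    (P : probability T R) (f g : T -> T) : measure_preserving P P f ->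
  measurable_fun setT g -> cancel f g -> cancel g f -> measure_preserving P P g.
Proof.
move=> [mf fP] mg fg gf; split=> // B mB.
rewrite -fP; last exact: measurable_preimage.
by congr (P _); apply/seteqP; split=> x /=; rewrite fg.
Qed.

Lemma measure_preserving_comp d d' d'' (T : measurableType d)
    (T' : measurableType d') (T'' : measurableType d'') (R : realType)
    (P : probability T R) (P' : probability T' R) (P'' : probability T'' R)
    (g : T' -> T'') (f : T -> T') : measure_preserving P' P'' g ->
  measure_preserving P P' f -> measure_preserving P P'' (g \o f).
Proof.
move=> [mg gP] [mf fP]; split; first exact: measurableT_comp.
by move=> B mB; rewrite -gP// -fP//; exact: measurable_preimage.
Qed.

Section pullback.
Variables (R : realType) (F : system R -> Prop).
Hypothesis hF : characteristic F.
Variable s : system R.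
Hypothesis s_pres : measure_preserving (sys_prob s) (sys_prob s) (@sys_map _ s).
Hypothesis s_inv : invertible (@sys_map _ s).

(** Completed by null sets: uncompleted, the preimages of a factor map depend on
    its values on null sets and cannot contain every other factor. *)
Definition pullback_algebra (t : system R) (p : sys_space s -> sys_space t) :
    set (set (sys_space s)) :=
  [set A | measurable A /\ exists2 C, measurable C &
    {ae sys_prob s, forall z, A z <-> C (p z)}].

Lemma pullback_F_factor (t : system R) (p : sys_space s -> sys_space t) :
  F t -> factor_map p -> is_F_factor F (pullback_algebra p).
Proof.
move=> Ft [[mp pP] pS]; have [_ tP [T' mT' [TT' T'T]]] : is_mds t by case: hF => /(_ _ Ft).
have [S' mS' [SS' S'S]] := s_inv.
split.
- split.
  + split=> //; exists set0 => //; exact: aeW.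
  + move=> A [mA [C mC AC]]; rewrite setTD; split; first exact: measurableC.
    exists (~` C); first exact: measurableC.
    by apply: filterS AC => z [AC CA]; split=> /= h k; apply: h; [exact: CA|exact: AC].
  + move=> A hA; have /choice[C hC] i : exists C, measurable C /\
        {ae sys_prob s, forall z, A i z <-> C (p z)}.
      by have [_ [C mC AC]] := hA i; exists C.
    split; first by apply: bigcup_measurable => i _; have [] := hA i.
    exists (\bigcup_i C i); first by apply: bigcup_measurable => i _; have [] := hC i.
    have : {ae sys_prob s, forall z, forall i, A i z <-> C i (p z)}.
      by apply: ae_foralln => i; have [] := hC i.
    by apply: filterS => z h; split=> -[i _ /h]; exists i.
- by move=> A [].
- move=> A; split=> -[mA [C mC AC]]; split.
  + rewrite (_ : A = S' @^-1` (@sys_map _ s @^-1` A)); first exact: measurable_preimage.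
    by apply/seteqP; split=> x /=; rewrite S'S.
  + exists (T' @^-1` C); first exact: measurable_preimage.
    have S'pres := measure_preserving_inv s_pres mS' SS' S'S.
    have /(ae_comp S'pres) := AC; have /(ae_comp S'pres) := pS.
    by apply: filterS2 => z /=; rewrite S'S => -> ; rewrite TT'.
  + by apply: measurable_preimage => //; case: s_pres.
  + exists (@sys_map _ t @^-1` C); first by apply: measurable_preimage => //; case: tP.
    have /(ae_comp s_pres) := AC.
    by apply: filterS2 pS => z /= ->.
- exists t, p; split=> //.
  + move=> C mC; exists (p @^-1` C).
      split; first exact: measurable_preimage.
      by exists C => //; exact: aeW.
    apply/symdiff0_ae; [exact: measurable_preimage..|exact: aeW].
  + move=> A [mA [C mC AC]]; exists C => //.
    by apply/symdiff0_ae => //; exact: measurable_preimage.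
Qed.

End pullback.

(** * Symbolic systems on the Cantor space *)

Lemma nat_bijection (T : countType) (i : nat -> T) : injective i ->
  exists (e : T -> nat) (e' : nat -> T), cancel e e' /\ cancel e' e.
Proof.
move=> ii; have : ~ finite_set [set: T].
  move=> fT; apply: infinite_nat.
  have : finite_set (i @^-1` [set: T]).
    by apply: finite_preimage => // x y _ _; exact: ii.
  by rewrite preimage_setT.
move=> /(eq_card_nat (countableP _))/card_set_bijP[e]; rewrite setTT_bijective.
by move=> [e' ee' e'e]; exists e, e'.
Qed.

Definition permute (pi : nat -> nat) (b : cantor_space) : cantor_space :=
  fun n => b (pi n).

Lemma measurable_permute pi :
  measurable_fun setT (permute pi : cantor_borel -> cantor_borel).
Proof. by apply: measurable_cantor_fun => n; exact: measurable_cantor_coord. Qed.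

Lemma permuteK pi pi' : cancel pi' pi -> cancel (permute pi) (permute pi').
Proof. by move=> pik b; apply/funext => n; rewrite /permute pik. Qed.

Section cantor_metric.
Variable R : realType.

(** Standard Borel spaces are given by a complete pseudometric; it is put on a
    copy of the Cantor space. *)
Definition cantor_metric : Type := prod_topology (fun _ : nat => bool).

HB.instance Definition _ := Pointed.on cantor_metric.
HB.instance Definition _ := Uniform.on cantor_metric.
HB.instance Definition _ : @PseudoMetric R _ := PseudoMetric.on cantor_metric.

Lemma cantor_metric_complete (F : set_system cantor_metric) :
  ProperFilter F -> cauchy F -> cvg F.
Proof.
move=> FF Fc; apply: (@compact_cauchy_cvg cantor_metric setT F) => //.
- exact: filterT.
- exact: cantor_space_compact.
Qed.

HB.instance Definition _ := Uniform_isComplete.Build cantor_metric cantor_metric_complete.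

Lemma cantor_standard_borel : standard_borel R cantor_borel.
Proof.
exists (cantor_metric : completePseudoMetricType R); split.
- exact: cantor_space_hausdorff.
- pose f (s : seq bool) : cantor_metric := nth false s.
  exists (range f); first by apply: card_le_trans (card_image_le _ _) (countableP _).
  move=> U [b Ub] oU; have [|n nU] := @cyl_nbhs U b; first exact: open_nbhs_nbhs.
  exists (f (mkseq b n)); split; last by exists (mkseq b n).
  apply: nU; rewrite /cyl /= size_mkseq; apply: eq_mkseq_lt => i ilt.
  by rewrite /f nth_mkseq.
- by exists id, id; split.
Qed.

End cantor_metric.

(** * Common factors *)

Definition int_iter (T : Type) (f g : T -> T) (k : int) (x : T) : T :=
  match k with Posz n => iter n f x | Negz n => iter n.+1 g x end.

Lemma int_iterS (T : Type) (f g : T -> T) k x : cancel f g ->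
  int_iter f g (k + 1) x = int_iter f g k (f x).
Proof.
move=> fg; case: k => [n|[|n]].
- by rewrite -PoszD addn1 /int_iter iterSr.
- by rewrite /= fg.
- rewrite (_ : Negz n.+1 + 1 = Negz n); last by rewrite !NegzE; lia.
  by rewrite /int_iter [in RHS]iterSr fg.
Qed.

Lemma measure_preserving_iter d (T : measurableType d) (R : realType)
    (P : probability T R) (f : T -> T) n :
  measure_preserving P P f -> measure_preserving P P (iter n f).
Proof.
move=> fP; elim: n => [|n IH]; last exact: (measure_preserving_comp fP IH).
by split=> //; exact: measurable_id.
Qed.

Lemma measure_preserving_int_iter d (T : measurableType d) (R : realType)
    (P : probability T R) (f g : T -> T) k :
  measure_preserving P P f -> measurable_fun setT g -> cancel f g -> cancel g f ->
  measure_preserving P P (int_iter f g k).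
Proof.
move=> fP mg fg gf; have gP := measure_preserving_inv fP mg fg gf.
by case: k => n; exact: measure_preserving_iter.
Qed.

Lemma int_iter_pair (T U : Type) (f f' : T -> T) (g g' : U -> U) k xz :
  int_iter (fun xz => (f xz.1, g xz.2)) (fun xz => (f' xz.1, g' xz.2)) k xz =
  (int_iter f f' k xz.1, int_iter g g' k xz.2).
Proof.
have h f1 g1 n : iter n (fun xz : T * U => (f1 xz.1, g1 xz.2)) xz =
    (iter n f1 xz.1, iter n g1 xz.2).
  by elim: n => [|n IH] /=; [case: xz|rewrite IH].
by case: k => n; rewrite /int_iter h.
Qed.

Section itinerary.
Variables (e : int -> nat) (e' : nat -> int).
Hypotheses (eK : cancel e e') (e'K : cancel e' e).

(** The factor generated by [A], realised on the Cantor space, where the dynamics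
    is a permutation of the coordinates whatever the system was. *)
Definition itinerary (T : Type) (f g : T -> T) (A : set T) (x : T) : cantor_space :=
  fun n => `[< A (int_iter f g (e' n) x) >].

Lemma itinerary_shift (T : Type) (f g : T -> T) (A : set T) (x : T) : cancel f g ->
  itinerary f g A (f x) = permute (fun n => e (e' n + 1)) (itinerary f g A x).
Proof.
by move=> fg; apply/funext => n; rewrite /permute /itinerary eK int_iterS.
Qed.

Lemma itinerary0 (T : Type) (f g : T -> T) (A : set T) (x : T) :
  itinerary f g A x (e 0) <-> A x.
Proof. by rewrite /itinerary eK; split=> /asboolP. Qed.

Lemma measurable_itinerary d (T : measurableType d) (f g : T -> T) A :
  measurable_fun setT f -> measurable_fun setT g -> measurable A ->
  measurable_fun setT (itinerary f g A : T -> cantor_borel).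
Proof.
move=> mf mg mA; apply: measurable_cantor_fun => n.
have mi (h : T -> T) m : measurable_fun setT h -> measurable_fun setT (iter m h).
  move=> mh; elim: m => [|m IH]; first exact: measurable_id.
  exact: (measurableT_comp mh IH).
have mk k : measurable_fun setT (int_iter f g k) by case: k => m; exact: mi.
apply: (measurable_fun_bool true); rewrite setTI.
rewrite (_ : _ @^-1` _ = int_iter f g (e' n) @^-1` A); first exact: measurable_preimage.
by apply/seteqP; split=> x /=; rewrite /itinerary => /asboolP.
Qed.

End itinerary.

Lemma permute_mds (R : realType) (e : int -> nat) (e' : nat -> int)
    (P : probability cantor_borel R) : cancel e e' -> cancel e' e ->
  measure_preserving P P (permute (fun n => e (e' n + 1)) : cantor_borel -> _) ->
  is_mds (System P (permute (fun n => e (e' n + 1)))).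
Proof.
move=> eK e'K hP; split=> //; first exact: cantor_standard_borel.
exists (permute (fun n => e (e' n - 1))); first exact: measurable_permute.
by split; apply: permuteK => n; rewrite eK ?addrK ?subrK e'K.
Qed.

(** The itineraries of the two sets agree almost surely for the coupling, hence
    have the same law. So the factor of [s] generated by [A] is also a factor
    of [t], and lies in the class. *)
Lemma common_factor (R : realType) (F : system R -> Prop) (s t : system R)
    (J : probability (sys_space t * sys_space s)%type R)
    (A : set (sys_space s)) (D : set (sys_space t)) :
  characteristic F -> F t -> invertible (@sys_map _ s) ->
  measure_preserving J (sys_prob t) fst -> measure_preserving J (sys_prob s) snd ->
  measure_preserving J J (fun xz => (sys_map xz.1, sys_map xz.2)) ->
  measurable A -> measurable D -> {ae J, forall xz, D xz.1 <-> A xz.2} ->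
  exists r (p : sys_space s -> sys_space r) C, [/\ F r, factor_map p,
    measurable C & forall z, A z <-> C (p z)].
Proof.
move=> hF Ft [S' mS' [SS' S'S]] Jt Js JJ mA mD DA.
have [_ tP [T' mT' [TT' T'T]]] : is_mds t by case: hF => /(_ _ Ft).
have [|e [e' [eK e'K]]] := @nat_bijection int Posz; first by move=> m n [].
have mS : measurable_fun setT (@sys_map _ s).
  case: JJ => mJ _.
  have m1 : measurable_fun setT (fun z => (point, z) : sys_space t * sys_space s).
    exact: measurable_fun_pair.
  exact: (measurableT_comp measurable_snd (measurableT_comp mJ m1)).
have mT : measurable_fun setT (@sys_map _ t) by case: tP.
pose qA := itinerary e' (@sys_map _ s) S' A.
pose qD := itinerary e' (@sys_map _ t) T' D.
have mqA : measurable_fun setT (qA : _ -> cantor_borel) by exact: measurable_itinerary.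
have mqD : measurable_fun setT (qD : _ -> cantor_borel) by exact: measurable_itinerary.
pose sg := permute (fun n => e (e' n + 1)).
have sP : measure_preserving (sys_prob s) (sys_prob s) (@sys_map _ s).
  split=> // B mB; rewrite -[RHS](proj2 Js)// -[LHS](proj2 Js); last exact: measurable_preimage.
  rewrite -[RHS](proj2 JJ)//; apply: measurable_preimage => //; exact: measurable_snd.
have qAS z : qA (sys_map z) = sg (qA z) by exact: itinerary_shift.
have qDS x : qD (sys_map x) = sg (qD x) by exact: itinerary_shift.
pose lam := law (sys_prob s) mqA.
have lamP : measure_preserving lam lam (sg : cantor_borel -> cantor_borel).
  split=> [|B mB]; first exact: measurable_permute.
  suff : sys_prob s (qA @^-1` (sg @^-1` B)) = sys_prob s (qA @^-1` B) by [].
  rewrite -[RHS](proj2 sP); last exact: (measurable_preimage mqA mB).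
  by congr (_ _); apply/funext => z; exact: (congr1 B (esym (qAS z))).
have rmds : is_mds (System lam sg) by exact: permute_mds.
have fA : @factor_map R s (System lam sg) qA.
  split; first by split.
  exact: aeW qAS.
exists (System lam sg), qA, [set b : cantor_borel | (b : cantor_space) (e 0)]; split=> //.
- have [_ _ Ffac _] := hF; apply: (Ffac t) => //; exists qD.
  split; last exact: aeW qDS.
  split=> // B mB.
  suff : sys_prob t (qD @^-1` B) = sys_prob s (qA @^-1` B) by [].
  have mA' := measurable_preimage mqA mB; have mD' := measurable_preimage mqD mB.
  rewrite -[LHS](proj2 Jt)// -[RHS](proj2 Js)//.
  apply: ae_iff_measure; [exact: measurable_preimage measurable_fst mD'|exact: measurable_preimage measurable_snd mA'|].
  have h (k : int) : {ae J, forall xz,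
      D (int_iter (@sys_map _ t) T' k xz.1) <-> A (int_iter (@sys_map _ s) S' k xz.2)}.
    have mg : measurable_fun setT (fun xz : sys_space t * sys_space s => (T' xz.1, S' xz.2)).
      by apply: measurable_fun_pair; apply: measurableT_comp => //.
    have JJk : measure_preserving J J (int_iter
        (fun xz => (sys_map xz.1, sys_map xz.2)) (fun xz => (T' xz.1, S' xz.2)) k).
      by apply: measure_preserving_int_iter => // -[x z] /=; rewrite ?TT' ?T'T ?SS' ?S'S.
    by apply: filterS (ae_comp JJk DA) => xz; rewrite int_iter_pair.
  have : {ae J, forall xz, forall n : nat,
      D (int_iter (@sys_map _ t) T' (e' n) xz.1) <-> A (int_iter (@sys_map _ s) S' (e' n) xz.2)}.
    by apply: ae_foralln => n; exact: h.
  apply: filterS => xz hxz /=.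
  suff -> : qD xz.1 = qA xz.2 by [].
  by apply/funext => n; rewrite /qD /qA /itinerary; apply: asbool_equiv_eq.
- rewrite -[X in measurable X]setTI; have := measurable_cantor_coord (e 0).
  by move=> /(_ measurableT [set true]); apply.
- by move=> z; rewrite -[A z](itinerary0 eK (@sys_map _ s) S').
Qed.

(** * The largest factor *)

(** An enumerable family of sets, dense in the measure algebra of every
    probability on the Cantor space. *)
Definition finite_dim (i : nat * seq (seq bool)) : set cantor_space :=
  [set b | mkseq b i.1 \in i.2].

Lemma finite_dim_pred m (q : pred (seq bool)) :
  exists i, finite_dim i = [set b | q (mkseq b m)].
Proof.
exists (m, [seq s <- [seq val t | t : m.-tuple bool] | q s]).
apply/seteqP; split=> b; rewrite /finite_dim /= mem_filter; first by case/andP.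
move=> qb; rewrite qb /=; apply/mapP.
have sz : size (mkseq b m) == m by rewrite size_mkseq.
by exists (Tuple sz) => //; rewrite mem_enum.
Qed.

Lemma measurable_finite_dim i : measurable (finite_dim i : set cantor_borel).
Proof.
rewrite (_ : finite_dim i = \bigcup_(s in [set s | (s \in i.2) && (size s == i.1)]) cyl s).
  by apply: bigcup_count_measurable => s _; exact: measurable_cyl.
apply/seteqP; split=> b /=.
  move=> bi; exists (mkseq b i.1); last exact: cyl_mkseq.
  by rewrite /= size_mkseq eqxx andbT.
by move=> [s /= /andP[si /eqP ss]]; rewrite /cyl /finite_dim /= ss => ->.
Qed.

Section separable.
Variables (R : realType) (P : probability cantor_borel R).

Definition approximable (A : set cantor_borel) := measurable A /\
  forall e : R, 0 < e -> exists i, (P (A `+` finite_dim i) < e%:E)%E.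

Lemma measurable_setY d (T : measurableType d) (A B : set T) :
  measurable A -> measurable B -> measurable (A `+` B).
Proof.
by move=> mA mB; rewrite setYE; apply: measurableD; [exact: measurableU|exact: measurableI].
Qed.

Lemma setY_triangle (T : Type) (A B C : set T) :
  A `+` C `<=` (A `+` B) `|` (B `+` C).
Proof.
move=> x [[Ax nC]|[Cx nA]]; have [Bx|nB] := pselect (B x).
- by right; left.
- by left; left.
- by left; right.
- by right; right.
Qed.

Let P_small A B C (e : R) : measurable A -> measurable B -> measurable C ->
  A `<=` B `|` C -> (P B < (e / 2)%:E)%E -> (P C < (e / 2)%:E)%E -> (P A < e%:E)%E.
Proof.
move=> mA mB mC ABC PB PC.
apply: (@le_lt_trans _ _ (P B + P C)%E).
  apply: (le_trans _ (measureU2 _ mB mC)).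
  by apply: le_measure; rewrite ?inE//; exact: measurableU.
by rewrite [e]splitr EFinD lteD.
Qed.

Lemma approximable_cyl s : approximable (cyl s).
Proof.
split; first exact: measurable_cyl.
move=> e e0; have [i iE] := finite_dim_pred (size s) (pred1 s).
exists i; rewrite iE (_ : _ `+` _ = set0) ?measure0 ?lte_fin//.
rewrite -[RHS](setYK (cyl s)); congr (_ `+` _).
by apply/seteqP; split=> b /=; rewrite /cyl /= => /eqP.
Qed.

Lemma approximableC A : approximable A -> approximable (~` A).
Proof.
move=> [mA hA]; split; first exact: measurableC.
move=> e /hA[i Ai]; have [j jE] := finite_dim_pred i.1 [pred s | s \notin i.2].
exists j; rewrite (_ : _ `+` _ = A `+` finite_dim i)//.
rewrite jE (_ : mkset _ = ~` finite_dim i).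
  by rewrite !setY_def !setDE !setCK setUC; congr (_ `|` _); exact: setIC.
by apply/seteqP; split=> b /=; rewrite /finite_dim /= => /negP.
Qed.

Lemma approximableU A B : approximable A -> approximable B -> approximable (A `|` B).
Proof.
move=> [mA hA] [mB hB]; split; first exact: measurableU.
move=> e e0; have e2 : 0 < e / 2 by rewrite divr_gt0.
have [i Ai] := hA _ e2; have [j Bj] := hB _ e2.
have [k kE] := finite_dim_pred (maxn i.1 j.1)
  [pred s | (take i.1 s \in i.2) || (take j.1 s \in j.2)].
have {}kE : finite_dim k = finite_dim i `|` finite_dim j.
  rewrite kE; apply/seteqP; split=> b /=.
    by rewrite !take_mkseq ?leq_maxl ?leq_maxr// => /orP.
  by move=> /orP; rewrite !take_mkseq ?leq_maxl ?leq_maxr.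
have mi := measurable_finite_dim i; have mj := measurable_finite_dim j.
exists k; apply: P_small Ai Bj; rewrite ?kE; try exact: measurable_setY.
  by apply: measurable_setY; exact: measurableU.
move=> b [[[Ab|Bb] /not_orP[ni nj]]|[[ib|jb] /not_orP[nA nB]]].
- by left; left.
- by right; left.
- by left; right.
- by right; right.
Qed.

Lemma approximable_bigcup (A : (set cantor_borel)^nat) :
  (forall n, approximable (A n)) -> approximable (\bigcup_n A n).
Proof.
move=> hA; have mA n : measurable (A n) by have [] := hA n.
pose U := \bigcup_n A n; pose V k := \big[setU/set0]_(i < k) A i.
have mU : measurable U by exact: bigcup_measurable.
have hV k : approximable (V k).
  elim: k => [|k IH]; last by rewrite /V big_ord_recr; exact: approximableU.
  rewrite /V big_ord0 -setCT; apply: approximableC.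
  by rewrite (_ : setT = cyl [::]); [exact: approximable_cyl|apply/seteqP; split].
have mV k : measurable (V k) by have [] := hV k.
have VU k : V k `<=` U.
  by rewrite /V -bigcup_mkord => b [i _ Ai]; exists i.
split=> // e e0; have e2 : 0 < e / 2 by rewrite divr_gt0.
have : P (U `\` V k) @[k --> \oo] --> 0%E.
  rewrite -(@measure0 _ _ _ P).
  have I0 : \bigcap_k (U `\` V k) = set0.
    apply/seteqP; split=> // b h; have [[i _ Ai] _] := h 0%N I.
    by have [_] := h i.+1 I; apply; rewrite /V -bigcup_mkord; exists i => /=.
  rewrite -[in X in _ --> X]I0; apply: nonincreasing_cvg_mu => //=.
  - by rewrite (le_lt_trans (probability_le1 P _)) ?ltry//; exact: measurableD.
  - by move=> k; exact: measurableD.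
  - by rewrite I0.
  - move=> m n mn; apply/subsetPset => b [Ub nV]; split=> // Vb; apply: nV.
    move: Vb; rewrite /V -!bigcup_mkord => -[i /= im Ai]; exists i => //=.
    exact: leq_trans mn.
move=> /fine_cvgP[_ /cvgrPdist_lt/(_ _ e2)[k _ /(_ k (leqnn k))]].
rewrite /= sub0r normrN ger0_norm ?fine_ge0// => Vk.
have {}Vk : (P (U `+` V k) < (e / 2)%:E)%E.
  rewrite (_ : _ `+` _ = U `\` V k).
    by rewrite -[ltLHS]fineK ?lte_fin// fin_num_measure//; exact: measurableD.
  by rewrite setY_def (_ : V k `\` U = set0) ?setU0//; apply/seteqP; split=> // b [/VU].
have [i Vi] := (hV k).2 _ e2; exists i.
have mi := measurable_finite_dim i.
apply: P_small Vk Vi; try exact: measurable_setY.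
exact: setY_triangle.
Qed.

(** The approximable sets form a sigma-algebra containing the cylinders. *)
Lemma cantor_approximable A : measurable A -> approximable A.
Proof.
rewrite cantor_borelE; move: A; apply: (@smallest_sub _ (sigma_algebra setT) _ approximable).
  split.
  - rewrite -setCT; apply: approximableC.
    by rewrite (_ : setT = cyl [::]); [exact: approximable_cyl|apply/seteqP; split].
  - by move=> A hA; rewrite setTD; exact: approximableC.
  - by move=> A hA; exact: approximable_bigcup.
by move=> _ [s _ <-]; exact: approximable_cyl.
Qed.
End separable.

(** For each finite-dimensional set and each precision one member of [G] that is
    that close to it is kept, if there is any. *)
Lemma dense_subfamily (R : realType) (P : probability cantor_borel R)
    (G : set (set cantor_borel)) : G !=set0 -> G `<=` measurable ->
  exists E : nat -> set cantor_borel, (forall n, G (E n)) /\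
    forall A, G A -> forall e : R, 0 < e -> exists n, (P (A `+` E n) < e%:E)%E.
Proof.
move=> [G0 GG0] Gm.
have /choice[E EP] (x : (nat * seq (seq bool)) * nat) : exists B, G B /\
    ((exists B', G B' /\ (P (B' `+` finite_dim x.1) < (x.2.+1%:R^-1 / 2)%:E)%E) ->
      (P (B `+` finite_dim x.1) < (x.2.+1%:R^-1 / 2)%:E)%E).
  have [[B' [GB' h]]|h] := pselect (exists B', G B' /\
      (P (B' `+` finite_dim x.1) < (x.2.+1%:R^-1 / 2)%:E)%E).
    by exists B'.
  by exists G0; split=> // /h.
pose En n := oapp E G0 (unpickle n).
exists En; split=> [n|A GA e e0].
  by rewrite /En; case: (unpickle n) => //= x; have [] := EP x.
have [k ke] : exists k, k.+1%:R^-1 < e.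
  have [k _ /(_ k (leqnn k)) hk] := near_infty_natSinv_lt (PosNum e0).
  by exists k.
have k0 : 0 < k.+1%:R^-1 / 2 :> R by rewrite divr_gt0// invr_gt0.
have [i Ai] := (cantor_approximable P (Gm _ GA)).2 _ k0.
exists (pickle (i, k)); rewrite /En pickleK /=.
have [GE hE] := EP (i, k); have {}hE := hE (ex_intro _ A (conj GA Ai)).
rewrite /= setYC in hE.
apply: lt_trans (_ : (P (A `+` E (i, k)) < k.+1%:R^-1%:E)%E) _; last by rewrite lte_fin.
have mi := measurable_finite_dim i; have mA := Gm _ GA; have mE := Gm _ GE.
apply: (@le_lt_trans _ _ (P (A `+` finite_dim i) + P (finite_dim i `+` E (i, k)))%E).
  apply: (le_trans _ (measureU2 _ _ _)); try exact: measurable_setY.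
  apply: le_measure; rewrite ?inE; first exact: measurable_setY.
    by apply: measurableU; exact: measurable_setY.
  exact: setY_triangle.
by rewrite [in ltRHS](splitr (k.+1%:R^-1)) EFinD lteD.
Qed.

Section prod_space.
Variables (R : realType) (I : Type) (t : I -> system R).

Lemma measurable_prod_coord i : measurable_fun setT (fun z : prod_space t => z i).
Proof.
by move=> _ A mA; rewrite setTI; apply: sub_sigma_algebra; exists i, A.
Qed.

Lemma measurable_prod_space d (T : measurableType d) (f : T -> prod_space t) :
  (forall i, measurable_fun setT (fun x => f x i)) -> measurable_fun setT f.
Proof.
move=> mf; have := @measurability _ _ T (prod_space t) setT f (@cylinders R I t) erefl.
apply=> _ [_ [i [A [mA ->]]] <-]; rewrite setTI.
exact: measurable_preimage (mf i) mA.
Qed.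

End prod_space.

Section largest.
Variables (R : realType) (F : system R -> Prop).
Hypothesis hF : characteristic F.
Variable s : system R.
Hypothesis s_pres : measure_preserving (sys_prob s) (sys_prob s) (@sys_map _ s).
Hypothesis s_inv : invertible (@sys_map _ s).

(** The sets seen by some factor in the class; a largest factor in the class must
    see all of them. *)
Definition F_measurable : set (set (sys_space s)) :=
  [set A | measurable A /\ exists t (p : sys_space s -> sys_space t) C,
    [/\ F t, factor_map p, measurable C &
      {ae sys_prob s, forall z, A z <-> C (p z)}]].

(** Countably many factors together map [s] to the product of their targets, and
    the image measure is a joining. *)
Lemma factor_map_prod (t : nat -> system R)
    (p : forall n, sys_space s -> sys_space (t n)) :
  (forall n, F (t n)) -> (forall n, factor_map (p n)) ->
  exists2 rho : probability (prod_space t) R, F (System rho (@prod_map R nat t)) &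
    @factor_map _ s (System rho (@prod_map R nat t)) (fun z n => p n z).
Proof.
move=> Ft pF; pose q (z : sys_space s) : prod_space t := fun n => p n z.
have mq : measurable_fun setT q.
  by apply: measurable_prod_space => n; have [[]] := pF n.
have mmap : measurable_fun setT (@prod_map R nat t).
  apply: measurable_prod_space => n.
  have [_ [mt _] _] : is_mds (t n) by case: hF => /(_ _ (Ft n)).
  have h := measurableT_comp mt (@measurable_prod_coord R nat t n).
  exact: h.
have qS : {ae sys_prob s, forall z, q (sys_map z) = prod_map (q z)}.
  have : {ae sys_prob s, forall z, forall n, p n (sys_map z) = sys_map (p n z)}.
    by apply: ae_foralln => n; have [] := pF n.
  by apply: filterS => z h; apply/functional_extensionality_dep => n; exact: h.
pose rho := law (sys_prob s) mq.
have qP : measure_preserving (sys_prob s) rho q by [].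
exists rho; last by split.
have [_ _ _ Fjoin] := hF; apply: Fjoin => //; split.
  split=> // B mB; have [mS sP] := s_pres.
  suff : sys_prob s (q @^-1` (@prod_map R nat t @^-1` B)) = sys_prob s (q @^-1` B) by [].
  have mqB := measurable_preimage mq mB.
  rewrite -[RHS]sP//; apply: ae_iff_measure.
  - exact: measurable_preimage mq (measurable_preimage mmap mB).
  - exact: measurable_preimage.
  - by apply: filterS qS => z /= ->.
move=> n; split; first exact: measurable_prod_coord.
by move=> B mB; have [[_ pP] _] := pF n; rewrite -pP.
Qed.

Variables (P : probability cantor_borel R) (beta : cantor_borel -> sys_space s).
Hypothesis beta_pres : measure_preserving P (sys_prob s) beta.

(** The map [beta] makes the measure algebra of [s] separable, so the sets of a
    sequence approximate all the sets seen by factors in the class. The joining of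
    the factors that see this sequence sees every limit of its members. *)
Lemma universal_F_factor : F_measurable !=set0 ->
  exists t (p : sys_space s -> sys_space t), [/\ F t, factor_map p &
    F_measurable `<=` pullback_algebra p].
Proof.
move=> [A0 hA0]; have [mb bP] := beta_pres.
have [||E [GE dE]] := @dense_subfamily R P [set beta @^-1` A | A in F_measurable].
- by exists (beta @^-1` A0); exists A0.
- by move=> _ [A [mA _] <-]; exact: measurable_preimage.
pose datum := {t : system R & ((sys_space s -> sys_space t) * set (sys_space t))%type}.
have /choice[D DP] n : exists x : set (sys_space s) * datum,
    [/\ beta @^-1` x.1 = E n, measurable x.1, F (projT1 x.2),
     factor_map (projT2 x.2).1 &
     measurable (projT2 x.2).2 /\
      {ae sys_prob s, forall z, x.1 z <-> (projT2 x.2).2 ((projT2 x.2).1 z)}].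
  have [A [mA [t [p [C [Ft pF mC AC]]]]] AE] := GE n.
  by exists (A, existT _ t (p, C)).
pose t n := projT1 (D n).2; pose p n := (projT2 (D n).2).1; pose C n := (projT2 (D n).2).2.
have [rho Frho qF] := @factor_map_prod t p
  (fun n => let: And5 _ _ h _ _ := DP n in h) (fun n => let: And5 _ _ _ h _ := DP n in h).
exists (System rho (@prod_map R nat t)), (fun z n => p n z); split=> // A hA.
have [mA _] := hA; split=> //.
have /choice[g gP] k : exists n,
    (sys_prob s (A `+` (D n).1) < (1 / (2 ^ k.+1)%:R)%:E)%E.
  have [||n] := dE (beta @^-1` A) _ (1 / (2 ^ k.+1)%:R); first by exists A.
    by rewrite divr_gt0// ltr0n expn_gt0.
  have [DE mD _ _ _] := DP n; rewrite -DE => hn; exists n.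
  by rewrite -bP//; exact: measurable_setY.
have mD n : measurable (D n).1 by have [] := DP n.
have mC n : measurable (C n) by have [_ _ _ _ []] := DP n.
(* The errors are summable, so almost every point lies in finitely many. *)
have null : sys_prob s (lim_sup_set (fun k => A `+` (D (g k)).1)) = 0%E.
  apply: lim_sup_set_cvg0; first by move=> k; exact: measurable_setY.
  apply: (@le_lt_trans _ _ (1%:E)); last exact: ltry.
  apply: (le_trans _ (epsilon_trick0 xpredT ler01)).
  by apply: lee_nneseries => [k _ _|k _]; [exact: measure_ge0|exact: (ltW (gP k))].
exists (lim_sup_set (fun k => (fun x : prod_space t => x (g k)) @^-1` C (g k))).
  apply: bigcapT_measurable => n; apply: bigcup_measurable => k _.
  exact: (measurable_preimage (@measurable_prod_coord R nat t (g k)) (mC (g k))).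
have : {ae sys_prob s, forall z, forall n, (D n).1 z <-> C n (p n z)}.
  by apply: ae_foralln => n; have [_ _ _ _ []] := DP n.
have : {ae sys_prob s, forall z, ~ lim_sup_set (fun k => A `+` (D (g k)).1) z}.
  exists (lim_sup_set (fun k => A `+` (D (g k)).1)); split=> //.
    apply: bigcapT_measurable => n; apply: bigcup_measurable => k _.
    exact: measurable_setY.
  by move=> z /= /contrapT.
apply: filterS2 => z nlim DC.
have [n hn] : exists n, forall k, (n <= k)%N -> (A z <-> (D (g k)).1 z).
  apply: contrapT => /forallNP h; apply: nlim => n _.
  have /existsNP[k /not_implyP[nk hk]] := h n; exists k => //=.
  apply: contrapT => hY; apply: hk.
  by split=> Hx; apply: contrapT => Hn; apply: hY; [left|right].
split=> [Az m _|].
  exists (maxn n m); first exact: leq_maxr.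
  by apply/DC/hn => //; exact: leq_maxl.
by move=> /(_ n I)[k /= nk /DC /hn]; apply.
Qed.

(** Any factor in the class consists of sets that it sees itself, so the factor
    seeing all of [F_measurable] is the largest one. *)
Lemma largest_F_factor_exists : F_measurable !=set0 ->
  exists G, is_largest_F_factor F G /\ F_measurable `<=` G.
Proof.
move=> /universal_F_factor[t [p [Ft pF hp]]]; exists (pullback_algebra p).
split=> //; split; first exact: pullback_F_factor.
move=> G' [_ mG' _ [t' [p' [Ft' pF' _ hG']]]] A GA; apply: hp.
have mA := mG' _ GA; split=> //.
have [C mC AC] := hG' _ GA; exists t', p', C; split=> //.
apply/symdiff0_ae => //; have [[mp' _] _] := pF'; exact: measurable_preimage.
Qed.

End largest.

(** * Disintegration of a measure on the Cantor space over a factor *)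

Lemma cylU s : cyl s = cyl (rcons s false) `|` cyl (rcons s true).
Proof.
rewrite !cyl_rcons -setIUr [X in _ `&` X](_ : _ = setT) ?setIT//.
by apply/seteqP; split=> // b _ /=; case: (b (size s)); [right|left].
Qed.

Section disintegration.
Context d (Z : measurableType d) (R : realType).
Variables (P : probability cantor_borel R) (beta : cantor_borel -> Z).
Hypothesis mbeta : measurable_fun setT beta.
Local Notation kappa := (law P mbeta).
Local Notation UR := (measurableTypeR R).

(** A Radon-Nikodym derivative with respect to the law of [beta]. *)
Lemma conditional_probability (A : set cantor_borel) : measurable A ->
  exists q : Z -> R, [/\ forall z, 0 <= q z, measurable_fun setT q,
    kappa.-integrable setT (EFin \o q) &
    forall B, measurable B -> P (A `&` beta @^-1` B) = (\int[kappa]_(z in B) (q z)%:E)%E].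
Proof.
move=> mA; pose nu0 := image_measure (mrestr P mA) mbeta.
have nu0E B : nu0 B = P (A `&` beta @^-1` B) by rewrite image_measureE /= /mrestr setIC.
have fin : fin_num_fun nu0.
  move=> B mB; rewrite nu0E fin_num_measure//; apply: measurableI => //.
  exact: measurable_preimage.
pose nu : {finite_measure set Z -> \bar R} := HB.pack (nu0 : set Z -> \bar R)
  (Measure.class nu0) (Measure_isFinite.Build _ _ _ nu0 fin).
have nuk : nu `<< kappa.
  apply/null_content_dominatesP => B mB kB0.
  apply/eqP; rewrite -measure_le0 -kB0 -[leRHS]/(P (beta @^-1` B)).
  have mb := measurable_preimage mbeta mB.
  by rewrite -[leLHS]/(nu0 B) nu0E; apply: le_measure; rewrite ?inE//; exact: measurableI.
have [f [f0 ffin fint fE]] := radon_nikodym_sigma_finite nuk.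
exists (fine \o f); split=> [z||| B mB].
- by rewrite fine_ge0.
- have mf := measurable_int _ fint; exact: measurableT_comp.
- by apply: eq_integrable fint => // z _; rewrite /= fineK.
- by rewrite -nu0E -[nu0 B]/(nu B) fE//; apply: eq_integral => z _; rewrite /= fineK.
Qed.

(** Conditional probabilities of cylinders add up only almost surely. On the
    exceptional null set they are replaced by the weights of a fair sequence. *)
Lemma consistent_weights : exists w : seq bool -> Z -> R,
  [/\ forall z, w [::] z = 1, forall s z, 0 <= w s z,
     forall s z, w s z = w (rcons s false) z + w (rcons s true) z,
     forall s, measurable_fun setT (w s) &
     forall s B, measurable B ->
       P (cyl s `&` beta @^-1` B) = (\int[kappa]_(z in B) (w s z)%:E)%E].
Proof.
have /choice[q qP] s := conditional_probability (measurable_cyl s).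
have q0 s z : 0 <= q s z by have [] := qP s.
have mq s : measurable_fun setT (q s) by have [] := qP s.
have iq s : kappa.-integrable setT (EFin \o q s) by have [] := qP s.
have qE s : forall B, measurable B ->
  P (cyl s `&` beta @^-1` B) = (\int[kappa]_(z in B) (q s z)%:E)%E by have [] := qP s.
(* The points at which the weights of all cylinders are consistent. *)
pose good z := (q [::] z == 1) &&
  `[< forall s, q s z == q (rcons s false) z + q (rcons s true) z >].
pose w s z := if good z then q s z else 2^-1 ^+ size s.
have mgood : measurable_fun setT good.
  apply: measurable_and.
    by apply: measurable_fun_eqr => //; exact: measurable_cst.
  apply: (measurable_fun_bool true); rewrite setTI.
  rewrite (_ : _ @^-1` _ = ~` \bigcup_(s in setT)
      ((fun z => q s z == q (rcons s false) z + q (rcons s true) z) @^-1` [set false])).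
    apply: measurableC; apply: bigcup_count_measurable => s _.
    apply: measurable_preimage => //; apply: measurable_fun_eqr => //.
    exact: measurable_funD.
  apply/seteqP; split=> z /=; first by move=> /asboolP h [s _ /=]; rewrite h.
  by move=> h; apply/asboolP => s; apply/negP => /negP /negbTE hs; apply: h; exists s.
have ae1 : {ae kappa, forall z, q [::] z = 1}.
  have : ae_eq kappa setT (EFin \o q [::]) (EFin \o cst 1).
    apply: integral_ae_eq => // [|E _ mE]; first exact/measurable_EFinP/measurable_cst.
    rewrite -qE// (_ : cyl [::] = setT) ?setTI; last by apply/seteqP; split.
    by rewrite -[RHS]/(\int[kappa]_(z in E) cst 1%E z)%E integral_cst// mul1e.
  by apply: filterS => z /(_ I) [].
have aeD : {ae kappa, forall z, forall s, q s z = q (rcons s false) z + q (rcons s true) z}.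
  have h s : {ae kappa, forall z, q s z = q (rcons s false) z + q (rcons s true) z}.
    have : ae_eq kappa setT (EFin \o q s)
        (EFin \o (fun z => q (rcons s false) z + q (rcons s true) z)).
      apply: integral_ae_eq => // [|E _ mE].
        by apply/measurable_EFinP; exact: measurable_funD.
      under [RHS]eq_integral do rewrite /= EFinD.
      rewrite ge0_integralD//; try by [move=> z _; rewrite lee_fin|apply/measurable_EFinP; exact: measurable_funTS].
      have mbE := measurable_preimage mbeta mE.
      have mc b : measurable (cyl (rcons s b) `&` beta @^-1` E : set cantor_borel).
        by apply: measurableI => //; exact: measurable_cyl.
      rewrite -!qE// -[RHS]measureU//.
        by rewrite -setIUl; congr (P (_ `&` _)); exact: cylU.
      by rewrite setIACA !cyl_rcons; apply/seteqP; split=> // b [[[_ /= ->]]] [].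
    by apply: filterS => z /(_ I) [].
  exact: ae_forall_count.
have wq s : {ae kappa, forall z, w s z = q s z}.
  apply: filterS2 ae1 aeD => z h1 hD; rewrite /w ifT// /good h1 eqxx /=.
  by apply/asboolP => s'; rewrite -hD.
exists w; split=> [z|s z|s z|s|s B mB].
- by rewrite /w; case: ifPn => [/andP[/eqP//]|_]; rewrite expr0.
- by rewrite /w; case: ifPn => // _; rewrite exprn_ge0// invr_ge0.
- rewrite /w; case: ifPn => [/andP[_ /asboolP /(_ s) /eqP//]|_].
  by rewrite !size_rcons exprS; lra.
- apply: measurable_fun_ifT => //; exact: measurable_cst.
- rewrite qE//; apply: ae_eq_integral => //.
  + by apply/measurable_EFinP; exact: measurable_funTS.
  + by apply/measurable_EFinP/measurable_funTS/measurable_fun_ifT => //; exact: measurable_cst.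
  + by apply: filterS (wq s) => z /= ->.
Qed.

(** A point with the conditional law given [z] is a random branch for the
    conditional weights of the cylinders, driven by a uniform variable independent
    of [z]. *)
Lemma disintegration : exists2 xi : Z * UR -> cantor_borel, measurable_fun setT xi &
  forall A B, measurable A -> measurable B ->
    (kappa \x unif R)%E [set p | A (xi p) /\ B p.1] = P (A `&` beta @^-1` B).
Proof.
have [w [w1 w0 wD mw wE]] := consistent_weights.
exists (tree_path w : Z * UR -> cantor_borel); first exact: measurable_path.
move=> A B mA mB.
have mB1 : measurable (fst @^-1` B : set (Z * UR)).
  exact: (measurable_preimage measurable_fst mB).
have mbB := measurable_preimage mbeta mB.
pose m1 := image_measure (mrestr (kappa \x unif R)%E mB1) (measurable_path mw).
pose m2 : {measure set cantor_borel -> \bar R} := mrestr P mbB.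
have cylE s : m1 (cyl s) = m2 (cyl s).
  rewrite /m1 /m2 image_measureE /= /mrestr wE// [RHS]integral_mkcond.
  apply: eq_integral => z _; rewrite patchE /=.
  case: ifPn => [/set_mem Bz|/negP nBz].
    rewrite -(path_law w1 w0 wD mw z s); congr (unif R _).
    by apply/seteqP; split=> t; rewrite xsectionE /=; [case|].
  transitivity (unif R set0); last exact: measure0.
  congr (unif R _).
  by apply/seteqP; split=> t; rewrite xsectionE //= => -[_ Bz]; apply: nBz; apply/mem_set.
rewrite -[LHS]/(m1 A) -[RHS]/(m2 A); apply: cantor_measure_unique => //.
rewrite /m1 image_measureE /= /mrestr; apply: (@le_lt_trans _ _ 1%E); last exact: ltry.
by rewrite preimage_setT setTI; exact: probability_le1.
Qed.

End disintegration.

(** * The relatively independent self-joining *)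

Lemma ae_eq_of_expect d (T : measurableType d) (R : realType)
    (P : probability T R) (f g : T -> R) : bounded_mfun f -> bounded_mfun g ->
  (forall B, measurable B -> \int[P]_x (f x * \1_B x) = \int[P]_x (g x * \1_B x)) ->
  {ae P, forall x, f x = g x}.
Proof.
move=> bf bg fg; have [mf _] := bf; have [mg _] := bg.
have : ae_eq P setT (EFin \o f) (EFin \o g).
  have h k E : bounded_mfun k -> measurable E ->
      (\int[P]_(x in E) (EFin \o k) x)%E = (\int[P]_x (k x * \1_E x))%:E.
    move=> bk mE; rewrite -EFin_expect; last exact: bounded_mfunM bk (bounded_mfun_indic R mE).
    rewrite integral_mkcond; apply: eq_integral => x _; rewrite patchE indicE.
    by case: ifP; rewrite ?mulr1 ?mulr0.
  apply: integral_ae_eq => // [||E _ mE].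
  - exact: bounded_mfun_int.
  - exact/measurable_EFinP.
  - by rewrite !h// fg.
by apply: filterS => x /(_ I) [].
Qed.

Lemma expect_preserving d d' (T : measurableType d) (T' : measurableType d')
    (R : realType) (P : probability T R) (Q : probability T' R) (f : T -> T')
    (g : T' -> R) : measure_preserving P Q f -> bounded_mfun g ->
  \int[Q]_x g x = \int[P]_x g (f x).
Proof.
move=> [mf fP] bg; rewrite -(expect_law P mf bg.1 (bounded_mfun_comp bg mf)); congr fine.
by apply: eq_measure_integral => A mA _; exact: (esym (fP A mA)).
Qed.

Lemma expect_indicI d (T : measurableType d) (R : realType)
    (P : probability T R) (A : set T) : measurable A ->
  (\int[P]_x (\1_A x : R))%:E = P A.
Proof. by move=> mA; rewrite expect_indic// fineK// fin_num_measure. Qed.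

Lemma bounded_mfun_prod d (T : measurableType d) (R : realType) (n : nat)
    (g : nat -> T -> R) : (forall i, bounded_mfun (g i)) ->
  bounded_mfun (fun x => \prod_(i < n) g i x).
Proof.
move=> bg; elim: n => [|n IH].
  by under eq_fun do rewrite big_ord0; exact: bounded_mfun_cst.
by under eq_fun do rewrite big_ord_recr; exact: bounded_mfunM.
Qed.

Lemma probability_rect_unique d1 d2 (T1 : measurableType d1)
    (T2 : measurableType d2) (R : realType) (P Q : probability (T1 * T2)%type R) :
  (forall A B, measurable A -> measurable B -> P (A `*` B) = Q (A `*` B)) ->
  forall E, measurable E -> P E = Q E.
Proof.
move=> PQ; pose G : set (set (T1 * T2)) :=
  [set E | exists A B, [/\ measurable A, measurable B & E = A `*` B]].
apply: (@probability_unique _ _ _ G).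
- rewrite measurable_prod_measurableType; congr (<<s _ >>).
  rewrite predeqE => E; split=> [[A mA [B mB <-]]|[A [B [mA mB ->]]]].
    by exists A, B.
  by exists A => //; exists B.
- move=> _ _ [A [B [mA mB ->]]] [A' [B' [mA' mB' ->]]].
  by rewrite -setXI; exists (A `&` A'), (B `&` B'); split=> //; exact: measurableI.
- by move=> _ [A [B [mA mB ->]]]; exact: PQ.
Qed.

Section iid_moments.
Variable R : realType.
Local Notation UR := (measurableTypeR R).
Local Notation iid := (@iid R).

Lemma unpair_preserving : measure_preserving (unif R) (unif R \x unif R)%E
  (fun v : UR => (unpair1 v, unpair2 v)).
Proof.
have m12 : measurable_fun setT (fun v : UR => (unpair1 v, unpair2 v)).
  by apply: measurable_fun_pair; [exact: measurable_unpair1|exact: measurable_unpair2].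
split=> // E mE; rewrite -(lawE (unif R) m12).
apply: probability_rect_unique mE => A B mA mB.
rewrite [RHS]product_measure1E//; exact: unif_unpair.
Qed.

Lemma unpair2_preserving : measure_preserving (unif R) (unif R) (@unpair2 R).
Proof.
split=> [|A mA]; first exact: measurable_unpair2.
have := unif_unpair measurableT mA; rewrite probability_setT mul1e => <-.
by congr (unif R _); apply/seteqP; split=> v //= -[].
Qed.

Lemma iid_uncorrelated (G : UR -> R) i j : bounded_mfun G ->
  \int[unif R]_v G v = 0 -> (i < j)%N ->
  \int[unif R]_v (G (iid i v) * G (iid j v)) = 0.
Proof.
move=> bG G0; elim: i j => [|i IH] [|j] // ij.
  have bGj : bounded_mfun (fun y => G (iid j y)).
    exact: (bounded_mfun_comp bG (measurable_iid j)).
  pose g (p : UR * UR) := G p.1 * G (iid j p.2).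
  have bg : bounded_mfun g.
    apply: bounded_mfunM; first exact: (bounded_mfun_comp bG measurable_fst).
    exact: (bounded_mfun_comp bGj measurable_snd).
  transitivity (\int[unif R]_v g (unpair1 v, unpair2 v)); first by [].
  rewrite -(expect_preserving unpair_preserving bg) expect_prod//.
  rewrite (_ : (fun x => _) = fun x => G x * \int[unif R]_y G (iid j y)).
    by rewrite expectZr// G0 mul0r.
  by apply/funext => x; rewrite -expectZl.
have bij k : bounded_mfun (fun y => G (iid k y)).
  exact: (bounded_mfun_comp bG (measurable_iid k)).
by rewrite -(expect_preserving unpair2_preserving (bounded_mfunM (bij i) (bij j))) IH.
Qed.

(** Distinct terms are uncorrelated, so only the [n] diagonal terms of the double
    sum contribute. *)
Lemma iid_variance (G : UR -> R) M n : bounded_mfun G -> (forall v, `|G v| <= M) ->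
  \int[unif R]_v G v = 0 -> (0 < n)%N ->
  \int[unif R]_v (n%:R^-1 * \sum_(i < n) G (iid i v)) ^+ 2 <= M ^+ 2 / n%:R.
Proof.
move=> bG GM G0 n0; have n0' : 0 < n%:R :> R by rewrite ltr0n.
have bi k : bounded_mfun (fun y => G (iid k y)).
  exact: (bounded_mfun_comp bG (measurable_iid k)).
have bij k l : bounded_mfun (fun y => G (iid k y) * G (iid l y)) by exact: bounded_mfunM.
have -> : (fun v => (n%:R^-1 * \sum_(i < n) G (iid i v)) ^+ 2) =
    (fun v => n%:R^-1 ^+ 2 * \sum_(i < n) \sum_(j < n) (G (iid i v) * G (iid j v))).
  apply/funext => v; rewrite exprMn; congr (_ * _).
  by rewrite expr2 big_distrl; apply: eq_bigr => i _; rewrite big_distrr.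
rewrite expectZl; last by do 2! apply: bounded_mfun_sum => ?.
rewrite expect_sum; last by move=> i; apply: bounded_mfun_sum.
have term (i : 'I_n) : \int[unif R]_v (\sum_(j < n) (G (iid i v) * G (iid j v))) <= M ^+ 2.
  rewrite expect_sum// (bigD1 i)//= big1 ?addr0.
    rewrite -[leRHS](expect_cst (unif R)); apply: le_expect => //.
      exact: bounded_mfun_cst.
    by move=> v; rewrite -expr2 -real_normK ?num_real// lerXn2r// ?nnegrE// (le_trans _ (GM v)).
  move=> j ji; have [ij|ij|/val_inj ij] := ltngtP i j.
  - exact: iid_uncorrelated.
  - rewrite -[RHS](iid_uncorrelated bG G0 ij); apply: eq_Rintegral => v _.
    by rewrite mulrC.
  - by rewrite ij eqxx in ji.
apply: (@le_trans _ _ (n%:R^-1 ^+ 2 * (n%:R * M ^+ 2))).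
  rewrite ler_wpM2l ?exprn_ge0 ?invr_ge0//.
  by rewrite mulr_natl -[X in _ *+ X]card_ord -sumr_const; apply: ler_sum => i _; exact: term.
by rewrite expr2 -mulrA mulKf ?gt_eqF// mulrC.
Qed.

End iid_moments.

Section self_joining.
Variables (R : realType) (F : system R -> Prop) (t : system R).
Hypotheses (hF : characteristic F) (Ft : F t).
Variables (d : measure_display) (Z : measurableType d) (S S' : Z -> Z).
Hypotheses (mS : measurable_fun setT S) (mS' : measurable_fun setT S').
Hypotheses (SK : cancel S S') (S'K : cancel S' S).
Variables (P : probability cantor_borel R) (sg : cantor_borel -> cantor_borel).
Hypothesis sgP : measure_preserving P P sg.
Variable alpha : cantor_borel -> sys_space t.
Hypothesis alphaP : measure_preserving P (sys_prob t) alpha.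
Hypothesis alphaT : {ae P, forall b, alpha (sg b) = sys_map (alpha b)}.
Variable beta : cantor_borel -> Z.
Hypothesis mbeta : measurable_fun setT beta.
Hypothesis betaS : {ae P, forall b, beta (sg b) = S (beta b)}.
Local Notation kappa := (law P mbeta).
Local Notation UR := (measurableTypeR R).
Variable xi : Z * UR -> cantor_borel.
Hypothesis mxi : measurable_fun setT xi.
Hypothesis xiP : forall A B, measurable A -> measurable B ->
  (kappa \x unif R)%E [set p | A (xi p) /\ B p.1] = P (A `&` beta @^-1` B).

Let malpha : measurable_fun setT alpha. Proof. by case: alphaP. Qed.
Let msg : measurable_fun setT sg. Proof. by case: sgP. Qed.
Let mT : measurable_fun setT (@sys_map _ t).
Proof. by have [_ [] ] : is_mds t by case: hF => /(_ _ Ft). Qed.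

Lemma kappa_preserving : measure_preserving kappa kappa S.
Proof.
split=> // B mB; suff : P (beta @^-1` (S @^-1` B)) = P (beta @^-1` B) by [].
have mb := measurable_preimage mbeta mB.
rewrite -[RHS](proj2 sgP)//; apply: ae_iff_measure.
- exact: measurable_preimage mbeta (measurable_preimage mS mB).
- exact: measurable_preimage.
- by apply: filterS betaS => b /= ->.
Qed.

(** The conditional probability of [A] given that [beta] takes the value [z]. *)
Definition cond (A : set cantor_borel) (z : Z) : R :=
  fine (unif R [set v | A (xi (z, v))]).

Lemma condE A z : measurable A -> cond A z = \int[unif R]_v \1_(xi @^-1` A) (z, v).
Proof.
move=> mA; rewrite /cond -expect_indic//.
have := measurable_preimage (measurable_pair1 z) (measurable_preimage mxi mA).
exact.
Qed.

Lemma bounded_cond A : measurable A -> bounded_mfun (cond A).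
Proof.
move=> mA; rewrite (_ : cond A = fun z => \int[unif R]_v \1_(xi @^-1` A) (z, v)).
  exact: (bounded_mfun_fubini kappa (unif R) (bounded_mfun_indic R (measurable_preimage mxi mA))).
by apply/funext => z; exact: condE.
Qed.

Lemma expect_cond A B : measurable A -> measurable B ->
  \int[kappa]_z (cond A z * \1_B z) = fine (P (A `&` beta @^-1` B)).
Proof.
move=> mA mB; rewrite -xiP//.
have mAx := measurable_preimage mxi mA; have mB1 := measurable_preimage (@measurable_fst _ _ Z UR) mB.
have m1 : measurable (xi @^-1` A `&` fst @^-1` B) by exact: measurableI.
transitivity (fine ((kappa \x unif R)%E (xi @^-1` A `&` fst @^-1` B))); last by [].
rewrite -expect_indic// expect_prod; last exact: bounded_mfun_indic.
apply: eq_Rintegral => z _; rewrite condE// -expectZr; last first.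
  apply: bounded_mfun_comp (measurable_pair1 z).
  exact: bounded_mfun_indic.
by apply: eq_Rintegral => v _; rewrite indicI.
Qed.

Lemma cond_ae_eq A A' : measurable A -> measurable A' ->
  {ae P, forall b, A b <-> A' b} -> {ae kappa, forall z, cond A z = cond A' z}.
Proof.
move=> mA mA' AA'; apply: ae_eq_of_expect => [||B mB]; try exact: bounded_cond.
rewrite !expect_cond//; congr fine; have mb := measurable_preimage mbeta mB.
apply: ae_iff_measure; try exact: measurableI.
by apply: filterS AA' => b [h1 h2]; split=> -[]; split=> //; [exact: h1|exact: h2].
Qed.

(** Both sides have the same integral against every indicator, because [sg]
    preserves [P] and moves [beta] by [S]. *)
Lemma cond_shift A : measurable A ->
  {ae kappa, forall z, cond (sg @^-1` A) z = cond A (S z)}.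
Proof.
move=> mA; have mgA := measurable_preimage msg mA.
apply: ae_eq_of_expect => [||B mB]; first exact: bounded_cond.
  exact: bounded_mfun_comp (bounded_cond mA) mS.
have mB' := measurable_preimage mS' mB; have mbB' := measurable_preimage mbeta mB'.
rewrite expect_cond//; transitivity (\int[kappa]_z (cond A z * \1_(S' @^-1` B) z)).
  rewrite expect_cond// -[in RHS](proj2 sgP); last exact: measurableI.
  congr fine; apply: ae_iff_measure.
  - by apply: measurableI => //; exact: measurable_preimage.
  - by apply: measurable_preimage => //; exact: measurableI.
  - by apply: filterS betaS => b /= ->; rewrite SK.
have bA := bounded_mfunM (bounded_cond mA) (bounded_mfun_indic R mB').
rewrite (expect_preserving kappa_preserving bA); apply: eq_Rintegral => z _.
rewrite !indicE; congr (_ * (nat_of_bool _)%:R).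
by apply/idP/idP => /set_mem h; apply/mem_set; move: h; rewrite /= SK.
Qed.

(** Copies of [alpha] that are independent given [z]; they share the value [z]
    and read separate parts of one uniform variable. *)
Definition joint (p : Z * UR) : prod_space (fun _ : nat => t) * Z :=
  (fun i => alpha (xi (p.1, iid i p.2)), p.1).

Let m_xi_iid i : measurable_fun setT (fun p : Z * UR => xi (p.1, iid i p.2)).
Proof.
have h : measurable_fun setT (fun p : Z * UR => (p.1, iid i p.2)).
  apply: measurable_fun_pair => //.
  exact: (measurableT_comp (measurable_iid i) measurable_snd).
exact: (measurableT_comp mxi h).
Qed.

Lemma measurable_joint : measurable_fun setT joint.
Proof.
apply: measurable_fun_pair => //; apply: measurable_prod_space => i.
exact: (measurableT_comp malpha (m_xi_iid i)).
Qed.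

Definition joint_law : probability (prod_space (fun _ : nat => t) * Z)%type R :=
  law (kappa \x unif R)%E measurable_joint.

Lemma iid_cond_law n (A : nat -> set cantor_borel) (B : set Z) :
  (forall i, measurable (A i)) -> measurable B ->
  (kappa \x unif R)%E
    [set p | (forall i, (i < n)%N -> A i (xi (p.1, iid i p.2))) /\ B p.1] =
  (\int[kappa]_z (\1_B z * \prod_(i < n) cond (A i) z))%:E.
Proof.
move=> mA mB; rewrite -EFin_expect; last first.
  apply: bounded_mfunM; first exact: bounded_mfun_indic.
  by apply: (@bounded_mfun_prod _ _ R n (fun i => cond (A i))) => i; exact: bounded_cond.
apply: eq_integral => z _ /=; rewrite xsectionE indicE.
case: (boolP (z \in B)) => [/set_mem Bz|/negP nBz].
  have mAz i : measurable [set v | A i (xi (z, v))].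
    exact: (measurable_preimage (measurable_pair1 z) (measurable_preimage mxi (mA i))).
  rewrite mul1r -(iid_law n mAz); congr (unif R _).
  by apply/seteqP; split=> v /=; [case|].
rewrite mul0r; transitivity (unif R set0); last exact: measure0.
congr (unif R _); apply/seteqP; split=> v //= -[_ Bz].
by apply: nBz; apply/mem_set.
Qed.

Definition box n (A : nat -> set (sys_space t)) (B : set Z) :
    set (prod_space (fun _ : nat => t) * Z) :=
  [set xz | (forall i, (i < n)%N -> A i (xz.1 i)) /\ B xz.2].

Definition boxes : set (set (prod_space (fun _ : nat => t) * Z)) :=
  [set E | exists n A B, [/\ forall i, measurable (A i), measurable B & E = box n A B]].

Lemma joint_law_box n A B : (forall i, measurable (A i)) -> measurable B ->
  joint_law (box n A B) =
  (\int[kappa]_z (\1_B z * \prod_(i < n) cond (alpha @^-1` A i) z))%:E.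
Proof.
move=> mA mB.
exact: (iid_cond_law n (fun i => measurable_preimage malpha (mA i)) mB).
Qed.

Lemma boxesI : setI_closed boxes.
Proof.
move=> _ _ [n [A [B [mA mB ->]]]] [n' [A' [B' [mA' mB' ->]]]].
pose A2 i := (if (i < n)%N then A i else setT) `&` (if (i < n')%N then A' i else setT).
exists (maxn n n'), A2, (B `&` B'); split.
- by move=> i; apply: measurableI; case: ifP.
- exact: measurableI.
apply/seteqP; split=> xz /=; rewrite /box /A2 /=.
  move=> [[h1 Bz] [h2 B'z]]; split=> // i _; split; case: ifP => // ilt.
    exact: h1.
  exact: h2.
move=> [h [Bz B'z]]; split; split=> // i ilt.
  by have [] := h i (leq_trans ilt (leq_maxl _ _)); rewrite ilt.
by have [_] := h i (leq_trans ilt (leq_maxr _ _)); rewrite ilt.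
Qed.

Lemma boxes_generate :
  @measurable _ (prod_space (fun _ : nat => t) * Z)%type = <<s boxes >>.
Proof.
apply/seteqP; split; last first.
  apply: smallest_sub; first exact: sigma_algebra_measurable.
  move=> _ [n [A [B [mA mB ->]]]].
  rewrite (_ : box n A B = (\bigcap_(i in `I_n) ((fun xz => xz.1 i) @^-1` A i)) `&` snd @^-1` B)//.
  apply: measurableI; last exact: measurable_preimage.
  apply: bigcap_measurableType => i _.
  apply: measurable_preimage (mA i).
  exact: (measurableT_comp (@measurable_prod_coord R nat (fun=> t) i) measurable_fst).
pose W := g_sigma_algebraType boxes.
have mboxes n A B : (forall i, measurable (A i)) -> measurable B ->
    measurable (box n A B : set W).
  by move=> mA mB; apply: sub_sigma_algebra; exists n, A, B.
have m1 : measurable_fun setT (fst : W -> prod_space (fun _ : nat => t)).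
  apply: measurable_prod_space => i _ A mA; rewrite setTI.
  rewrite (_ : _ @^-1` _ = box i.+1 (fun j => if j == i then A else setT) setT).
    by apply: mboxes => // j; case: ifP.
  apply/seteqP; split=> x /=.
    by move=> Ax; split=> // j _; case: eqP => [->|].
  by move=> [/(_ i (leqnn _))]; rewrite eqxx.
have m2 : measurable_fun setT (snd : W -> Z).
  move=> _ B mB; rewrite setTI.
  rewrite (_ : _ @^-1` _ = box 0 (fun=> setT) B); first exact: mboxes.
  by apply/seteqP; split=> x //= -[].
move=> E mE; have := measurable_preimage (measurable_fun_pair m1 m2) mE.
rewrite (_ : _ @^-1` _ = E)//; apply/seteqP; split=> -[x z] //.
Qed.

Let mmap : measurable_fun setT (@prod_map R nat (fun=> t)).
Proof.
apply: measurable_prod_space => n.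
have h := measurableT_comp mT (@measurable_prod_coord R nat (fun=> t) n).
exact: h.
Qed.

(** Boxes determine the law, and the probability of a box is the integral of a
    product of conditional probabilities, each of which moves with [S]. *)
Lemma joint_law_invariant : measure_preserving joint_law joint_law
  (fun xz => (@prod_map R nat (fun=> t) xz.1, S xz.2)).
Proof.
have m12 : measurable_fun setT (fun xz : prod_space (fun _ : nat => t) * Z =>
    (@prod_map R nat (fun=> t) xz.1, S xz.2)).
  apply: measurable_fun_pair.
    exact: (measurableT_comp mmap measurable_fst).
  exact: (measurableT_comp mS measurable_snd).
have key E : measurable E -> law joint_law m12 E = joint_law E; last first.
  by split=> [|E mE]; [exact: m12|rewrite -(key E mE); exact: (esym (lawE joint_law m12 E))].
apply: (probability_unique boxes_generate boxesI) => _ [n [A [B [mA mB ->]]]].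
have mTA i : measurable (@sys_map _ t @^-1` A i) by exact: measurable_preimage.
have mSB := measurable_preimage mS mB.
apply: (etrans (lawE joint_law m12 _)).
transitivity (joint_law (box n (fun i => @sys_map _ t @^-1` A i) (S @^-1` B))).
  exact: erefl.
rewrite (joint_law_box _ mTA mSB) (joint_law_box _ mA mB); congr EFin.
have bB D (C : nat -> set cantor_borel) : measurable D -> (forall i, measurable (C i)) ->
    bounded_mfun (fun z => \1_D z * \prod_(i < n) cond (C i) z : R).
  move=> mD mC; apply: bounded_mfunM; first exact: bounded_mfun_indic.
  by apply: (@bounded_mfun_prod _ _ R n (fun i => cond (C i))) => i; exact: bounded_cond.
have maA i := measurable_preimage malpha (mA i).
have maTA i := measurable_preimage malpha (mTA i).
rewrite [RHS](expect_preserving kappa_preserving); last exact: (bB B _ mB maA).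
apply: ae_eq_expect; first exact: (bB _ _ mSB maTA).
  exact: (bounded_mfun_comp (bB _ _ mB maA) mS).
have h i : {ae kappa, forall z,
    cond (alpha @^-1` (@sys_map _ t @^-1` A i)) z = cond (alpha @^-1` A i) (S z)}.
  have h1 : {ae P, forall b, (alpha @^-1` (@sys_map _ t @^-1` A i)) b <->
      (sg @^-1` (alpha @^-1` A i)) b}.
    by apply: filterS alphaT => b /= ->.
  have h2 := cond_ae_eq (maTA i) (measurable_preimage msg (maA i)) h1.
  by apply: filterS2 h2 (cond_shift (maA i)) => z -> ->.
have : {ae kappa, forall z, forall i,
    cond (alpha @^-1` (@sys_map _ t @^-1` A i)) z = cond (alpha @^-1` A i) (S z)}.
  exact: ae_foralln.
apply: filterS => z hz; congr (_ * _).
by apply: eq_bigr => i _; exact: hz.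
Qed.

Lemma xi_iid_law i A : measurable A ->
  (kappa \x unif R)%E [set p | A (xi (p.1, iid i p.2))] = P A.
Proof.
move=> mA; have mAz z : measurable [set v | A (xi (z, v))].
  exact: (measurable_preimage (measurable_pair1 z) (measurable_preimage mxi mA)).
transitivity ((kappa \x unif R)%E [set p | A (xi p) /\ setT p.1]).
  apply: eq_integral => z _ /=; rewrite !xsectionE.
  rewrite [RHS](_ : _ = unif R [set v | A (xi (z, v))]).
    by rewrite -(unif_iid i (mAz z)).
  by congr (unif R _); apply/seteqP; split=> v //= -[].
by rewrite xiP// preimage_setT setIT.
Qed.

Definition self_joining_law : probability (prod_space (fun _ : nat => t)) R :=
  law joint_law measurable_fst.

(** A countable joining of copies of [t]: every single copy has the law
    of [alpha]. *)
Lemma F_self_joining : F (System self_joining_law (@prod_map R nat (fun=> t))).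
Proof.
have [_ _ _ Fjoin] := hF; apply: (Fjoin nat (fun=> t) _ (fun=> Ft)); split.
  split=> [|B mB]; first exact: mmap.
  have [_ /(_ _ (measurable_preimage (@measurable_fst _ _ _ Z) mB)) h] := joint_law_invariant.
  exact: h.
move=> n; split=> [|A mA]; first exact: measurable_prod_coord.
have maA := measurable_preimage malpha mA.
rewrite -(proj2 alphaP)//; exact: (xi_iid_law n maA).
Qed.

Variable f : sys_space t -> R.
Hypothesis bf : bounded_mfun f.

Definition cond_expect (z : Z) : R := \int[unif R]_v f (alpha (xi (z, v))).

Let bg : bounded_mfun (fun p : Z * UR => f (alpha (xi p))).
Proof. exact: (bounded_mfun_comp bf (measurableT_comp malpha mxi)). Qed.

Lemma bounded_cond_expect : bounded_mfun cond_expect.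
Proof. exact: (bounded_mfun_fubini kappa (unif R) bg). Qed.

Lemma cond_expectE (psi : Z -> R) : bounded_mfun psi ->
  \int[P]_b (f (alpha b) * psi (beta b)) = \int[kappa]_z (cond_expect z * psi z).
Proof.
move=> bpsi.
have mq : measurable_fun setT (fun b : cantor_borel => (b, beta b)).
  by apply: measurable_fun_pair; [exact: measurable_id|exact: mbeta].
have mx : measurable_fun setT (fun p : Z * UR => (xi p, p.1)).
  by apply: measurable_fun_pair; [exact: mxi|exact: measurable_fst].
have mp : measure_preserving (kappa \x unif R)%E (law P mq) (fun p => (xi p, p.1)).
  split=> // E mE; rewrite -(lawE (kappa \x unif R)%E mx).
  apply: probability_rect_unique mE => A B mA mB; exact: xiP.
pose phi (bz : cantor_borel * Z) := f (alpha bz.1) * psi bz.2.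
have bphi : bounded_mfun phi.
  apply: bounded_mfunM.
    exact: (bounded_mfun_comp bf (measurableT_comp malpha measurable_fst)).
  exact: (bounded_mfun_comp bpsi measurable_snd).
transitivity (\int[P]_b phi (b, beta b)); first by [].
rewrite -(expect_law P mq bphi.1 (bounded_mfun_comp bphi mq)) (expect_preserving mp bphi) expect_prod; last first.
  exact: (bounded_mfun_comp bphi mx).
apply: eq_Rintegral => z _; rewrite /cond_expect -expectZr//.
exact: (bounded_mfun_comp bg (measurable_pair1 z)).
Qed.

(** The number of copies grows geometrically so that the probabilities of errors
    above [2^-n] are summable. *)
Let sample n (x : prod_space (fun _ : nat => t)) : R :=
  (4 ^ n)%:R^-1 * \sum_(i < 4 ^ n) f (x i).

Let error n (p : Z * UR) : R := (sample n (joint p).1 - cond_expect p.1) ^+ 2.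

Let msample n : bounded_mfun (sample n).
Proof.
apply: bounded_mfunM; first exact: bounded_mfun_cst.
apply: bounded_mfun_sum => i.
exact: (bounded_mfun_comp bf (@measurable_prod_coord R nat (fun=> t) i)).
Qed.

Let berror n : bounded_mfun (error n).
Proof.
have h : bounded_mfun (fun p : Z * UR => sample n (joint p).1 - cond_expect p.1).
  apply: bounded_mfunB.
    exact: (bounded_mfun_comp (msample n) (measurableT_comp measurable_fst measurable_joint)).
  exact: (bounded_mfun_comp bounded_cond_expect measurable_fst).
exact: (bounded_mfunM h h).
Qed.

Let expect_error : exists C : R, 0 < C /\
  forall n, \int[(kappa \x unif R)%E]_p error n p <= C / (4 ^ n)%:R.
Proof.
have [_ [M fM]] := bf; have [_ [M' hM']] := bounded_cond_expect.
have M0 : 0 <= M by exact: le_trans (normr_ge0 _) (fM point).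
have M'0 : 0 <= M' by exact: le_trans (normr_ge0 _) (hM' point).
exists ((M + M') ^+ 2 + 1); split.
  by rewrite ltr_wpDl// exprn_ge0// addr_ge0.
move=> n; have n0 : (0 < 4 ^ n)%N by rewrite expn_gt0.
rewrite expect_prod// -[leRHS](expect_cst kappa); apply: le_expect => [||z].
- exact: (bounded_mfun_fubini kappa).
- exact: bounded_mfun_cst.
pose G v := f (alpha (xi (z, v))) - cond_expect z.
have bgz : bounded_mfun (fun v => f (alpha (xi (z, v)))).
  exact: (bounded_mfun_comp bg (measurable_pair1 z)).
have bG : bounded_mfun G by apply: bounded_mfunB => //; exact: bounded_mfun_cst.
have GM v : `|G v| <= M + M' by rewrite (le_trans (ler_normB _ _))// lerD.
have G0 : \int[unif R]_v G v = 0.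
  by rewrite expectB ?expect_cst ?subrr//; exact: bounded_mfun_cst.
apply: le_trans (_ : (M + M') ^+ 2 / (4 ^ n)%:R <= _); last first.
  by rewrite ler_wpM2r ?invr_ge0// lerDl.
apply: le_trans (iid_variance bG GM G0 n0); rewrite le_eqVlt; apply/orP; left; apply/eqP.
apply: eq_Rintegral => v _; rewrite /error; congr (_ ^+ 2).
rewrite /sample /joint /= /G sumrB mulrBr; congr (_ - _).
by rewrite sumr_const card_ord -[cond_expect z *+ _]mulr_natl mulKf// pnatr_eq0 -lt0n.
Qed.

(** The law of large numbers along a fast sequence, by the Chebyshev inequality
    and the Borel-Cantelli lemma. *)
Lemma sample_cvg : {ae (kappa \x unif R)%E, forall p,
  exists n, forall k, (n <= k)%N -> error k p < 2^-1 ^+ k}.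
Proof.
have [C [C0 hC]] := expect_error.
pose E k : set (Z * UR) := [set p | 2^-1 ^+ k <= error k p].
have mE k : measurable (E k).
  have h : measurable_fun setT (fun p => 2^-1 ^+ k <= error k p).
    by apply: measurable_fun_ler; [exact: measurable_cst|case: (berror k)].
  rewrite (_ : E k = (fun p => 2^-1 ^+ k <= error k p) @^-1` [set true])//.
  exact: measurable_preimage.
have PE k : ((kappa \x unif R)%E (E k) <= (2 * C / (2 ^ k.+1)%:R)%:E)%E.
  rewrite -expect_indicI// lee_fin.
  apply: (@le_trans _ _ (\int[(kappa \x unif R)%E]_p (2 ^+ k * error k p))).
    apply: le_expect => [||p].
    - exact: bounded_mfun_indic.
    - by apply: bounded_mfunM => //; exact: bounded_mfun_cst.
    rewrite indicE; case: (boolP (p \in E k)) => [/set_mem /= Ep|_].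
      by rewrite mulrC -ler_pdivrMr ?exprn_gt0// div1r -exprVn.
    by apply: mulr_ge0; [exact: exprn_ge0|exact: sqr_ge0].
  rewrite expectZl//; apply: (@le_trans _ _ (2 ^+ k * (C / (4 ^ k)%:R))).
    by rewrite ler_wpM2l ?exprn_ge0.
  rewrite le_eqVlt; apply/orP; left; apply/eqP.
  rewrite (_ : 4 = 2 * 2)%N// expnMn expnS !natrM !natrX.
  have h : 2 ^+ k != 0 :> R by rewrite expf_neq0.
  by field.
have null : (kappa \x unif R)%E (lim_sup_set E) = 0%E.
  apply: lim_sup_set_cvg0 => //.
  apply: (@le_lt_trans _ _ ((2 * C)%:E)); last exact: ltry.
  have C2 : 0 <= 2 * C by rewrite mulr_ge0// ltW.
  apply: (le_trans _ (epsilon_trick0 xpredT C2)).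
  by apply: lee_nneseries => [k _ _|k _]; [exact: measure_ge0|exact: PE].
exists (lim_sup_set E); split=> //.
  by apply: bigcapT_measurable => n; exact: bigcup_measurable.
move=> p /= h n _; apply: contrapT => hn; apply: h; exists n => k nk.
by rewrite ltNge; apply/negP => hk; apply: hn; exists k.
Qed.

(** By the law of large numbers the conditional expectation is almost surely a
    limit of averages over the copies, so the set is decided by the self-joining
    of [t], which belongs to the class, as well as by [z]. *)
Lemma cond_expect_F_measurable r :
  F_measurable F (s := System kappa S) [set z | cond_expect z < r].
Proof.
have [mh _] := bounded_cond_expect.
have mA : measurable [set z | cond_expect z < r].
  have h : measurable_fun setT (fun z => cond_expect z < r).
    by apply: measurable_fun_ltr => //; exact: measurable_cst.
  rewrite (_ : mkset _ = (fun z => cond_expect z < r) @^-1` [set true])//.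
  exact: measurable_preimage.
(* The averages eventually stay below [r] by a fixed margin. *)
pose D := \bigcup_k \bigcup_m \bigcap_(j in [set j | (m <= j)%N])
  [set x : prod_space (fun _ : nat => t) | sample j x <= r - k.+1%:R^-1].
have mD : measurable D.
  apply: bigcup_measurable => k _; apply: bigcup_measurable => m _.
  apply: bigcap_measurable => [|j _]; first by exists m => /=.
  have h : measurable_fun setT (fun x => sample j x <= r - k.+1%:R^-1).
    by apply: measurable_fun_ler; [case: (msample j)|exact: measurable_cst].
  rewrite (_ : mkset _ = (fun x => sample j x <= r - k.+1%:R^-1) @^-1` [set true])//.
  exact: measurable_preimage.
have mfst := measurable_preimage (@measurable_fst _ _ _ Z) mD.
have msnd := measurable_preimage (@measurable_snd _ _ (prod_space (fun _ : nat => t)) _) mA.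
have small (a b e : R) n : (a - b) ^+ 2 < 2^-1 ^+ n -> 2^-1 ^+ n < e ^+ 2 -> 0 < e ->
    `|a - b| < e.
  move=> h1 h2 e0; rewrite -(@ltr_pXn2r _ 2)// ?nnegrE// ?ltW// real_normK ?num_real//.
  exact: lt_trans h2.
have pow m n : (m <= n)%N -> 2^-1 ^+ n <= 2^-1 ^+ m :> R.
  by move=> mn; apply: ler_wiXn2l => //; lra.
have aeD : {ae joint_law, forall xz, D xz.1 <-> cond_expect xz.2 < r}.
  apply/symdiff0_ae => //.
  suff : (kappa \x unif R)%E ((joint @^-1` (fst @^-1` D)) `+`
      (joint @^-1` (snd @^-1` [set z | cond_expect z < r]))) = 0%E by [].
  apply/symdiff0_ae; try exact: (measurable_preimage measurable_joint).
  apply: filterS sample_cvg => p [n0 hn] /=; split.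
    move=> [k _ [m _ hj]]; have k0 : 0 < k.+1%:R^-1 :> R by rewrite invr_gt0.
    have [l hl] := half_lt (exprn_gt0 2 k0).
    have hm : sample (maxn m (maxn n0 l)) (joint p).1 <= r - k.+1%:R^-1.
      exact: hj (leq_maxl _ _).
    have := small _ _ _ _ (hn _ (leq_trans (leq_maxl n0 l) (leq_maxr m _)))
      (le_lt_trans (pow _ _ (leq_trans (leq_maxr n0 l) (leq_maxr m _))) hl) k0.
    rewrite ltr_norml => /andP[+ _]; move: hm.
    by move: (sample _ _) (k.+1%:R^-1) => a b; lra.
  move=> hr; have e0 : 0 < (r - cond_expect p.1) / 2 by rewrite divr_gt0// subr_gt0.
  have [k _ /(_ k (leqnn k)) hk] := near_infty_natSinv_lt (PosNum e0).
  have [l hl] := half_lt (exprn_gt0 2 e0).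
  exists k => //; exists (maxn n0 l) => // j /= hj.
  have := small _ _ _ _ (hn _ (leq_trans (leq_maxl n0 l) hj))
      (le_lt_trans (pow _ _ (leq_trans (leq_maxr n0 l) hj)) hl) e0.
  rewrite ltr_norml => /andP[_]; move: hk => /=.
  by move: (sample _ _) (k.+1%:R^-1) => a b; lra.
split=> //.
have Jfst : measure_preserving joint_law self_joining_law fst by split.
have Jsnd : measure_preserving joint_law kappa snd.
  split=> [|B mB]; first exact: measurable_snd.
  have := xiP measurableT mB; rewrite setTI => h.
  transitivity ((kappa \x unif R)%E [set p | setT (xi p) /\ B p.1]); last exact: h.
  transitivity ((kappa \x unif R)%E (fst @^-1` B)); first exact: erefl.
  rewrite (_ : [set p | setT (xi p) /\ B p.1] = fst @^-1` B)//.
  by apply/seteqP; split=> p //= -[].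
have [r' [p [C [Fr pF mC AC]]]] := @common_factor R F (System kappa S)
  (System self_joining_law (@prod_map R nat (fun=> t))) joint_law
  [set z | cond_expect z < r] D hF F_self_joining
  (ex_intro2 _ _ S' mS' (conj SK S'K)) Jfst Jsnd joint_law_invariant mA mD aeD.
exists r', p, C; split=> //; exact: aeW.
Qed.

End self_joining.

(** * Complex-valued functions *)

Section complex_topology.
Variable R : realType.
Local Notation Re := (@complex.Re R).
Local Notation Im := (@complex.Im R).
Local Notation normc := (@ComplexField.Normc.normc R).

Lemma ReB z w : Re (z - w) = Re z - Re w. Proof. by case: z; case: w. Qed.

Lemma ImB z w : Im (z - w) = Im z - Im w. Proof. by case: z; case: w. Qed.

Lemma normr_Re_le z : `|Re z| <= normc z.
Proof. by case: z => a b /=; rewrite -[leLHS]sqrtr_sqr ler_wsqrtr// lerDl sqr_ge0. Qed.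

Lemma normr_Im_le z : `|Im z| <= normc z.
Proof. by case: z => a b /=; rewrite -[leLHS]sqrtr_sqr ler_wsqrtr// lerDr sqr_ge0. Qed.

Lemma normc_le_ReIm z : normc z <= `|Re z| + `|Im z|.
Proof.
case: z => a b /=; rewrite -[leRHS]ger0_norm ?addr_ge0// -[leRHS]sqrtr_sqr ler_wsqrtr//.
rewrite sqrrD !real_normK ?num_real// addrAC lerDl mulrn_wge0// mulr_ge0.
Qed.

Lemma nbhs_complexP (z : R[i]) (U : set R[i]) :
  nbhs z U <-> exists2 e : R, 0 < e & forall w, normc (z - w) < e -> U w.
Proof.
split=> [/nbhs_ballP[e /= e0 eU]|[e e0 eU]].
  move: e0; rewrite ltcE => /andP[/eqP /= Ime Ree]; exists (complex.Re e) => // w zw.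
  by apply: eU; rewrite /ball /= ltcE /= Ime eqxx.
apply/nbhs_ballP; exists (e%:C) => /=; first by rewrite ltcR.
by move=> w; rewrite /ball /= ltcR; exact: eU.
Qed.

Lemma Re_continuous : continuous (Re : R[i] -> R).
Proof.
move=> z; have FF := nbhs_filter z; apply/cvgrPdist_lt => e e0; apply/nbhs_complexP; exists e => // w /= zw.
by apply: le_lt_trans zw; rewrite -ReB; exact: normr_Re_le.
Qed.

Lemma Im_continuous : continuous (Im : R[i] -> R).
Proof.
move=> z; have FF := nbhs_filter z; apply/cvgrPdist_lt => e e0; apply/nbhs_complexP; exists e => // w /= zw.
by apply: le_lt_trans zw; rewrite -ImB; exact: normr_Im_le.
Qed.

Lemma cvg_complex (T : Type) (G : set_system T) (FG : Filter G) (f g : T -> R) (a b : R) :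
  f @ G --> a -> g @ G --> b -> (fun t => f t +i* g t) @ G --> a +i* b.
Proof.
move=> /cvgrPdist_lt fa /cvgrPdist_lt gb U /nbhs_complexP[e e0 eU].
have e2 : 0 < e / 2 by rewrite divr_gt0.
apply: filterS2 (fa _ e2) (gb _ e2) => t ft gt; apply: eU.
by apply: (le_lt_trans (normc_le_ReIm _)); rewrite [ltRHS]splitr /= ltrD.
Qed.

Lemma complex_avg N (f : nat -> R[i]) : N%:R^-1 * \sum_(1 <= n < N.+1) f n =
  avg N (Re \o f) +i* avg N (Im \o f).
Proof.
have hs : \sum_(1 <= n < N.+1) f n =
    (\sum_(1 <= n < N.+1) Re (f n)) +i* (\sum_(1 <= n < N.+1) Im (f n)).
  elim: (index_iota 1 N.+1) => [|n s IH]; first by rewrite !big_nil.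
  by rewrite !big_cons IH; case: (f n).
have hN : (N%:R^-1 : R[i]) = (N%:R^-1)%:C by rewrite fmorphV rmorph_nat.
by rewrite hs hN /avg; simpc.
Qed.

(** An open set of complex numbers is a countable union of open squares with
    rational centres. *)
Lemma sigma_algebra_preimage_open (T : pointedType) (G : set (set T)) (f g : T -> R) :
  sigma_algebra setT G -> (forall r, G [set x | f x < r]) ->
  (forall r, G [set x | g x < r]) ->
  forall U : set R[i], open U -> G ((fun x => f x +i* g x) @^-1` U).
Proof.
move=> sG Gf Gg U oU.
pose W := g_sigma_algebraType G.
have GE (A : set W) : measurable A -> G A by rewrite /measurable /= sigma_algebra_id.
have mW (h : T -> R) : (forall r, G [set x | h x < r]) -> measurable_fun setT (h : W -> R).
  move=> Gh; apply: (measurability _ (RGenInftyO.measurableE R)) => _ [_ [r ->] <-].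
  rewrite setTI (_ : _ @^-1` _ = [set x | h x < r]); first exact: sub_sigma_algebra.
  by apply/seteqP; split=> x /=; rewrite in_itv.
have mf := mW _ Gf; have mg := mW _ Gg.
pose box (i : rat * rat * nat) : set W := [set x |
  `|f x - ratr i.1.1| < i.2.+1%:R^-1 /\ `|g x - ratr i.1.2| < i.2.+1%:R^-1].
have mball (h : W -> R) (q : R) e : measurable_fun setT h -> measurable [set x | `|h x - q| < e].
  move=> mh; have h' : measurable_fun setT (fun x => `|h x - q| < e).
    apply: measurable_fun_ltr; last exact: measurable_cst.
    apply: measurableT_comp => //; apply: measurable_funB => //; exact: measurable_cst.
  by rewrite (_ : mkset _ = (fun x => `|h x - q| < e) @^-1` [set true])//; exact: measurable_preimage.
pose good := [set i : rat * rat * nat | forall a b, `|a - ratr i.1.1| < i.2.+1%:R^-1 ->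
  `|b - ratr i.1.2| < i.2.+1%:R^-1 -> U (a +i* b)].
apply: GE; rewrite (_ : _ @^-1` _ = \bigcup_(i in good) box i).
  by apply: bigcup_count_measurable => i _; apply: measurableI; exact: mball.
apply/seteqP; split=> x /=; last by move=> [i /= gi [fi gi']]; exact: gi.
move=> Ux; have /nbhs_complexP[e e0 eU] : nbhs (f x +i* g x) U by exact: open_nbhs_nbhs.
have e4 : 0 < e / 4 by rewrite divr_gt0.
have [n _ /(_ n (leqnn n)) /= ne] := near_infty_natSinv_lt (PosNum e4).
have n0 : 0 < n.+1%:R^-1 :> R by rewrite invr_gt0.
have rat_near (a : R) : exists q : rat, `|a - ratr q| < n.+1%:R^-1.
  have [|q] := @rat_in_itvoo R (a - n.+1%:R^-1) (a + n.+1%:R^-1).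
    by rewrite ltrBlDr -addrA ltrDl addr_gt0.
  rewrite in_itv /= => /andP[q1 q2]; exists q.
  by rewrite ltr_norml; move: (n.+1%:R^-1) q1 q2 => r; move=> *; apply/andP; split; lra.
have [p hp] := rat_near (f x); have [q hq] := rat_near (g x).
exists (p, q, n) => //= a b ha hb; apply: eU.
apply: (le_lt_trans (normc_le_ReIm _)) => /=.
have h1 : `|f x - a| <= `|f x - ratr p| + `|a - ratr p|.
  by rewrite [X in _ <= _ + X]distrC; exact: ler_distD.
have h2 : `|g x - b| <= `|g x - ratr q| + `|b - ratr q|.
  by rewrite [X in _ <= _ + X]distrC; exact: ler_distD.
move: h1 h2 hp hq ha hb ne => /=; move: (n.+1%:R^-1) => r.
by move: `|_| `|_| `|_| `|_| `|_| `|_| => *; lra.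
Qed.

End complex_topology.

(** * Orthogonality for the joining with a system of the class *)

Section joining_orthogonality.
Variables (R : realType) (F : system R -> Prop) (t : system R).
Hypotheses (hF : characteristic F) (Ft : F t).
Variables (d : measure_display) (Z : measurableType d) (S S' : Z -> Z).
Hypotheses (mS : measurable_fun setT S) (mS' : measurable_fun setT S').
Hypotheses (SK : cancel S S') (S'K : cancel S' S).
Variables (P : probability cantor_borel R) (sg : cantor_borel -> cantor_borel).
Hypothesis sgP : measure_preserving P P sg.
Variable alpha : cantor_borel -> sys_space t.
Hypothesis alphaP : measure_preserving P (sys_prob t) alpha.
Hypothesis alphaT : {ae P, forall b, alpha (sg b) = sys_map (alpha b)}.
Variable beta : cantor_borel -> Z.
Hypothesis mbeta : measurable_fun setT beta.
Hypothesis betaS : {ae P, forall b, beta (sg b) = S (beta b)}.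
Local Notation kappa := (law P mbeta).
Variables (f1 f2 : sys_space t -> R) (a b : Z -> R).
Hypotheses (bf1 : bounded_mfun f1) (bf2 : bounded_mfun f2).
Hypotheses (ba : bounded_mfun a) (bb : bounded_mfun b).

(** The two integrals are the real and the imaginary part of the integral of
    [(f1 +i* f2) (alpha w) * (a +i* b) (beta w)]. Conditioning on [beta] replaces
    [f1 +i* f2] by a function measurable for the largest factor in the class,
    whose conjugate is then tested against [a +i* b]. *)
Lemma joining_orthogonality :
  (forall G, is_largest_F_factor F (s := System kappa S) G ->
    forall g, L2 kappa G g -> L2_inner kappa (fun z => a z +i* b z) g = 0) ->
  \int[P]_w (f1 (alpha w) * a (beta w) - f2 (alpha w) * b (beta w)) = 0 /\
  \int[P]_w (f1 (alpha w) * b (beta w) + f2 (alpha w) * a (beta w)) = 0.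
Proof.
move=> hG; have [xi mxi xiP] := disintegration P mbeta.
pose h1 := cond_expect alpha xi f1; pose h2 := cond_expect alpha xi f2.
have Fm f r : bounded_mfun f ->
    F_measurable F (s := System kappa S) [set z | cond_expect alpha xi f z < r].
  move=> bf; exact: (cond_expect_F_measurable hF Ft mS mS' SK S'K sgP alphaP alphaT betaS mxi xiP bf).
have bh f : bounded_mfun f -> bounded_mfun (cond_expect alpha xi f).
  move=> bf; exact: (bounded_cond_expect alphaP mbeta mxi bf).
have kS := kappa_preserving mS sgP mbeta betaS.
have [G [Glargest FG]] := @largest_F_factor_exists R F hF (System kappa S) kS
  (ex_intro2 _ _ S' mS' (conj SK S'K)) P beta (conj mbeta (fun _ _ => erefl))
  (ex_intro _ _ (Fm f1 0 bf1)).
have sG : sigma_algebra setT G by have [[]] := Glargest.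
have Gh1 r : G [set z | h1 z < r] by apply: FG; exact: Fm.
have bg f z : bounded_mfun f -> bounded_mfun (fun v => f (alpha (xi (z, v)))).
  move=> bf; have [malpha _] := alphaP.
  exact: (bounded_mfun_comp bf (measurableT_comp malpha (measurableT_comp mxi (measurable_pair1 z)))).
have Gh2 r : G [set z | (- h2 z) < r].
  rewrite (_ : [set z | _] = [set z | cond_expect alpha xi (fun x => - f2 x) z < r]).
    by apply: FG; apply: Fm; exact: bounded_mfunN.
  apply/seteqP; split=> z /=; rewrite /h2 /cond_expect.
    rewrite -mulN1r -expectZl; last exact: bg.
    by under eq_Rintegral do rewrite mulN1r.
  under eq_Rintegral do rewrite -mulN1r.
  by rewrite expectZl ?mulN1r//; exact: bg.
have L2g : L2 kappa G (fun z => h1 z +i* (- h2 z)).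
  split; first by move=> U oU; exact: sigma_algebra_preimage_open sG Gh1 Gh2 U oU.
  have bb2 : bounded_mfun (fun z => h1 z ^+ 2 + (- h2 z) ^+ 2).
    by apply: bounded_mfunD; apply: bounded_mfunM; try exact: bh; exact: bounded_mfunN (bh _ _).
  rewrite (eq_integral (EFin \o (fun z => h1 z ^+ 2 + (- h2 z) ^+ 2))).
    by rewrite EFin_expect// ltry.
  by move=> z _ /=; rewrite sqr_sqrtr// addr_ge0 ?sqr_ge0.
have /(_ _ L2g) := hG _ Glargest.
rewrite /L2_inner /cintegral => /eqP; rewrite eq_complex /= => /andP[/eqP I1 /eqP I2].
have bM f g : bounded_mfun f -> bounded_mfun g ->
  bounded_mfun (fun w => f (alpha w) * g (beta w)).
  move=> bf bg'; have [malpha _] := alphaP.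
  by apply: bounded_mfunM; [exact: (bounded_mfun_comp bf malpha)|exact: (bounded_mfun_comp bg' mbeta)].
have E f g : bounded_mfun f -> bounded_mfun g ->
    \int[P]_w (f (alpha w) * g (beta w)) = \int[kappa]_z (cond_expect alpha xi f z * g z).
  by move=> bf bg'; exact: (cond_expectE alphaP mxi xiP bf bg').
split.
  rewrite expectB; try exact: bM.
  rewrite !E// -expectB; try by apply: bounded_mfunM => //; exact: bh.
  rewrite -[RHS]I1; apply: eq_Rintegral => z _; rewrite /h1 /h2; simpc; ring.
rewrite expectD; try exact: bM.
rewrite !E// -expectD; try by apply: bounded_mfunM => //; exact: bh.
rewrite -[RHS]I2; apply: eq_Rintegral => z _; rewrite /h1 /h2; simpc; ring.
Qed.

End joining_orthogonality.

(** * Images of limit measures under maps continuous on a closed set *)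

Section cylinder_continuity.
Variables (K : set cantor_space) (Y : ptopologicalType) (gam : cantor_space -> Y).
Hypothesis closedK : closed K.

(** Continuity of the restriction to [K]. The map is made constant off [K] below,
    which keeps it Borel although it is not continuous on the whole space. *)
Definition cyl_continuous := forall b, K b -> forall W, nbhs (gam b) W ->
  exists n, forall b', K b' -> mkseq b' n = mkseq b n -> W (gam b').

Hypothesis gamK : cyl_continuous.
Variable y0 : Y.
Hypothesis gam0 : forall b, ~ K b -> gam b = y0.

Lemma measurable_cyl_continuous :
  measurable_fun setT (gam : cantor_borel -> borel Y).
Proof.
have mK : measurable (K : set cantor_borel) by exact: measurable_closed.
have := @measurability _ _ cantor_borel (borel Y) setT gam (@open Y) erefl.
apply=> _ [W oW <-]; rewrite setTI.
rewrite (_ : _ @^-1` _ =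
    (K `&` \bigcup_(s in [set s | forall b, K b -> cyl s b -> W (gam b)]) cyl s) `|`
    (~` K `&` [set b | W y0])).
  apply: measurableU; apply: measurableI => //.
  - by apply: bigcup_count_measurable => s _; exact: measurable_cyl.
  - exact: measurableC.
  - have [Wy|nWy] := pselect (W y0).
      by rewrite (_ : mkset _ = setT)//; apply/seteqP; split.
    by rewrite (_ : mkset _ = set0)//; apply/seteqP; split.
apply/seteqP; split=> b /=.
  move=> Wb; have [Kb|nK] := pselect (K b); last by right; split=> //; rewrite -(gam0 nK).
  left; split=> //; have [|n nW] := gamK Kb (W := W); first exact: open_nbhs_nbhs.
  exists (mkseq b n); last exact: cyl_mkseq.
  by move=> b' Kb'; rewrite /cyl /= size_mkseq; exact: nW.
move=> [[Kb [s /= sW sb]]|[nK Wy]]; first exact: sW.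
by rewrite gam0.
Qed.

Lemma cyl_continuous_real (R : realType) (g : Y -> R) : continuous g ->
  forall b, K b -> forall e, 0 < e -> exists n,
  forall b', K b' -> mkseq b' n = mkseq b n -> `|g (gam b') - g (gam b)| < e.
Proof.
move=> cg b Kb e e0; have /gamK h := Kb.
have [|n nP] := h [set y | `|g y - g (gam b)| < e].
  have /cvgrPdist_lt/(_ e e0) := cg (gam b).
  by apply: filterS => y; rewrite distrC.
by exists n.
Qed.

Lemma bounded_cyl_continuous (R : realType) (g : Y -> R) : continuous g ->
  bounded_mfun (g \o gam : cantor_borel -> R).
Proof.
move=> cg; split.
  exact: (measurableT_comp (measurable_continuous cg) measurable_cyl_continuous).
have [n nP] := cantor_unif_continuous closedK (cyl_continuous_real cg) ltr01.
have /choice[rep repP] s : exists b, (cyl s `&` K) !=set0 -> (cyl s `&` K) b.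
  by have [[b ?]|?] := pselect (cyl s `&` K !=set0); [exists b|exists point].
exists (\sum_(s : n.-tuple bool) `|g (gam (rep s))| + 1 + `|g y0|) => b /=.
have S0 : 0 <= \sum_(s : n.-tuple bool) `|g (gam (rep s))| by exact: sumr_ge0.
have [Kb|nK] := pselect (K b); last by rewrite gam0// lerDr addr_ge0.
have sz : size (mkseq b n) == n by rewrite size_mkseq.
have [|bs Ks] := repP (mkseq b n); first by exists b; split=> //; exact: cyl_mkseq.
have hb : `|g (gam b) - g (gam (rep (mkseq b n)))| < 1.
  by apply: nP => //; move: bs; rewrite /cyl /= size_mkseq => ->.
have hS : `|g (gam (rep (mkseq b n)))| <= \sum_(s : n.-tuple bool) `|g (gam (rep s))|.
  by rewrite (bigD1 (Tuple sz))//= lerDl sumr_ge0.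
rewrite -[X in `|X|](subrK (g (gam (rep (mkseq b n))))).
apply: (le_trans (ler_normD _ _)); apply: (le_trans (lerD (ltW hb) hS)).
by rewrite [1 + _]addrC lerDl.
Qed.

End cylinder_continuity.

Section quasi_generic_law.
Variables (R : realType) (c : nat -> cantor_space) (K : set cantor_space).
Variables (N : nat -> nat) (P : probability cantor_borel R).
Hypothesis N0 : forall l, (0 < N l)%N.
Hypothesis NP : forall s,
  avg (N l) (fun n => \1_(cyl s) (c n) : R) @[l --> \oo] --> fine (P (cyl s)).
Hypothesis cK : forall n, (0 < n)%N -> K (c n).
Hypothesis closedK : closed K.
Variables (Y : ptopologicalType) (gam : cantor_space -> Y) (y0 : Y).
Hypothesis gamK : cyl_continuous K gam.
Hypothesis gam0 : forall b, ~ K b -> gam b = y0.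
Hypothesis mgam : measurable_fun setT (gam : cantor_borel -> borel Y).

Lemma law_cvg (g : Y -> R[i]) : continuous g ->
  (fun l => (N l)%:R^-1 * \sum_(1 <= n < (N l).+1) g (gam (c n))) @ \oo
    --> cintegral (law P mgam) (g : borel Y -> R[i]).
Proof.
move=> cg; under eq_fun do rewrite complex_avg.
have cR : continuous (fun y => complex.Re (g y)).
  by move=> y; apply: continuous_comp; [exact: cg|exact: Re_continuous].
have cI : continuous (fun y => complex.Im (g y)).
  by move=> y; apply: continuous_comp; [exact: cg|exact: Im_continuous].
have bR := bounded_cyl_continuous closedK gamK gam0 cR.
have bI := bounded_cyl_continuous closedK gamK gam0 cI.
apply: cvg_complex.
  rewrite (expect_law P mgam (measurable_continuous cR) bR).
  exact: (empirical_integral N0 NP cK closedK (cyl_continuous_real gamK cR) bR).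
rewrite (expect_law P mgam (measurable_continuous cI) bI).
exact: (empirical_integral N0 NP cK closedK (cyl_continuous_real gamK cI) bI).
Qed.

End quasi_generic_law.

Section shift_invariance.
Variables (R : realType) (c : nat -> cantor_space) (K : set cantor_space).
Variables (N : nat -> nat) (P : probability cantor_borel R).
Hypothesis Nincr : {homo N : m n / (m < n)%N}.
Hypothesis N0 : forall l, (0 < N l)%N.
Hypothesis NP : forall s,
  avg (N l) (fun n => \1_(cyl s) (c n) : R) @[l --> \oo] --> fine (P (cyl s)).

Lemma clopen_cvg (A : set cantor_space) : open A -> closed A ->
  avg (N l) (fun n => \1_A (c n) : R) @[l --> \oo] --> fine (P A).
Proof.
move=> oA cA; have mA : measurable (A : set cantor_borel) by exact: measurable_open.
rewrite -expect_indic//.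
apply: (@empirical_integral R c setT N P N0 NP _ _ (\1_A)) => // [b _ e e0|].
  have [n nP] : exists n, forall b', mkseq b' n = mkseq b n -> \1_A b' = \1_A b :> R.
    have [Ab|nA] := pselect (A b).
      have [|n nA] := @cyl_nbhs A b; first exact: open_nbhs_nbhs.
      exists n => b' hb'; rewrite !indicE !mem_set//; apply: nA.
      by rewrite /cyl /= size_mkseq.
    have [|n nA'] := @cyl_nbhs (~` A) b.
      by apply: open_nbhs_nbhs; split=> //; exact: closed_openC.
    exists n => b' hb'; rewrite !indicE !memNset//; apply: nA'.
    by rewrite /cyl /= size_mkseq.
  by exists n => b' _ /nP ->; rewrite subrr normr0.
exact: bounded_mfun_indic.
Qed.

Variable pi : nat -> nat.
Hypothesis cS : forall n, c n.+1 = permute pi (c n).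

Lemma permute_continuous : continuous (permute pi).
Proof.
move=> b; apply: cantor_cvg => n.
exact: (proj_cantor_nbhs b (pi n)).
Qed.

Lemma le_homo_ltn m : (m <= N m)%N.
Proof. by elim: m => // m IH; apply: (leq_ltn_trans IH); exact: Nincr. Qed.

(** The frequencies of a clopen set and of its preimage along the first [N l]
    terms differ by a telescoping sum, thus by at most [1 / N l]. *)
Lemma limit_permute_preserving :
  measure_preserving P P (permute pi : cantor_borel -> cantor_borel).
Proof.
have mpi := measurable_permute pi; split=> // B mB.
rewrite -(lawE P mpi); apply: cantor_measure_unique mB => [|s].
  by rewrite (le_lt_trans (probability_le1 _ measurableT)) ?ltry.
pose A := permute pi @^-1` cyl s.
have oA : open A by apply: open_comp; [move=> b _; exact: permute_continuous|exact: open_cyl].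
have cA : closed A.
  by apply: preimage_closed; [move=> b _; exact: permute_continuous|exact: closed_cyl].
have mA : measurable (A : set cantor_borel) by exact: measurable_open.
have ms := measurable_cyl s.
suff h : fine (P A) = fine (P (cyl s)).
  transitivity (P A); first by [].
  by rewrite -[LHS]fineK ?fin_num_measure// h fineK// fin_num_measure.
apply/eqP; rewrite -subr_eq0; apply/eqP.
have lim : (fun l => avg (N l) (fun n => \1_A (c n) : R) -
    avg (N l) (fun n => \1_(cyl s) (c n))) @ \oo --> fine (P A) - fine (P (cyl s)).
  exact: (cvgB (clopen_cvg oA cA) (@NP s)).
apply: (cvg_unique _ lim) => //.
apply/cvgrPdist_lt => e e0; have e2 : 0 < e / 2 by rewrite divr_gt0.
near=> l; rewrite sub0r normrN.
have -> : avg (N l) (fun n => \1_A (c n) : R) - avg (N l) (fun n => \1_(cyl s) (c n)) =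
    (N l)%:R^-1 * (\1_(cyl s) (c (N l).+1) - \1_(cyl s) (c 1%N)).
  rewrite -avgB /avg; congr (_ * _).
  rewrite -(telescope_sumr (fun n => \1_(cyl s) (c n) : R))//.
  by apply: eq_bigr => n _; rewrite cS.
have h1 : `|\1_(cyl s) (c (N l).+1) - \1_(cyl s) (c 1%N)| <= 1 :> R.
  by rewrite !indicE; do 2! case: (_ \in _) => /=; rewrite ?subrr ?subr0 ?sub0r ?normrN ?normr0 ?normr1.
rewrite normrM ger0_norm ?invr_ge0//.
apply: le_lt_trans (_ : (N l)%:R^-1 * 1 < _); first by rewrite ler_wpM2l ?invr_ge0.
rewrite mulr1; apply: (@le_lt_trans _ _ l%:R^-1).
  rewrite lef_pV2 ?posrE ?ltr0n// ?ler_nat ?le_homo_ltn//.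
  by near: l; exists 1%N.
near: l; have [k _ kP] := near_infty_natSinv_lt (PosNum e0).
exists k.+1 => // -[|l] //= kl; exact: kP.
Unshelve. all: end_near. Qed.

End shift_invariance.

(** * The orbit closure of a bounded sequence *)

Section orbit_closure.
Variables (R : realType) (v : bisequence R).

Lemma shift_byD (k l : int) (z : bisequence R) :
  shift_by k (shift_by l z) = shift_by (k + l) z.
Proof. by apply/funext => n; rewrite /shift_by addrA. Qed.

Lemma orbit_closure_shift_inv (z : bisequence R) :
  orbit_closure v z -> orbit_closure v (shift_by (- 1) z).
Proof.
move=> vz B /shift_by_continuous /vz [_ [[k _ <-] Bk]].
exists (shift_by (- 1 + k) v); split; first by exists (- 1 + k).
by rewrite -shift_byD.
Qed.

Definition Xshift_inv (z : Xspace v) : Xspace v :=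
  SigSub (mem_set (orbit_closure_shift_inv (set_valP z))).

Lemma set_val_inj (x y : Xspace v) :
  (set_val x : bisequence R) = set_val y -> x = y.
Proof. exact: val_inj. Qed.

Lemma XshiftK : cancel (@Xshift R v) Xshift_inv.
Proof.
move=> z; apply: set_val_inj; apply/funext => n.
by rewrite [LHS]/= !set_valE/= /shift_by -addrA addNr addr0.
Qed.

Lemma Xshift_invK : cancel Xshift_inv (@Xshift R v).
Proof.
move=> z; apply: set_val_inj; apply/funext => n.
by rewrite [LHS]/= !set_valE/= /shift_by -addrA addrN addr0.
Qed.

Lemma set_val_continuous : continuous (set_val : Xspace v -> bisequence R).
Proof. exact: initial_continuous. Qed.

Lemma nbhs_Xspace (z : Xspace v) (W : set (Xspace v)) : nbhs z W ->
  exists2 V : set (bisequence R), nbhs (set_val z : bisequence R) V &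
    set_val @^-1` V `<=` W.
Proof.
rewrite nbhsE => -[U [oU Uz] UW]; have [V oV VU] := oU.
exists V; last by rewrite VU.
by apply: open_nbhs_nbhs; split=> //; move: Uz; rewrite -VU.
Qed.

Lemma Xspace_map_continuous (f : Xspace v -> Xspace v) (k : int) :
  (forall z, (set_val (f z) : bisequence R) = shift_by k (set_val z)) ->
  continuous f.
Proof.
move=> fk z W /nbhs_Xspace[V nV VW].
have : nbhs (shift_by k (set_val z)) V by rewrite -fk.
move=> /shift_by_continuous/set_val_continuous nz.
suff : nbhs z (f @^-1` W) by [].
by apply: (@filterS _ (nbhs z) (nbhs_filter z) _ _ _ nz) => y /=; rewrite -fk; exact: VW.
Qed.

Lemma pi0_continuous : continuous (@pi0 R v : Xspace v -> R[i]).
Proof.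
move=> z; apply: (@continuous_comp _ _ _ set_val (fun y : bisequence R => y 0)).
  exact: set_val_continuous.
exact: (@proj_continuous int (fun=> R[i]) 0).
Qed.

Lemma measurable_Xshift :
  measurable_fun setT (@Xshift R v : borel (Xspace v) -> borel (Xspace v)).
Proof.
by apply: measurable_continuous_map; apply: (Xspace_map_continuous (k := 1)) => z.
Qed.

Lemma measurable_Xshift_inv :
  measurable_fun setT (Xshift_inv : borel (Xspace v) -> borel (Xspace v)).
Proof.
by apply: measurable_continuous_map; apply: (Xspace_map_continuous (k := - 1)) => z.
Qed.

Lemma normc_orbit_closure (L : R) (k : int) (z : bisequence R) :
  (forall k, ComplexField.Normc.normc (v k) <= L) -> orbit_closure v z ->
  ComplexField.Normc.normc (z k) <= L.
Proof.
move=> vL vz; rewrite leNgt; apply/negP => Lz.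
have [|_ [[j _ <-]]] := vz [set y | L < ComplexField.Normc.normc (y k)]; last first.
  by rewrite /= /shift_by ltNge vL.
have e0 : 0 < ComplexField.Normc.normc (z k) - L by rewrite subr_gt0.
have : nbhs (z k) [set w | L < ComplexField.Normc.normc w].
  apply/nbhs_complexP; exists (ComplexField.Normc.normc (z k) - L) => // w.
  rewrite ltrBrDr addrC -ltrBrDr => /lt_le_trans; apply.
  rewrite lerBlDr -[X in ComplexField.Normc.normc X <= _](subrK w).
  by rewrite addrC le_normcD.
exact: (@proj_continuous int (fun=> R[i]) k z).
Qed.

End orbit_closure.

(** * Coding an orbit and a bounded sequence by one point *)

Section coding.
Variables (e : int * (nat * nat) -> nat) (e' : nat -> int * (nat * nat)).
Hypothesis eK : cancel e e'.

(** A point of the Cantor space is read as an array: for each time [k] and each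
    [j] it contains a stream of digits, the digit [n] of which sits at the place
    [e (k, (j, n))]. Moving time by one permutes the places. *)
Definition row (k : int) (j : nat) : cantor_space -> cantor_space :=
  permute (fun n => e (k, (j, n))).

Definition assemble (d : int -> nat -> cantor_space) : cantor_space :=
  fun m => d (e' m).1 (e' m).2.1 (e' m).2.2.

Definition next_index (m : nat) : nat := e ((e' m).1 + 1, (e' m).2).

Lemma row_assemble d k j : row k j (assemble d) = d k j.
Proof. by apply/funext => n; rewrite /row /permute /assemble eK. Qed.

Lemma permute_assemble d :
  permute next_index (assemble d) = assemble (fun k => d (k + 1)).
Proof. by apply/funext => m; rewrite /permute /assemble /next_index eK. Qed.

Lemma row_permute b k j : row k j (permute next_index b) = row (k + 1) j b.
Proof. by apply/funext => n; rewrite /row /permute /next_index eK. Qed.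

Lemma row_continuous k j : continuous (row k j).
Proof. exact: permute_continuous. Qed.

End coding.

Section disc.
Variables (R : realType) (A : R).
Hypothesis A0 : 0 < A.

(** The interval from [- A] to [A] is rescaled to the unit interval, whose points
    have binary digits. *)
Definition real_code (r : R) : cantor_space := digits ((r / A + 1) / 2).
Definition real_value (b : cantor_space) : R := A * (2 * undigits R b - 1).

Lemma real_codeK r : `|r| < A -> real_value (real_code r) = r.
Proof.
move=> rA; have /andP[r1 r2] : - 1 < r / A < 1.
  by rewrite ltr_pdivlMr// ltr_pdivrMr// mulN1r mul1r -ltr_norml.
rewrite /real_value /real_code digitsK; first by field; rewrite gt_eqF.
by apply/andP; split; lra.
Qed.

Lemma real_value_continuous : continuous real_value.
Proof.
move=> b; apply: cvgM; first exact: cvg_cst.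
apply: cvgB; last exact: cvg_cst.
by apply: cvgM; [exact: cvg_cst|exact: undigits_continuous].
Qed.

End disc.

Section joint_coding.
Variables (e : int * (nat * nat) -> nat) (e' : nat -> int * (nat * nat)).
Hypothesis eK : cancel e e'.
Variables (R : realType) (X : ptopologicalType) (A : R).
Hypothesis A0 : 0 < A.
Variables (dec : cantor_space -> X) (rep : X -> cantor_space).
Hypotheses (repK : cancel rep dec) (cdec : continuous dec).

Definition joint_code (xs : int -> X) (ys : bisequence R) : cantor_space :=
  assemble e' (fun k j => match j with
    | 0%N => rep (xs k)
    | 1%N => real_code A (complex.Re (ys k))
    | _ => real_code A (complex.Im (ys k))
    end).

Definition point_of (b : cantor_space) : X := dec (row e 0 0 b).

Definition sequence_of (b : cantor_space) : bisequence R :=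
  fun k => real_value A (row e k 1 b) +i* real_value A (row e k 2 b).

Lemma point_of_code xs ys : point_of (joint_code xs ys) = xs 0.
Proof. by rewrite /point_of row_assemble// repK. Qed.

Lemma sequence_of_code xs ys :
  (forall k, ComplexField.Normc.normc (ys k) < A) ->
  sequence_of (joint_code xs ys) = ys.
Proof.
move=> yA; apply/funext => k; rewrite /sequence_of !row_assemble// !real_codeK//.
- by case: (ys k).
- exact: le_lt_trans (normr_Im_le _) (yA k).
- exact: le_lt_trans (normr_Re_le _) (yA k).
Qed.

Lemma permute_code xs ys : permute (next_index e e') (joint_code xs ys) =
  joint_code (fun k => xs (k + 1)) (shift_by 1 ys).
Proof. by rewrite /joint_code permute_assemble. Qed.

Lemma sequence_of_permute b :
  sequence_of (permute (next_index e e') b) = shift_by 1 (sequence_of b).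
Proof. by apply/funext => k; rewrite /sequence_of !row_permute. Qed.

Lemma point_of_continuous : continuous point_of.
Proof.
by move=> b; apply: continuous_comp; [exact: row_continuous|exact: cdec].
Qed.

Lemma sequence_of_continuous : continuous sequence_of.
Proof.
move=> b; apply: cvg_bisequence => k; apply: cvg_complex.
  by apply: (@continuous_comp _ _ _ (row e k 1) (real_value A));
    [exact: row_continuous|exact: real_value_continuous].
by apply: (@continuous_comp _ _ _ (row e k 2) (real_value A));
  [exact: row_continuous|exact: real_value_continuous].
Qed.

End joint_coding.

Lemma closed_equalizer (Y Z : topologicalType) (f g : Y -> Z) :
  hausdorff_space Z -> continuous f -> continuous g ->
  closed [set y | f y = g y].
Proof.
move=> hZ cf cg y cy; apply: hZ => U V Uy Vy.
have [|z [fg [Uz Vz]]] := cy (f @^-1` U `&` g @^-1` V).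
  by apply: filterI; [exact: cf|exact: cg].
by exists (f z); split=> //; rewrite fg.
Qed.

(** * The limit of the joint empirical measures *)

HB.instance Definition _ (Y Z : ptopologicalType) := Pointed.on (Y * Z)%type.

Lemma cyl_continuous_comp (K : set cantor_space) (Y Z : ptopologicalType)
    (gam : cantor_space -> Y) (g : Y -> Z) : continuous g ->
  cyl_continuous K gam -> cyl_continuous K (g \o gam).
Proof. by move=> cg gamK b Kb W /cg; exact: gamK. Qed.

Definition closure_point (R : realType) (v z : bisequence R)
  (vz : orbit_closure v z) : Xspace v := SigSub (mem_set vz).

Section joint_limit.
Variables (R : realType) (X : tds R) (v : bisequence R) (L : R).
Hypothesis vL : forall k, ComplexField.Normc.normc (v k) <= L.
Variable x : tds_space X.
Local Notation T := (@tds_map R X).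
Hypothesis cT : continuous T.
Variables (e : int * (nat * nat) -> nat) (e' : nat -> int * (nat * nat)).
Hypothesis eK : cancel e e'.
Variables (dec : cantor_space -> tds_space X) (rep : tds_space X -> cantor_space).
Hypotheses (repK : cancel rep dec) (cdec : continuous dec).

(* The margin keeps rescaled values strictly below 1, as expansions require. *)
Local Notation A := (L + 1).
Local Notation sg := (permute (next_index e e')).

Let L0 : 0 <= L.
Proof. exact: le_trans (normr_ge0 _) (le_trans (normr_Re_le (v 0)) (vL 0)). Qed.

Let A0 : 0 < A. Proof. by rewrite ltr_wpDl. Qed.

(** The orbit is written at all times in order that the shift of the array act as
    [T]; its reflection fills the negative times, compatibly with the shift. *)
Definition orbit_code (n : nat) : cantor_space :=
  joint_code e' A rep (fun k => iter `|k + n%:Z| T x) (shift_by n%:Z v).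

Lemma orbit_codeS n : orbit_code n.+1 = sg (orbit_code n).
Proof.
rewrite /orbit_code permute_code// shift_byD -intS; congr joint_code.
by apply/funext => k; rewrite intS addrA.
Qed.

Lemma point_of_orbit_code n : point_of e dec (orbit_code n) = iter n T x.
Proof. by rewrite point_of_code// add0r. Qed.

Lemma sequence_of_orbit_code n :
  sequence_of e A (orbit_code n) = shift_by n%:Z v.
Proof.
rewrite sequence_of_code// => k.
by rewrite /shift_by (le_lt_trans (vL _))// ltrDl.
Qed.

Definition code_support : set cantor_space :=
  [set b | orbit_closure v (sequence_of e A b)].

Lemma closed_code_support : closed code_support.
Proof.
apply: (@preimage_closed _ _ (sequence_of e A)); last exact: closed_closure.
by move=> b _; exact: sequence_of_continuous.
Qed.

Lemma code_support_orbit n : code_support (orbit_code n).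
Proof.
rewrite /code_support /= sequence_of_orbit_code.
by apply: subset_closure; exists n%:Z.
Qed.

Definition decode (b : cantor_space) : tds_space X * Xspace v :=
  match pselect (code_support b) with
  | left h => (point_of e dec b, closure_point h)
  | right _ => (point, Xbase v)
  end.

Lemma decode_on b : code_support b -> (decode b).1 = point_of e dec b /\
  (set_val (decode b).2 : bisequence R) = sequence_of e A b.
Proof. by rewrite /decode; case: pselect. Qed.

Lemma decode_off b : ~ code_support b -> decode b = (point, Xbase v).
Proof. by rewrite /decode; case: pselect. Qed.

Lemma decode_orbit_code n :
  decode (orbit_code n) = (iter n T x, iter n (@Xshift R v) (Xbase v)).
Proof.
have [d1 d2] := decode_on (@code_support_orbit n).
rewrite [LHS]surjective_pairing d1 point_of_orbit_code; congr pair.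
apply: set_val_inj; rewrite d2 sequence_of_orbit_code.
elim: n {d1 d2} => [|n IH].
  by apply/funext => k; rewrite /shift_by addr0.
by rewrite iterS /= -[RHS]/(shift_by 1 (set_val _)) -IH shift_byD -intS.
Qed.

Lemma decode_continuous : cyl_continuous code_support decode.
Proof.
move=> b Kb W; have [d1 d2] := decode_on Kb.
move=> [[U V] /= [nU /nbhs_Xspace[V' nV' VV']] UVW].
rewrite d1 in nU; rewrite d2 in nV'.
have n1 : nbhs b (point_of e dec @^-1` U) by exact: point_of_continuous.
have n2 : nbhs b (sequence_of e A @^-1` V') by exact: sequence_of_continuous.
have /cyl_nbhs[n nP] := @filterI _ (nbhs b) (nbhs_filter b) _ _ n1 n2.
exists n => b' Kb' bb'; apply: UVW.
have [d1' d2'] := decode_on Kb'.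
have [] : (point_of e dec @^-1` U `&` sequence_of e A @^-1` V') b'.
  by apply: nP; rewrite /cyl /= size_mkseq.
by move=> ? ?; split=> /=; [rewrite d1'|apply: VV'; rewrite /= d2'].
Qed.

Definition decode_point (b : cantor_borel) : borel (tds_space X) := (decode b).1.
Definition decode_sequence (b : cantor_borel) : borel (Xspace v) := (decode b).2.

Let fst_cont : continuous (fst : tds_space X * Xspace v -> tds_space X).
Proof. by move=> p; exact: cvg_fst. Qed.

Let snd_cont : continuous (snd : tds_space X * Xspace v -> Xspace v).
Proof. by move=> p; exact: cvg_snd. Qed.

Let decode_pointK : cyl_continuous code_support (decode_point : cantor_space -> tds_space X).
Proof. exact: (cyl_continuous_comp fst_cont decode_continuous). Qed.

Let decode_sequenceK : cyl_continuous code_support (decode_sequence : cantor_space -> Xspace v).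
Proof. exact: (cyl_continuous_comp snd_cont decode_continuous). Qed.

Let decode_point0 b : ~ code_support b -> decode_point b = point.
Proof. by rewrite /decode_point => /decode_off ->. Qed.

Let decode_sequence0 b : ~ code_support b -> decode_sequence b = Xbase v.
Proof. by rewrite /decode_sequence => /decode_off ->. Qed.

Lemma measurable_decode :
  measurable_fun setT (decode : cantor_borel -> borel (tds_space X * Xspace v)%type).
Proof. exact: (measurable_cyl_continuous closed_code_support decode_continuous decode_off). Qed.

Lemma measurable_decode_point : measurable_fun setT decode_point.
Proof. exact: (measurable_cyl_continuous closed_code_support decode_pointK decode_point0). Qed.

Lemma measurable_decode_sequence : measurable_fun setT decode_sequence.
Proof. exact: (measurable_cyl_continuous closed_code_support decode_sequenceK decode_sequence0). Qed.

Variables (N : nat -> nat) (P : probability cantor_borel R).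
Hypothesis Nincr : {homo N : m n / (m < n)%N}.
Hypothesis N0 : forall l, (0 < N l)%N.
Hypothesis NP : forall s,
  avg (N l) (fun n => \1_(cyl s) (orbit_code n) : R) @[l --> \oo] --> fine (P (cyl s)).

Lemma shift_preserving : measure_preserving P P (sg : cantor_borel -> cantor_borel).
Proof. exact: (limit_permute_preserving Nincr N0 NP orbit_codeS). Qed.

Lemma ae_closed (K : set cantor_space) : closed K ->
  (forall n, K (orbit_code n)) -> {ae P, forall b, K b}.
Proof.
move=> cK Kn; exists (~` K); split.
- by apply: measurableC; exact: measurable_closed.
- by apply: (empirical_limit_support N0 NP) => // n _; exact: Kn.
- by move=> b.
Qed.

Lemma ae_code_support : {ae P, forall b, code_support b}.
Proof. exact: ae_closed closed_code_support (fun n => @code_support_orbit n). Qed.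

Lemma code_support_shift b : code_support b -> code_support (sg b).
Proof. by rewrite /code_support /= sequence_of_permute//; exact: orbit_closure_shift. Qed.

(** Equality holds at the codes of the orbit, and it is a closed condition
    because [T] is continuous. *)
Lemma decode_point_shift : {ae P, forall b, decode_point (sg b) = T (decode_point b)}.
Proof.
pose E := [set b | point_of e dec (sg b) = T (point_of e dec b)].
have aeE : {ae P, forall b, E b}.
  apply: ae_closed => [|n].
    apply: closed_equalizer; first exact: metric_hausdorff.
      move=> b; apply: (@continuous_comp _ _ _ sg (point_of e dec)).
        exact: permute_continuous.
      exact: point_of_continuous.
    move=> b; apply: (@continuous_comp _ _ _ (point_of e dec) T).
      exact: point_of_continuous.
    exact: cT.
  by rewrite /E /= -orbit_codeS !point_of_orbit_code.
apply: (@filterS2 _ _ (ae_filter_ringOfSetsType P) _ _ _ _ ae_code_support aeE).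
move=> b Kb Eb.
have [d1 _] := decode_on Kb; have [d2 _] := decode_on (code_support_shift Kb).
by rewrite /decode_point d1 d2 Eb.
Qed.

Lemma decode_sequence_shift : {ae P, forall b, decode_sequence (sg b) = @Xshift R v (decode_sequence b)}.
Proof.
apply: (@filterS _ _ (ae_filter_ringOfSetsType P) _ _ _ ae_code_support) => b Kb.
have [_ d1] := decode_on Kb; have [_ d2] := decode_on (code_support_shift Kb).
apply: set_val_inj; rewrite /decode_sequence d2 sequence_of_permute// -d1.
by [].
Qed.

Local Notation nu := (law P measurable_decode_point).
Local Notation kappa := (law P measurable_decode_sequence).

Lemma visible_decode_point : visible nu.
Proof.
split.
  apply: (kappa_preserving _ shift_preserving measurable_decode_point decode_point_shift).
  exact: measurable_continuous_map cT.
exists x, N; split=> // f cf.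
under eq_fun do under eq_bigr => n _ do
  rewrite -[iter n T x]/(iter n T x, iter n (@Xshift R v) (Xbase v)).1 -decode_orbit_code.
exact: (law_cvg N0 NP (fun n _ => @code_support_orbit n) closed_code_support decode_pointK decode_point0 (mgam := measurable_decode_point) cf).
Qed.

Lemma in_VS_decode_sequence : in_VS kappa.
Proof.
exists N => // f cf.
under eq_fun do under eq_bigr => n _ do
  rewrite -[iter n _ (Xbase v)]/(iter n T x, iter n (@Xshift R v) (Xbase v)).2 -decode_orbit_code.
exact: (law_cvg N0 NP (fun n _ => @code_support_orbit n) closed_code_support decode_sequenceK decode_sequence0 (mgam := measurable_decode_sequence) cf).
Qed.

(** The average tends to the integral of [f p.1 * pi0 p.2] for the limit joining
    of a visible measure, which is in the class by assumption, and a Furstenberg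
    system. The Veech condition makes this integral vanish. *)
Lemma joint_limit_orthogonal (F : system R -> Prop) (f : tds_space X -> R[i]) :
  characteristic F -> class_C F X -> veech F v -> continuous f ->
  (fun l => (N l)%:R^-1 * \sum_(1 <= n < (N l).+1) f (iter n T x) * v n%:Z)
    @ \oo --> (0 : R[i]).
Proof.
move=> hF FX hv cf.
pose g (p : tds_space X * Xspace v) : R[i] := f p.1 * pi0 p.2.
have cg : continuous g.
  move=> p; apply: cvgM.
    by apply: continuous_comp; [exact: fst_cont|exact: cf].
  by apply: continuous_comp; [exact: snd_cont|exact: pi0_continuous].
have cRe (Y : topologicalType) (h : Y -> R[i]) : continuous h ->
    continuous (fun y => complex.Re (h y)).
  by move=> ch y; apply: continuous_comp; [exact: ch|exact: Re_continuous].
have cIm (Y : topologicalType) (h : Y -> R[i]) : continuous h ->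
    continuous (fun y => complex.Im (h y)).
  by move=> ch y; apply: continuous_comp; [exact: ch|exact: Im_continuous].
have bX (h : tds_space X -> R) : continuous h ->
    bounded_mfun (h : borel (tds_space X) -> R).
  move=> ch; split; first exact: measurable_continuous.
  have decK : cyl_continuous setT dec.
    move=> b _ W /cdec/cyl_nbhs[n nW]; exists n => b' _ bb'; apply: nW.
    by rewrite /cyl /= size_mkseq.
  have dec0 b : ~ [set: cantor_space] b -> dec b = point by move=> /(_ I).
  have [_ [M hM]] := bounded_cyl_continuous closedT decK dec0 ch.
  by exists M => y; rewrite -(repK y); exact: hM.
have bRe : bounded_mfun (fun z : borel (Xspace v) => complex.Re (pi0 z)).
  split; first exact: (measurable_continuous (cRe _ _ (@pi0_continuous R v))).
  exists L => z; apply: le_trans (normr_Re_le _) _.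
  exact: normc_orbit_closure vL (set_valP z).
have bIm : bounded_mfun (fun z : borel (Xspace v) => complex.Im (pi0 z)).
  split; first exact: (measurable_continuous (cIm _ _ (@pi0_continuous R v))).
  exists L => z; apply: le_trans (normr_Im_le _) _.
  exact: normc_orbit_closure vL (set_valP z).
have ReIm (w : R[i]) : complex.Re w +i* complex.Im w = w by case: w.
have decode_pointP : measure_preserving P nu decode_point.
  by split; [exact: measurable_decode_point|move=> B mB].
have [] := joining_orthogonality hF (FX _ visible_decode_point) (@measurable_Xshift R v)
  (@measurable_Xshift_inv R v) (@XshiftK R v) (@Xshift_invK R v) shift_preserving
  (alpha := decode_point) decode_pointP decode_point_shift (mbeta := measurable_decode_sequence) decode_sequence_shift
  (bX _ (cRe _ _ cf)) (bX _ (cIm _ _ cf)) bRe bIm.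
  move=> G Glargest h hL2; under eq_fun do rewrite ReIm.
  exact: hv in_VS_decode_sequence G Glargest h hL2.
move=> I1 I2.
have lim := law_cvg N0 NP (fun n _ => @code_support_orbit n) closed_code_support
  decode_continuous decode_off (mgam := measurable_decode) cg.
have intE (h : tds_space X * Xspace v -> R) : continuous h ->
    \int[law P measurable_decode]_p h p = \int[P]_b h (decode b).
  move=> ch; apply: expect_law; first exact: measurable_continuous.
  exact: (bounded_cyl_continuous closed_code_support decode_continuous decode_off ch).
have int0 : cintegral (law P measurable_decode) g = 0.
  rewrite /cintegral !intE; [|exact: cIm|exact: cRe].
  rewrite (_ : \int[P]_b complex.Re _ = 0); last first.
    rewrite -[RHS]I1; apply: eq_Rintegral => b _; rewrite /g /decode_point /decode_sequence.
    by case: (f _) => ? ?; case: (pi0 _).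
  rewrite (_ : \int[P]_b complex.Im _ = 0)//.
  rewrite -[RHS]I2; apply: eq_Rintegral => b _; rewrite /g /decode_point /decode_sequence.
  by case: (f _) => ? ?; case: (pi0 _).
rewrite int0 in lim.
move: lim; apply: cvg_trans; apply: near_eq_cvg; apply: nearW => l /=.
congr (_ * _); apply: eq_bigr => n _.
have [_ d2] := decode_on (@code_support_orbit n).
rewrite /g /pi0 d2 decode_orbit_code sequence_of_orbit_code.
by rewrite /shift_by add0r.
Qed.

End joint_limit.

Theorem theorem2 (R : realType) (F : system R -> Prop)
    (u : nat -> R[i]) (L : R) (u0 : R[i]) :
  characteristic F ->
  (forall n : nat, (0 < n)%N -> ComplexField.Normc.normc (u n) <= L) ->
  ComplexField.Normc.normc u0 <= L ->
  veech F (extend u u0) ->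
  orthogonal_to_class u (class_C F).
Proof.
move=> hF uL u0L hv X FX f x cf.
pose v : bisequence R := extend u u0.
have vL k : ComplexField.Normc.normc (v k) <= L.
  rewrite /v /extend; case: eqP => // /eqP k0; apply: uL.
  by rewrite lt0n absz_eq0.
have [cT _] := tds_homeo X.
have [e [e' [eK _]]] : exists (e : int * (nat * nat) -> nat) (e' : nat -> int * (nat * nat)),
    cancel e e' /\ cancel e' e.
  by apply: (@nat_bijection _ (fun n => (0, (0%N, n)))) => m n [].
have [dec cdec] := cantor_surj (@tds_compact R X) (@metric_hausdorff R (tds_space X)).
have /choice[rep repK] y : exists b, dec b = y.
  by have [b _ <-] := 'surj_dec (I : setT y); exists b.
move=> U /nbhs_complexP[r r0 rU]; apply: contrapT => nU.
pose Q N := r <= ComplexField.Normc.normc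
  (N%:R^-1 * \sum_(1 <= n < N.+1) f (iter n (@tds_map R X) x) * u n).
(* Otherwise the averages stay away from 0 along infinitely many [N]; a limit
   of joint empirical measures along these contradicts orthogonality. *)
have frequentlyQ M : exists N, (M < N)%N /\ Q N.
  apply: contrapT => nM; apply: nU; exists M.+1 => // N /= MN; apply: rU.
  rewrite ltNge; apply/negP; rewrite sub0r normcN => rN.
  by apply: nM; exists N.
have [N [P [Nincr NQ NP]]] :=
  empirical_limit R (orbit_code v L x e' rep) frequentlyQ.
have N0 l : (0 < N l)%N by have [] := NQ l.
have near0 : nbhs (0 : R[i]) [set w | ComplexField.Normc.normc w < r].
  by apply/nbhs_complexP; exists r => // w; rewrite sub0r normcN.
have [k _ /(_ k (leqnn k))/=] :=
  joint_limit_orthogonal vL cT eK repK cdec Nincr N0 NP hF FX hv cf near0.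
apply/negP; rewrite -leNgt; have [_] := NQ k; rewrite /Q.
congr (r <= ComplexField.Normc.normc (_ * _)).
by apply: eq_big_nat => n /andP[n1 _]; rewrite /v /extend; case: n n1.
Qed.
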